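(* For every prime $p < 2000$, the set $\mathcal{L}_p$ has a least element $\min \mathcal{L}_p$, this least element is an isolated point of $\mathcal{L}_p$, and $\min \mathcal{L}_p$ is the irrational square root of a rational number.
   Context: For a positive integer $n$ and an irrational real $\xi$, define the $n$-Lagrange approximability $\lambda_n(\xi) = \limsup_{s/t \to \xi} \dfrac{\gcd(t,n)}{t^2 \left| \frac{s}{t} - \xi\right|} \in \mathbb{R}\cup\{\infty\}$, where the limsup is over rationals $s/t$ ($s,t\in\mathbb{Z}$, $t>0$) tending to $\xi$. The $n$-Lagrange spectrum is $\mathcal{L}_n = \{\lambda_n(\xi) \in \mathbb{R} : \xi \in \mathbb{R}\setminus\mathbb{Q}\}$ (the set of finite values). *)

(* Defs.v *)
From Stdlib Require Import Reals ZArith Znumtheory.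
From Coquelicot Require Import Coquelicot.
Open Scope R_scope.

Definition irrational (xi : R) : Prop :=
  ~ exists a b : Z, b <> 0%Z /\ xi = IZR a / IZR b.

Definition lag_quot (n : Z) (xi : R) (s t : Z) : R :=
  IZR (Z.gcd t n) / (IZR t ^ 2 * Rabs (IZR s / IZR t - xi)).

Definition lag_sup (n : Z) (xi : R) (eps : R) : Rbar :=
  Rbar_lub (fun y : Rbar => exists s t : Z, (0 < t)%Z /\
     0 < Rabs (IZR s / IZR t - xi) < eps /\ y = Finite (lag_quot n xi s t)).

(* n-Lagrange approximability: limsup_{s/t -> xi} = inf_{eps>0} sup_{...} *)
Definition lagrange_approx (n : Z) (xi : R) : Rbar :=
  Rbar_glb (fun y : Rbar => exists eps : R, 0 < eps /\ y = lag_sup n xi eps).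

Definition lagrange_spectrum (n : Z) (x : R) : Prop :=
  exists xi : R, irrational xi /\ lagrange_approx n xi = Finite x.

(* Main.v *)
(** Following xi down the Stern-Brocot tree gives a word in two letters R, L, whose factors determine how well the
    Farey neighbours of xi approximate it.  The weighted constant of xi is the larger of the ordinary Lagrange
    constants of xi and p xi, so when it is less than C the words of both numbers eventually avoid every factor
    that forces an approximation constant at least C.  The words are linked by Raney's transducer: the integral
        matrix
    of determinant p that takes the current tail of xi to the current tail of p xi is infinitely often doubly
        balanced,
    and there are finitely many such matrices.  For C slightly above the expected minimum a search from all of them
    shows that the word of xi is eventually one of a few periodic words.  Then xi is a root of an integral
    form f of discriminant D, and its constant is p sqrt D / K, where K is the minimum of the values p |f(s,t)| and
    of the dual form f o adj T; both minima are read off the periodic rivers (Conway) of the forms.  All cycles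
        found for
    a given p have the same constant, which is therefore the least element of the spectrum and the only one below
        C. *)

Require Import Defs.
From Stdlib Require Import Reals ZArith Znumtheory.
From Coquelicot Require Import Coquelicot.
From Stdlib Require Import List Bool Lia Lra Psatz Classical.
Import ListNotations.

Open Scope Z_scope.

(** * Words and 2 x 2 matrices *)

(** For C above 3 the condition on one word alone leaves infinitely many possible tails; only the
    link through the matrix makes the surviving branches finite in number. The search branches over
    the letters of xi alone: a letter of p xi is emitted when one row of the matrix dominates the
    other, and is then forced. Neither past is known at a doubly balanced matrix, so both histories
    start empty and a branch dies only by letters seen since then. Exclusion needs just the
    quotients at the two current Farey neighbours. The exact constant of a cycle concerns all
    fractions, and these are handled by forms: s/t becomes a value F(s,t) of one form, the quotient
    is gcd(t,p) (sqrt D + o(1)) / |F(s,t)|, and F(s,t) runs through values of the dual form when p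
    divides t. The certificates are untrusted data; tries, cycles and histories are rechecked by
    Boolean functions. Any C above the minimum for which the search ends would do, and its distance
    to the minimum is the isolation radius. *)

Record mat := Mat { m11 : Z; m12 : Z; m21 : Z; m22 : Z }.

Definition mmul (M N : mat) : mat :=
  Mat (m11 M * m11 N + m12 M * m21 N) (m11 M * m12 N + m12 M * m22 N)
      (m21 M * m11 N + m22 M * m21 N) (m21 M * m12 N + m22 M * m22 N).
Definition madj (M : mat) : mat := Mat (m22 M) (- m12 M) (- m21 M) (m11 M).
Definition mdet (M : mat) : Z := m11 M * m22 M - m12 M * m21 M.
Definition mid : mat := Mat 1 0 0 1.
Definition nonneg (M : mat) : Prop := 0 <= m11 M /\ 0 <= m12 M /\ 0 <= m21 M /\ 0 <= m22 M.

(* A word in the letters R (true) and L (false) is read most recent letter first. *)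
Definition elem (x : bool) : mat := if x then Mat 1 1 0 1 else Mat 1 0 1 1.
Fixpoint rmat (h : list bool) : mat :=
  match h with
  | [] => mid
  | x :: h => let 'Mat a b c d := rmat h in
              if x then Mat a (a + b) c (c + d) else Mat (a + b) b (c + d) d
  end.
(** The letters at times [n-1], [n-2], ..., [n-k], in the order that [rmat] expects, cut off at time
    0. *)
Fixpoint hist (f : nat -> bool) (n k : nat) {struct k} : list bool :=
  match k, n with
  | S k, S n => f n :: hist f n k
  | _, _ => []
  end.

Lemma mat_ext (M N : mat) : m11 M = m11 N -> m12 M = m12 N -> m21 M = m21 N -> m22 M = m22 N -> M = N.
Proof. destruct M, N; simpl; congruence. Qed.

Ltac mat_ring := repeat match goal with M : mat |- _ => destruct M end;
  unfold mdet, madj, mid in *; simpl in *; try apply mat_ext; simpl; ring.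

Lemma mmul_assoc (M N P : mat) : mmul M (mmul N P) = mmul (mmul M N) P.
Proof. mat_ring. Qed.
Lemma mmul_1_l (M : mat) : mmul mid M = M.
Proof. destruct M; unfold mmul, mid; cbn [m11 m12 m21 m22]; f_equal; ring. Qed.
Lemma mmul_1_r (M : mat) : mmul M mid = M.
Proof. destruct M; unfold mmul, mid; cbn [m11 m12 m21 m22]; f_equal; ring. Qed.
Lemma mdet_mul (M N : mat) : mdet (mmul M N) = mdet M * mdet N.
Proof. mat_ring. Qed.
Lemma madj_mul (M N : mat) : madj (mmul M N) = mmul (madj N) (madj M).
Proof. mat_ring. Qed.
Lemma mdet_elem (x : bool) : mdet (elem x) = 1.
Proof. destruct x; reflexivity. Qed.
Lemma mmul_adj_r (M : mat) : mdet M = 1 -> mmul M (madj M) = mid.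
Proof.
  destruct M; unfold mdet, madj, mmul, mid; cbn [m11 m12 m21 m22]; intros H.
  apply mat_ext; cbn [m11 m12 m21 m22]; try ring; rewrite <- H; ring.
Qed.
Lemma mmul_adj_l (M : mat) : mdet M = 1 -> mmul (madj M) M = mid.
Proof.
  destruct M; unfold mdet, madj, mmul, mid; cbn [m11 m12 m21 m22]; intros H.
  apply mat_ext; cbn [m11 m12 m21 m22]; try ring; rewrite <- H; ring.
Qed.
Lemma nonneg_mul (M N : mat) : nonneg M -> nonneg N -> nonneg (mmul M N).
Proof.
  unfold nonneg, mmul; cbn [m11 m12 m21 m22]; intros (?&?&?&?) (?&?&?&?).
  repeat split; apply Z.add_nonneg_nonneg; now apply Z.mul_nonneg_nonneg.
Qed.
Lemma nonneg_elem (x : bool) : nonneg (elem x).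
Proof. destruct x; unfold nonneg; simpl; lia. Qed.
Lemma mmul_elem_l (x : bool) (a b c d : Z) :
  mmul (elem x) (Mat a b c d) = if x then Mat (a + c) (b + d) c d else Mat a b (a + c) (b + d).
Proof. destruct x; apply mat_ext; cbn [mmul elem m11 m12 m21 m22]; ring. Qed.
Lemma mmul_elem_r (x : bool) (a b c d : Z) :
  mmul (Mat a b c d) (elem x) = if x then Mat a (a + b) c (c + d) else Mat (a + b) b (c + d) d.
Proof. destruct x; apply mat_ext; cbn [mmul elem m11 m12 m21 m22]; ring. Qed.
Lemma rmat_cons (x : bool) (h : list bool) : rmat (x :: h) = mmul (rmat h) (elem x).
Proof. simpl. destruct (rmat h). now rewrite mmul_elem_r. Qed.
Lemma mdet_rmat (h : list bool) : mdet (rmat h) = 1.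
Proof. induction h as [|x h IH]; [reflexivity|]. now rewrite rmat_cons, mdet_mul, IH, mdet_elem. Qed.
Lemma nonneg_rmat (h : list bool) : nonneg (rmat h).
Proof.
  induction h as [|x h IH]; [unfold nonneg; simpl; lia|].
  rewrite rmat_cons; apply nonneg_mul; [assumption|apply nonneg_elem].
Qed.
Lemma hist_app (f : nat -> bool) (n j i : nat) :
  (j <= n)%nat -> hist f n (j + i) = hist f n j ++ hist f (n - j) i.
Proof.
  revert n; induction j as [|j IH]; intros n Hn; simpl.
  - rewrite PeanoNat.Nat.sub_0_r. reflexivity.
  - destruct n as [|n]; [lia|]. simpl. rewrite IH by lia. reflexivity.
Qed.
Lemma hist_length (f : nat -> bool) (n k : nat) : (k <= n)%nat -> length (hist f n k) = k.
Proof.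
  revert n; induction k as [|k IH]; intros n Hn; [reflexivity|].
  destruct n as [|n]; [lia|]. simpl. rewrite IH; lia.
Qed.
Lemma hist_prefix (f : nat -> bool) (n k : nat) (h1 h2 : list bool) :
  (k <= n)%nat -> hist f n k = h1 ++ h2 -> h1 = hist f n (length h1) /\ (length h1 <= k)%nat.
Proof.
  intros Hn H.
  assert (L : k = (length h1 + length h2)%nat)
    by (rewrite <- length_app, <- H, hist_length; auto).
  rewrite L, hist_app in H by lia. split; [|lia].
  apply (f_equal (firstn (length h1))) in H.
  rewrite !firstn_app, firstn_all, PeanoNat.Nat.sub_diag in H.
  rewrite hist_length in H by lia. rewrite PeanoNat.Nat.sub_diag in H.
  simpl in H. rewrite !app_nil_r in H.
  rewrite <- (hist_length f n (length h1)) in H at 1 by lia.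
  rewrite firstn_all in H. congruence.
Qed.

(** [j] comes from a certificate and may exceed [k], so the length of the front part is some [i] and
    not [j] itself. *)
Lemma hist_split (f : nat -> bool) (n k j : nat) : (k <= n)%nat ->
  exists i l, (i + l = k)%nat /\ firstn j (hist f n k) = hist f n i /\ skipn j (hist f n k) = hist f (n - i) l.
Proof.
  intros L. assert (E := eq_sym (firstn_skipn j (hist f n k))).
  assert (E' := E). apply hist_prefix in E' as [E1 L1]; [|assumption].
  set (i := length (firstn j (hist f n k))) in *.
  exists i, (k - i)%nat. split; [lia|]. split; [assumption|].
  apply (app_inv_head (firstn j (hist f n k))). rewrite <- E, E1 at 1.
  rewrite <- hist_app by lia. f_equal. lia.
Qed.

(** * Searching through pairs of words *)

(* A word is doomed when it is bad at the cut after its [j] most recent letters, or when both its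
   one-letter continuations are doomed. *)
Inductive doom := Cut (j : nat) | Ahead (l r : doom).
Inductive trie := Dead (s : doom) | Free | Node (l r : trie).

(* With x the future of the cut and y its past, x > V12/V22, 1/x > V21/V11, y >= U12/U11 and
   1/y >= U21/U22; so the word is bad when x + y >= cn/cd or 1/x + 1/y >= cn/cd is forced. *)
Definition bad_cut (cn cd : Z) (V U : mat) : bool :=
  (cn * (m22 V * m11 U) <=? (m12 V * m11 U + m12 U * m22 V) * cd)
  || (cn * (m11 V * m22 U) <=? (m21 V * m22 U + m21 U * m11 V) * cd).
Definition bad_at (cn cd : Z) (h : list bool) (j : nat) : bool :=
  bad_cut cn cd (rmat (firstn j h)) (rmat (skipn j h)).

(** Looks at most [n] letters ahead for a reason why a word is doomed. Nothing is proved about it: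
    [check_trie] rechecks whatever it finds. *)
Fixpoint find_doom (cn cd : Z) (n : nat) (h : list bool) : option doom :=
  match find (bad_at cn cd h) (seq 0 (S (length h))), n with
  | Some j, _ => Some (Cut j)
  | None, O => None
  | None, S n =>
    match find_doom cn cd n (false :: h), find_doom cn cd n (true :: h) with
    | Some l, Some r => Some (Ahead l r)
    | _, _ => None
    end
  end.
Fixpoint insert (h : list bool) (s : doom) (t : trie) : trie :=
  match h, t with
  | _, Dead _ => t
  | [], _ => Dead s
  | x :: h, Node l r => if x then Node l (insert h s r) else Node (insert h s l) r
  | x :: h, Free => if x then Node Free (insert h s Free) else Node (insert h s Free) Free
  end.
(* The binary digits below the leading one, least significant (most recent letter) first. *)
Fixpoint digits (w : positive) : list bool :=
  match w with xH => [] | xO w => false :: digits w | xI w => true :: digits w end.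
Definition mk_trie (cn cd : Z) (ws : list positive) : trie :=
  fold_right (fun w t => let h := digits w in
    match find_doom cn cd 4 h with Some s => insert h s t | None => t end) Free ws.

Fixpoint check_doom (cn cd : Z) (s : doom) (h : list bool) : bool :=
  match s with
  | Cut j => bad_at cn cd h j
  | Ahead l r => check_doom cn cd l (false :: h) && check_doom cn cd r (true :: h)
  end.
(** Descending the trie goes back in time, hence letters are appended at the far end of [h], whereas
    [check_doom] adds future letters at the front. *)
Fixpoint check_trie (cn cd : Z) (t : trie) (h : list bool) : bool :=
  match t with
  | Dead s => check_doom cn cd s h
  | Free => true
  | Node l r => check_trie cn cd l (h ++ [false]) && check_trie cn cd r (h ++ [true])
  end.

(** A history that ends inside the trie counts as alive, so pruning never relies on letters before
    the start of the search. *)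
Fixpoint dead (t : trie) (h : list bool) : bool :=
  match t with
  | Dead _ => true
  | Free => false
  | Node l r => match h with [] => false | x :: h => if x then dead r h else dead l h end
  end.

(** [h0] is the path from the root of the whole trie to the subtree [t]. *)
Lemma dead_doom (cn cd : Z) (t : trie) : forall h0 h,
  check_trie cn cd t h0 = true -> dead t h = true ->
  exists h1 h2 s, h = h1 ++ h2 /\ check_doom cn cd s (h0 ++ h1) = true.
Proof.
  induction t as [s| |l IHl r IHr]; intros h0 h C D; simpl in C, D; [|discriminate|].
  - exists [], h, s. rewrite app_nil_r. auto.
  - apply andb_true_iff in C as [Cl Cr]. destruct h as [|x h]; [discriminate|].
    assert (IH : exists h1 h2 s, h = h1 ++ h2 /\ check_doom cn cd s ((h0 ++ [x]) ++ h1) = true)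
      by (destruct x; auto).
    destruct IH as (h1 & h2 & s & -> & E). rewrite <- app_assoc in E.
    exists (x :: h1), h2, s. auto.
Qed.
(** The actual next letter selects the branch of each [Ahead], so a doomed word becomes bad after
    [i] more letters, whatever these are. *)
Lemma doom_bad (cn cd : Z) (f : nat -> bool) (s : doom) : forall n k,
  check_doom cn cd s (hist f n k) = true ->
  exists i j, bad_at cn cd (hist f (n + i) (k + i)) j = true.
Proof.
  induction s as [j|l IHl r IHr]; intros n k H; simpl in H.
  - exists 0%nat, j. now rewrite !PeanoNat.Nat.add_0_r.
  - apply andb_true_iff in H as [Hl Hr].
    assert (H : exists i j, bad_at cn cd (hist f (S n + i) (S k + i)) j = true)
      by (destruct (f n) eqn:E; [apply IHr|apply IHl]; simpl; rewrite E; assumption).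
    destruct H as (i & j & H). exists (S i), j.
    now rewrite <- !PeanoNat.Nat.add_succ_comm.
Qed.

(** * Forms along a path and cyclic lists *)

(* The form A X^2 + B X Y + C Y^2. *)
Record form := Form { fA : Z; fB : Z; fC : Z }.
(** For A > 0 > C the positive root of the form exceeds 1 exactly when the value at (1,1) is
    negative. *)
Definition letter (f : form) : bool := fA f + fB f + fC f <? 0.
(** One step along Conway's river: the substitution X -> X + Y or Y -> X + Y puts the value at (1,1)
    in place of the outer coefficient of the same sign. The step back, [prevf], uses the value at
    (1,-1). *)
Definition nextf (f : form) : form :=
  let s := fA f + fB f + fC f in
  if s <? 0 then Form (fA f) (2 * fA f + fB f) s else Form s (fB f + 2 * fC f) (fC f).
Definition prevf (f : form) : form :=
  let s := fA f - fB f + fC f in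
  if s <? 0 then Form (fA f) (fB f - 2 * fA f) s else Form s (fB f - 2 * fC f) (fC f).
Fixpoint iterf (n : nat) (f : form) : form :=
  match n with O => f | S n => iterf n (nextf f) end.

(** A state on a surviving cycle: the transducer matrix, the latest input and output letters that
    must have been seen, and the form whose positive root is the current tail of xi. *)
Record entry := Ent { e_mat : mat; e_hi : list bool; e_ho : list bool; e_form : form }.

Fixpoint prefixb (h h' : list bool) : bool :=
  match h, h' with
  | [], _ => true
  | x :: h, y :: h' => if Bool.eqb x y then prefixb h h' else false
  | _, _ => false
  end.
Lemma prefixb_spec (h h' : list bool) : prefixb h h' = true -> exists r, h' = h ++ r.
Proof.
  revert h'; induction h as [|x h IH]; intros h' H; [now exists h'|].
  destruct h' as [|y h']; simpl in H; [discriminate|].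
  destruct (Bool.eqb x y) eqn:E; [|discriminate].
  apply eqb_prop in E as ->. destruct (IH _ H) as [r ->]. now exists r.
Qed.
Definition mat_eqb (M N : mat) : bool :=
  (m11 M =? m11 N) && (m12 M =? m12 N) && (m21 M =? m21 N) && (m22 M =? m22 N).
Lemma mat_eqb_spec (M N : mat) : mat_eqb M N = true -> M = N.
Proof.
  unfold mat_eqb; rewrite !andb_true_iff, !Z.eqb_eq; intros [[[? ?] ?] ?]; now apply mat_ext.
Qed.
Definition form_eqb (f g : form) : bool := (fA f =? fA g) && (fB f =? fB g) && (fC f =? fC g).
Lemma form_eqb_spec (f g : form) : form_eqb f g = true -> f = g.
Proof.
  unfold form_eqb; destruct f, g; simpl; rewrite !andb_true_iff, !Z.eqb_eq; intros [[? ?] ?]; congruence.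
Qed.

Fixpoint links {X : Type} (P : X -> X -> bool) (x0 : X) (l : list X) : bool :=
  match l with
  | [] => true
  | x :: l => P x (match l with [] => x0 | y :: _ => y end) && links P x0 l
  end.
Definition ring_links {X : Type} (P : X -> X -> bool) (l : list X) : bool :=
  match l with [] => false | x :: _ => links P x l end.
Lemma links_next {X : Type} (P : X -> X -> bool) (x0 : X) (l : list X) (x : X) :
  links P x0 l = true -> In x l -> exists y, (y = x0 \/ In y l) /\ P x y = true.
Proof.
  induction l as [|z l IH]; simpl; [tauto|]. rewrite andb_true_iff; intros [H1 H2] [->|H].
  - destruct l as [|y l]; [exists x0|exists y]; simpl; auto.
  - destruct (IH H2 H) as (y & [Hy|Hy] & E); exists y; auto.
Qed.
Lemma ring_next {X : Type} (P : X -> X -> bool) (l : list X) (x : X) :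
  ring_links P l = true -> In x l -> exists y, In y l /\ P x y = true.
Proof.
  destruct l as [|z l]; [discriminate|]. intros H Hx.
  destruct (links_next _ _ _ _ H Hx) as (y & [->|Hy] & E); [exists z|exists y]; simpl in *; auto.
Qed.
Lemma links_prev {X : Type} (P : X -> X -> bool) (x0 : X) (l : list X) (y : X) :
  links P x0 l = true -> l <> [] -> y = x0 \/ In y (tl l) -> exists x, In x l /\ P x y = true.
Proof.
  induction l as [|z l IH]; simpl; [tauto|]. rewrite andb_true_iff; intros [H1 H2] _ Hy.
  destruct l as [|w l].
  - destruct Hy as [->|[]]. exists z; auto.
  - destruct Hy as [Hy|[<-|Hy]].
    + destruct (IH H2) as (x & Hx & E); [easy|now left|]. exists x; auto.
    + exists z; auto.
    + destruct (IH H2) as (x & Hx & E); [easy|now right|]. exists x; auto.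
Qed.
Lemma ring_prev {X : Type} (P : X -> X -> bool) (l : list X) (y : X) :
  ring_links P l = true -> In y l -> exists x, In x l /\ P x y = true.
Proof.
  destruct l as [|z l]; [discriminate|]. intros H Hx.
  apply (links_prev _ _ _ _ H); [easy|]. destruct Hx; auto.
Qed.

(** * Raney's transducer and the pruned search *)

Section Search.
Variable t : trie.

(** The search is in continuation-passing style: a continuation receives the entries [b], [c], [u],
    [v] and the output history, and no list of states is ever built. *)
Definition cont := Z -> Z -> Z -> Z -> list bool -> bool.

(* The matrix (a b; c d) is represented by b, c, u = a - c and v = d - b. *)
Fixpoint emit (n : nat) (b c u v : Z) (ho : list bool) (k : cont) : bool :=
  match n with
  | O => false
  | S n =>
    match u, v with
    | Zpos _, Zpos _ => k b c u v ho
    | Zpos _, _ => if dead t (true :: ho) then true else emit n (- v) c (u - c) (b + v + v) (true :: ho) k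
    | _, Zneg _ => k b c u v ho
    | _, _ => if dead t (false :: ho) then true else emit n b (- u) (c + u + u) (v - b) (false :: ho) k
    end
  end.

(** [e] stands for [u - v], computed once for both letters. At most 199 letters can be emitted in a
    row; running out of fuel makes the check fail. *)
Definition read_R (b c u e : Z) (hi ho : list bool) (k : list bool -> cont) : bool :=
  if dead t (true :: hi) then true else emit 200 (c + u + b) c u (- e) ho (k (true :: hi)).
Definition read_L (b c v e : Z) (hi ho : list bool) (k : list bool -> cont) : bool :=
  if dead t (false :: hi) then true else emit 200 b (c + (b + v)) e v ho (k (false :: hi)).
Definition read (x : bool) (b c u v : Z) (hi ho : list bool) (k : list bool -> cont) : bool :=
  if x then read_R b c u (u - v) hi ho k else read_L b c v (u - v) hi ho k.

Fixpoint explore (fin : list bool -> cont) (n : nat) (hi : list bool) : cont :=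
  fun b c u v ho =>
  match n with
  | O => fin hi b c u v ho
  | S n => (fun e => read_R b c u e hi ho (explore fin n) && read_L b c v e hi ho (explore fin n)) (u - v)
  end.

Definition matches (e : entry) (hi : list bool) (b c u v : Z) (ho : list bool) : bool :=
  mat_eqb (e_mat e) (Mat (c + u) b c (b + v)) && prefixb (e_hi e) hi && prefixb (e_ho e) ho.
Definition fail : list bool -> cont := fun _ _ _ _ _ _ => false.
Definition landed (es : list entry) (N : nat) : list bool -> cont := fun hi b c u v ho =>
  existsb (fun e => matches e hi b c u v ho) es || explore fail N hi b c u v ho.

(* Leaving the cycle at [e] is impossible, and staying on it leads to [e']. *)
Definition follow (N : nat) (e e' : entry) : bool :=
  form_eqb (nextf (e_form e)) (e_form e') &&
  let 'Mat a b c d := e_mat e in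
  read (negb (letter (e_form e))) b c (a - c) (d - b) (e_hi e) (e_ho e) (explore fail N) &&
  read (letter (e_form e)) b c (a - c) (d - b) (e_hi e) (e_ho e) (matches e').

(** * The actual words and matrices as a run of the search *)

Section Run.
Variables (A B : nat -> bool) (T : nat -> nat -> mat) (n0 m0 : nat).
Hypothesis T_in : forall n m, T (S n) m = mmul (T n m) (elem (A n)).
Hypothesis T_out : forall n m, T n m = mmul (elem (B m)) (T n (S m)).
Hypothesis T_R : forall n m, nonneg (T n m) -> m21 (T n m) <= m11 (T n m) -> m22 (T n m) <= m12 (T n m) -> B m =
    true.
Hypothesis T_L : forall n m, nonneg (T n m) -> m11 (T n m) <= m21 (T n m) -> m12 (T n m) <= m22 (T n m) -> B m =
    false.
Hypothesis A_ok : forall n k, (n0 + k <= n)%nat -> dead t (hist A n k) = false.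
Hypothesis B_ok : forall m k, (m0 + k <= m)%nat -> dead t (hist B m k) = false.

Definition at_state (n m k' : nat) (b c u v : Z) (ho : list bool) : Prop :=
  T n m = Mat (c + u) b c (b + v) /\ nonneg (T n m) /\ ho = hist B m k' /\ (m0 + k' <= m)%nat.

(** A letter is emitted only when one row dominates the other, and then [T_R] or [T_L] says that it
    is the true output letter; so a dead output history contradicts [B_ok]. In the case [u <= 0],
    [v < 0], which a positive determinant excludes, [emit] merely stops. *)
Lemma emit_sound (k : cont) (n F : nat) : forall b c u v ho m k',
  at_state n m k' b c u v ho -> emit F b c u v ho k = true ->
  exists m' k'' b' c' u' v' ho', (m <= m')%nat /\ at_state n m' k'' b' c' u' v' ho' /\
    k b' c' u' v' ho' = true.
Proof.
  induction F as [|F IH]; intros b c u v ho m k' S H; simpl in H; [discriminate|].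
  assert (S' := S). destruct S' as (ET & NN & Eho & Hm).
  assert (stay : k b c u v ho = true ->
    exists m' k'' b' c' u' v' ho', (m <= m')%nat /\ at_state n m' k'' b' c' u' v' ho' /\
    k b' c' u' v' ho' = true) by (intros; exists m, k', b, c, u, v, ho; auto).
  assert (hB : forall x, B m = x -> hist B (Datatypes.S m) (Datatypes.S k') = x :: ho)
    by (intros x <-; subst ho; reflexivity).
  assert (hD : dead t (hist B (Datatypes.S m) (Datatypes.S k')) = false) by (apply B_ok; lia).
  assert (TO := T_out n m). assert (TR := T_R n m NN). assert (TL := T_L n m NN).
  rewrite ET in *. unfold nonneg in NN; cbn [m11 m12 m21 m22] in *.
  assert (emit_R : 0 < u -> v <= 0 ->
    (if dead t (true :: ho) then true else emit F (- v) c (u - c) (b + v + v) (true :: ho) k) = true ->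
    exists m' k'' b' c' u' v' ho', (m <= m')%nat /\ at_state n m' k'' b' c' u' v' ho' /\ k b' c' u' v' ho' = true).
  { clear H. intros U V H. specialize (TR ltac:(lia) ltac:(lia)). rewrite (hB true TR) in hD. rewrite hD in H.
    rewrite TR in TO. destruct (T n (Datatypes.S m)) as [a1 b1 c1 d1] eqn:ET'.
    rewrite mmul_elem_l in TO. injection TO as T1 T2 T3 T4.
    edestruct (IH (- v) c (u - c) (b + v + v) (true :: ho) (Datatypes.S m) (Datatypes.S k'))
      as (m' & k2 & b2 & c2 & u2 & v2 & h2 & R1 & R2); [|exact H|].
    - unfold at_state. rewrite ET', (hB true TR). unfold nonneg; cbn [m11 m12 m21 m22].
      repeat split; try lia. f_equal; lia.
    - exists m', k2, b2, c2, u2, v2, h2. split; [lia|exact R2]. }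
  assert (emit_L : u <= 0 -> 0 <= v ->
    (if dead t (false :: ho) then true else emit F b (- u) (c + u + u) (v - b) (false :: ho) k) = true ->
    exists m' k'' b' c' u' v' ho', (m <= m')%nat /\ at_state n m' k'' b' c' u' v' ho' /\ k b' c' u' v' ho' = true).
  { clear H. intros U V H. specialize (TL ltac:(lia) ltac:(lia)). rewrite (hB false TL) in hD. rewrite hD in H.
    rewrite TL in TO. destruct (T n (Datatypes.S m)) as [a1 b1 c1 d1] eqn:ET'.
    rewrite mmul_elem_l in TO. injection TO as T1 T2 T3 T4.
    edestruct (IH b (- u) (c + u + u) (v - b) (false :: ho) (Datatypes.S m) (Datatypes.S k'))
      as (m' & k2 & b2 & c2 & u2 & v2 & h2 & R1 & R2); [|exact H|].
    - unfold at_state. rewrite ET', (hB false TL). unfold nonneg; cbn [m11 m12 m21 m22].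
      repeat split; try lia. f_equal; lia.
    - exists m', k2, b2, c2, u2, v2, h2. split; [lia|exact R2]. }
  destruct u, v; (apply stay; exact H) || (apply emit_R; [lia|lia|exact H]) || (apply emit_L; [lia|lia|exact H]).
Qed.

Lemma read_sound (k : list bool -> cont) (n m i k' : nat) (x : bool) (b c u v : Z) (ho : list bool) :
  at_state n m k' b c u v ho -> (n0 + i <= n)%nat -> A n = x ->
  read x b c u v (hist A n i) ho k = true ->
  exists m' k'' b' c' u' v' ho', (m <= m')%nat /\ at_state (S n) m' k'' b' c' u' v' ho' /\
    k (hist A (S n) (S i)) b' c' u' v' ho' = true.
Proof.
  intros (ET & NN & Eho & Hm) Hi Ax H.
  assert (hD := A_ok (S n) (S i) ltac:(lia)).
  assert (TI := T_in n m). rewrite Ax in TI.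
  assert (NN' : nonneg (T (S n) m)) by (rewrite TI; apply nonneg_mul; [assumption|apply nonneg_elem]).
  assert (Eh : hist A (S n) (S i) = x :: hist A n i) by (simpl; congruence).
  rewrite Eh in *. rewrite ET, mmul_elem_r in TI.
  destruct x; unfold read, read_R, read_L in H; rewrite hD in H.
  - eapply emit_sound; [|exact H]. repeat split; try apply NN'; [|exact Eho|assumption]. rewrite TI. f_equal; lia.
  - eapply emit_sound; [|exact H]. repeat split; try apply NN'; [|exact Eho|assumption]. rewrite TI. f_equal; lia.
Qed.

Lemma explore_sound (fin : list bool -> cont) (N : nat) : forall n m i k' a b c d ho,
  at_state n m k' a b c d ho -> (n0 + i <= n)%nat ->
  explore fin N (hist A n i) a b c d ho = true ->
  exists m' k'' a' b' c' d' ho', (m <= m')%nat /\ at_state (n + N) m' k'' a' b' c' d' ho' /\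
    fin (hist A (n + N) (i + N)) a' b' c' d' ho' = true.
Proof.
  induction N as [|N IH]; intros n m i k' a b c d ho HS Hi H.
  - rewrite !PeanoNat.Nat.add_0_r. exists m, k', a, b, c, d, ho. auto.
  - cbn [explore] in H. apply andb_true_iff in H as [HR HL].
    assert (H : read (A n) a b c d (hist A n i) ho (explore fin N) = true)
      by (destruct (A n); assumption).
    destruct (read_sound _ _ _ _ _ _ _ _ _ _ _ HS Hi eq_refl H)
      as (m1 & k1 & b1 & c1 & u1 & v1 & h1 & L1 & S1 & H1).
    destruct (IH (S n) m1 (S i) _ _ _ _ _ _ S1 ltac:(lia) H1) as (m' & k'' & a' & b' & c' & d' & ho' & L & S' & F).
    exists m', k'', a', b', c', d', ho'.
    replace (n + S N)%nat with (S n + N)%nat by lia.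
    replace (i + S N)%nat with (S i + N)%nat by lia.
    split; [lia|auto].
Qed.

Definition on_entry (n m : nat) (e : entry) : Prop :=
  T n m = e_mat e /\ nonneg (T n m) /\
  e_hi e = hist A n (length (e_hi e)) /\ (n0 + length (e_hi e) <= n)%nat /\
  e_ho e = hist B m (length (e_ho e)) /\ (m0 + length (e_ho e) <= m)%nat.

Lemma matches_sound (e : entry) (n m i k' : nat) (a b c d : Z) (ho : list bool) :
  at_state n m k' a b c d ho -> (n0 + i <= n)%nat ->
  matches e (hist A n i) a b c d ho = true -> on_entry n m e.
Proof.
  intros (ET & NN & -> & Hm) Hi H. unfold matches in H.
  rewrite !andb_true_iff in H; destruct H as [[H1 H2] H3].
  apply mat_eqb_spec in H1. apply prefixb_spec in H2 as [r2 H2]. apply prefixb_spec in H3 as [r3 H3].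
  apply hist_prefix in H2 as [H2 L2]; [|lia]. apply hist_prefix in H3 as [H3 L3]; [|lia].
  unfold on_entry. repeat split; try apply NN; try lia; congruence.
Qed.

(** With [fail] at the end success means that every branch dies, but the true words stay alive on
    one of them. *)
Lemma explore_fail (N n m i k' : nat) (a b c d : Z) (ho : list bool) :
  at_state n m k' a b c d ho -> (n0 + i <= n)%nat ->
  explore fail N (hist A n i) a b c d ho = true -> False.
Proof.
  intros HS Hi H. destruct (explore_sound _ _ _ _ _ _ _ _ _ _ _ HS Hi H)
    as (? & ? & ? & ? & ? & ? & ? & _ & _ & F). discriminate F.
Qed.

Lemma follow_sound (N n m : nat) (e e' : entry) :
  on_entry n m e -> follow N e e' = true ->
  A n = letter (e_form e) /\ e_form e' = nextf (e_form e) /\ exists m', on_entry (S n) m' e'.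
Proof.
  intros (ET & NN & Hi & Li & Ho & Lo) H. unfold follow in H.
  apply andb_true_iff in H as [Hf H]. apply form_eqb_spec in Hf.
  destruct (e_mat e) as [a b c d]. apply andb_true_iff in H as [H1 H2].
  assert (HS : at_state n m (length (e_ho e)) b c (a - c) (d - b) (e_ho e)).
  { repeat split; auto; try apply NN. rewrite ET. f_equal; lia. }
  rewrite Hi in H1, H2.
  assert (EA : A n = letter (e_form e)).
  { destruct (Bool.bool_dec (A n) (letter (e_form e))) as [E|E]; [assumption|exfalso].
    assert (E' : A n = negb (letter (e_form e))) by (destruct (A n), (letter (e_form e)); easy).
    destruct (read_sound _ _ _ _ _ _ _ _ _ _ _ HS Li E' H1)
      as (m1 & k1 & a1 & b1 & c1 & d1 & h1 & L1 & S1 & F1).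
    eapply explore_fail; [exact S1| |exact F1]; lia. }
  split; [assumption|]. split; [now symmetry|].
  destruct (read_sound _ _ _ _ _ _ _ _ _ _ _ HS Li EA H2)
    as (m1 & k1 & a1 & b1 & c1 & d1 & h1 & L1 & S1 & F1).
  exists m1. eapply matches_sound; [exact S1| |exact F1]; lia.
Qed.

(** Once on an entry the run is forced round the ring for ever, so all later input letters are those
    of the periodic path of the form. *)
Lemma ring_sound (N : nat) (es : list entry) (j : nat) : forall n m e,
  ring_links (follow N) es = true -> In e es -> on_entry n m e ->
  A (n + j)%nat = letter (iterf j (e_form e)).
Proof.
  induction j as [|j IH]; intros n m e HR He HE;
    destruct (ring_next _ _ _ HR He) as (e' & He' & F);
    destruct (follow_sound _ _ _ _ _ HE F) as (EA & Ef & m' & HE').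
  - now rewrite PeanoNat.Nat.add_0_r.
  - replace (n + S j)%nat with (S n + j)%nat by lia. simpl iterf. rewrite <- Ef.
    apply (IH _ _ _ HR He' HE').
Qed.

(** Both histories start empty, so nothing about the letters before times [n] and [m] enters. After
    [N0] letters the run is on a cycle or would have to die within [N1] more. *)
Lemma search_sound (N0 N1 : nat) (cycles : list (list entry)) (n m : nat) (a b c d : Z) :
  (forall es, In es cycles -> ring_links (follow N1) es = true) ->
  explore (landed (concat cycles) N1) N0 [] b c (a - c) (d - b) [] = true ->
  T n m = Mat a b c d -> nonneg (T n m) -> (n0 <= n)%nat -> (m0 <= m)%nat ->
  exists n' m' es e, In es cycles /\ In e es /\ T n' m' = e_mat e /\
    forall j, A (n' + j)%nat = letter (iterf j (e_form e)).
Proof.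
  intros HR H ET NN Hn Hm.
  assert (HS : at_state n m 0 b c (a - c) (d - b) []).
  { repeat split; auto; try apply NN; [rewrite ET; f_equal; lia|lia]. }
  destruct (explore_sound (landed (concat cycles) N1) N0 n m 0 _ _ _ _ _ _ HS ltac:(lia) H)
    as (m1 & k1 & a1 & b1 & c1 & d1 & h1 & L1 & S1 & F1).
  unfold landed in F1. apply orb_true_iff in F1 as [F1|F1].
  - apply existsb_exists in F1 as (e & He & F1). apply in_concat in He as (es & Hes & He).
    assert (HE : on_entry (n + N0) m1 e) by (eapply matches_sound; [exact S1| |exact F1]; lia).
    exists (n + N0)%nat, m1, es, e. repeat split; auto; [apply HE|].
    intros j. eapply ring_sound; [apply HR; exact Hes|exact He|exact HE].
  - exfalso. eapply explore_fail; [exact S1| |exact F1]; lia.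
Qed.

End Run.
End Search.

(** * Rivers of indefinite forms *)

Definition feval (f : form) (u v : Z) : Z := fA f * u ^ 2 + fB f * (u * v) + fC f * v ^ 2.
Definition fcomp (f : form) (M : mat) : form :=
  let 'Mat a b c d := M in
  Form (fA f * a ^ 2 + fB f * (a * c) + fC f * c ^ 2)
       (2 * fA f * (a * b) + fB f * (a * d + b * c) + 2 * fC f * (c * d))
       (fA f * b ^ 2 + fB f * (b * d) + fC f * d ^ 2).
Definition disc (f : form) : Z := fB f ^ 2 - 4 * fA f * fC f.

Lemma feval_comp (f : form) (M : mat) (u v : Z) :
  feval (fcomp f M) u v = feval f (m11 M * u + m12 M * v) (m21 M * u + m22 M * v).
Proof. destruct M as [a b c d]; unfold feval, fcomp; cbn [fA fB fC m11 m12 m21 m22]. ring. Qed.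

(** Both directions are tested, so that a ring is closed under [nextf] and [prevf]; the descent in
    [river_min] follows the river forwards and backwards. *)
Definition flink (f g : form) : bool := form_eqb (nextf f) g && form_eqb (prevf g) f.
Definition river (q K : Z) (fs : list form) : bool :=
  ring_links flink fs && forallb (fun f => (K <=? q * fA f) && (K <=? q * - fC f)) fs.

Lemma river_bounds (q K : Z) (fs : list form) (f : form) :
  river q K fs = true -> In f fs -> K <= q * fA f /\ K <= q * - fC f.
Proof.
  unfold river. rewrite andb_true_iff, forallb_forall. intros [_ H] Hf.
  specialize (H f Hf). now rewrite andb_true_iff, !Z.leb_le in H.
Qed.
Lemma river_next (q K : Z) (fs : list form) (f : form) :
  river q K fs = true -> In f fs -> In (nextf f) fs.
Proof.
  unfold river. rewrite andb_true_iff. intros [H _] Hf.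
  destruct (ring_next _ _ _ H Hf) as (g & Hg & E). apply andb_true_iff in E as [E _].
  apply form_eqb_spec in E. now rewrite E.
Qed.
Lemma river_prev (q K : Z) (fs : list form) (f : form) :
  river q K fs = true -> In f fs -> In (prevf f) fs.
Proof.
  unfold river. rewrite andb_true_iff. intros [H _] Hf.
  destruct (ring_prev _ _ _ H Hf) as (g & Hg & E). apply andb_true_iff in E as [_ E].
  apply form_eqb_spec in E. now rewrite E.
Qed.

(* A u^2 + B u v + C v^2 = A u (u - v) + (A + B + C) u v + C v (v - u), and for 0 < u < v all three
   terms are negative when A + B + C < 0. *)
Lemma convex_neg (q K A B C u v : Z) : 0 < q -> 0 < K -> K <= q * A -> K <= q * - C -> K <= q * - (A + B + C) ->
  0 < u < v -> K <= q * Z.abs (A * u ^ 2 + B * (u * v) + C * v ^ 2).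
Proof.
  intros Q K0 HA HC HS H.
  replace (A * u ^ 2 + B * (u * v) + C * v ^ 2) with (- (A * (u * (v - u)) + (- (A + B + C)) * (u * v) + (- C) * (v
      * (v - u)))) by ring.
  assert (P1 : 0 < u * (v - u)) by nia. assert (P2 : 0 < u * v) by nia. assert (P3 : 0 < v * (v - u)) by nia.
  rewrite Z.abs_opp, <- (Z.abs_eq q) at 1 by lia. rewrite <- Z.abs_mul, Z.abs_eq; nia.
Qed.
Lemma convex_pos (q K A B C u v : Z) : 0 < q -> 0 < K -> K <= q * A -> K <= q * - C -> K <= q * (A + B + C) ->
  0 < v < u -> K <= q * Z.abs (A * u ^ 2 + B * (u * v) + C * v ^ 2).
Proof.
  intros Q K0 HA HC HS H.
  assert (E := convex_neg q K (- C) (- B) (- A) v u Q K0 ltac:(lia) ltac:(lia) ltac:(lia) H).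
  replace (A * u ^ 2 + B * (u * v) + C * v ^ 2) with (- (- C * v ^ 2 + - B * (v * u) + - A * u ^ 2)) by ring.
  now rewrite Z.abs_opp.
Qed.

(** Conway's principle that values grow away from the river. The descent is on |u| + |v|: a vector
    either becomes shorter in the coordinates of a neighbouring form on the river or lies beside the
    river, where the convexity lemmas apply. *)
Lemma river_min (q K : Z) (fs : list form) : 0 < q -> 0 < K -> river q K fs = true ->
  forall f u v, In f fs -> (u <> 0 \/ v <> 0) -> K <= q * Z.abs (feval f u v).
Proof.
  intros Q K0 HR.
  enough (W : forall n f u v, In f fs -> (u <> 0 \/ v <> 0) -> Z.abs u + Z.abs v < Z.of_nat n -> K <= q * Z.abs
      (feval f u v)).
  { intros f u v Hf N. apply (W (S (Z.to_nat (Z.abs u + Z.abs v)))); auto. lia. }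
  induction n as [|n IH]; intros f u v Hf N L; [lia|].
  destruct (river_bounds _ _ _ _ HR Hf) as [BA BC].
  assert (Hn := river_next _ _ _ _ HR Hf). assert (Hp := river_prev _ _ _ _ HR Hf).
  assert (Bn := river_bounds _ _ _ _ HR Hn). assert (Bp := river_bounds _ _ _ _ HR Hp).
  assert (neg : forall u v, feval f (- u) (- v) = feval f u v) by (intros; unfold feval; ring).
  (* by the symmetry (u,v) -> (-u,-v) we may take v >= 0 *)
  assert (W : forall u v, 0 <= v -> (u <> 0 \/ v <> 0) -> Z.abs u + Z.abs v < Z.of_nat (S n) -> K <= q * Z.abs
      (feval f u v)).
  { clear u v N L. intros u v V N L.
    assert (C1 : v = 0 \/ u = 0 \/ (0 < u /\ 0 < v) \/ (u < 0 /\ 0 < v)) by lia.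
    destruct C1 as [->|[->|[[U V']|[U V']]]].
    - unfold feval. replace (fA f * u ^ 2 + fB f * (u * 0) + fC f * 0 ^ 2) with (fA f * u ^ 2) by ring.
      rewrite Z.abs_eq by nia. assert (1 <= u ^ 2) by nia. nia.
    - unfold feval. replace (fA f * 0 ^ 2 + fB f * (0 * v) + fC f * v ^ 2) with (- (- fC f * v ^ 2)) by ring.
      rewrite Z.abs_opp, Z.abs_eq by nia. assert (1 <= v ^ 2) by nia. nia.
    (* In the first quadrant the sign of the value at (1,1) tells which half lies ahead along the
       river and which half is off it. The second quadrant is treated alike with [prevf] and the
       value at (1,-1). *)
    - unfold nextf in Hn, Bn. destruct (fA f + fB f + fC f <? 0); cbn [fA fB fC] in Bn.
      + destruct (Z_lt_le_dec u v) as [W|W]; [apply convex_neg; lia|].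
        replace (feval f u v) with (feval (Form (fA f) (2 * fA f + fB f) (fA f + fB f + fC f)) (u - v) v)
          by (unfold feval; cbn [fA fB fC]; ring). apply IH; [assumption|lia|lia].
      + destruct (Z_lt_le_dec v u) as [W|W]; [apply convex_pos; lia|].
        replace (feval f u v) with (feval (Form (fA f + fB f + fC f) (fB f + 2 * fC f) (fC f)) u (v - u))
          by (unfold feval; cbn [fA fB fC]; ring). apply IH; [assumption|lia|lia].
    - unfold prevf in Hp, Bp. destruct (fA f - fB f + fC f <? 0); cbn [fA fB fC] in Bp.
      + destruct (Z_lt_le_dec (- u) v) as [W|W].
        * replace (feval f u v) with (fA f * (- u) ^ 2 + (- fB f) * ((- u) * v) + fC f * v ^ 2) by (unfold feval;
            ring).
          apply convex_neg; lia.
        * replace (feval f u v) with (feval (Form (fA f) (fB f - 2 * fA f) (fA f - fB f + fC f)) (u + v) v)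
            by (unfold feval; cbn [fA fB fC]; ring). apply IH; [assumption|lia|lia].
      + destruct (Z_lt_le_dec v (- u)) as [W|W].
        * replace (feval f u v) with (fA f * (- u) ^ 2 + (- fB f) * ((- u) * v) + fC f * v ^ 2) by (unfold feval;
            ring).
          apply convex_pos; lia.
        * replace (feval f u v) with (feval (Form (fA f - fB f + fC f) (fB f - 2 * fC f) (fC f)) u (u + v))
            by (unfold feval; cbn [fA fB fC]; ring). apply IH; [assumption|lia|lia]. }
  destruct (Z_le_gt_dec 0 v) as [V|V]; [now apply W|].
  rewrite <- neg. apply W; lia.
Qed.

Lemma iterf_add (n m : nat) (f : form) : iterf (n + m) f = iterf m (iterf n f).
Proof. revert f; induction n as [|n IH]; intros f; simpl; auto. Qed.
Lemma iterf_S (n : nat) (f : form) : iterf (S n) f = nextf (iterf n f).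
Proof. rewrite <- (Nat.add_1_r n), iterf_add. reflexivity. Qed.

Lemma links_iterf (x0 : form) (fs : list form) (f : form) :
  links flink x0 (f :: fs) = true ->
  iterf (S (length fs)) f = x0 /\ forall g, In g (f :: fs) -> exists i, (i <= length fs)%nat /\ iterf i f = g.
Proof.
  revert f; induction fs as [|h fs IH]; intros f H.
  - simpl in H. rewrite andb_true_r in H. apply andb_true_iff in H as [H _]. apply form_eqb_spec in H.
    split; [assumption|]. intros g [<-|[]]. now exists 0%nat.
  - remember (h :: fs) as l eqn:El. simpl in H. apply andb_true_iff in H as [H1 H2]. subst l.
    apply andb_true_iff in H1 as [H1 _]. apply form_eqb_spec in H1.
    destruct (IH h H2) as [E1 E2]. split.
    + simpl length. change (iterf (S (S (length fs))) f) with (iterf (S (length fs)) (nextf f)). now rewrite H1.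
    + intros g [<-|Hg]; [exists 0%nat; split; [lia|reflexivity]|].
      destruct (E2 g Hg) as (i & Li & Ei). exists (S i). split; [simpl; lia|]. simpl. now rewrite H1.
Qed.
Lemma river_io (q K : Z) (fs : list form) (f g : form) (n0 : nat) :
  river q K fs = true -> In f fs -> In g fs -> exists n, (n0 <= n)%nat /\ iterf n f = g.
Proof.
  intros H Hf Hg. apply andb_true_iff in H as [H _]. destruct fs as [|f0 fs]; [destruct Hf|].
  destruct (links_iterf _ _ _ H) as [E1 E2]. set (L := S (length fs)) in *.
  destruct (E2 f Hf) as (i & Li & <-). destruct (E2 g Hg) as (j & Lj & <-).
  assert (P : forall k, iterf (k * L) f0 = f0)
    by (induction k as [|k IH]; [reflexivity|]; change (S k * L)%nat with (L + k * L)%nat; rewrite iterf_add, E1;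
        assumption).
  (* Finish the current round, go round [n0] more times to get past [n0], then walk from the first
     form to [g]. *)
  exists ((L - i) + n0 * L + j)%nat. split; [unfold L; nia|].
  rewrite <- iterf_add. replace (i + (L - i + n0 * L + j))%nat with ((S n0) * L + j)%nat by (unfold L in *; lia).
  now rewrite iterf_add, P.
Qed.
Lemma river_iter (q K : Z) (fs : list form) (f : form) (n : nat) :
  river q K fs = true -> In f fs -> In (iterf n f) fs.
Proof.
  intros H; revert f; induction n as [|n IH]; intros f Hf; [assumption|]. simpl. apply IH. eapply river_next;
      eassumption.
Qed.

(** * Enumeration of doubly balanced matrices *)

(* Follows the convex hull of a lattice of index p: the last two points are (c + u, d - v) and (c, d), and the
   next one is the first of the points (c - u, d + v) + i (c, d) with a nonnegative abscissa. *)
Fixpoint chain (k : Z -> Z -> Z -> Z -> bool) (n : nat) (c d u v : Z) : bool :=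
  match n with
  | O => false
  | S n =>
    match c ?= d with
    | Lt => k (d - v) c u v
    | Eq => true
    | Gt => (fun w => match w with
                      | Zneg _ => chain k n c d (- w) (v + d)
                      | _ => chain k n w (d + v) u v
                      end) (c - u)
    end
  end.
Fixpoint all_from (j : Z) (n : nat) (k : Z -> bool) : bool :=
  match n with O => true | S n => k j && all_from (j + 1) n k end.
(** The rows of the matrix span a lattice of index [p]. For prime [p] it is spanned by (1,0) and
    (0,p), or by (p,0) and (j,1) for one j below [p]; these are the starting points. *)
Definition all_balanced (p : Z) (k : Z -> Z -> Z -> Z -> bool) : bool :=
  k 0 0 1 p && all_from 0 (Z.to_nat p) (fun j => chain k (S (Z.to_nat p)) j 1 (p - j) 1).

Lemma all_from_spec (n : nat) (k : Z -> bool) (j0 j : Z) :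
  all_from j0 n k = true -> j0 <= j < j0 + Z.of_nat n -> k j = true.
Proof.
  revert j0; induction n as [|n IH]; intros j0; simpl all_from; [lia|]. rewrite andb_true_iff. intros [H1 H2] L.
  destruct (Z.eq_dec j j0) as [->|]; [assumption|]. apply (IH (j0 + 1)); [assumption|lia].
Qed.

(** While the abscissa is negative, [chain] just adds the last point once more; [m] such rounds
    belong to a single step of the hull. *)
Lemma chain_turn (k : Z -> Z -> Z -> Z -> bool) (a b : Z) (m : nat) : forall f u v, b < a -> 0 < a -> 0 < u ->
  chain k (m + f) a b (Z.of_nat m * a + u) v = chain k f a b u (v + Z.of_nat m * b).
Proof.
  induction m as [|m IH]; intros f u v L A U.
  - f_equal; lia.
  - cbn [chain Nat.add]. rewrite (proj2 (Z.compare_gt_iff a b)) by lia.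
    destruct (a - (Z.of_nat (S m) * a + u)) eqn:E; [nia|nia|].
    replace (- Z.neg p) with (Z.of_nat m * a + u) by lia.
    rewrite IH by lia. f_equal; lia.
Qed.

(** The hull is traced backwards: the point before (a,b) and (c,d) is q (a,b) - (c,d) with q the
    ceiling of d/b, and its ordinate is less than b. The descent ends at ordinate 0, where a divides
    [p], so that the point is (p,0). The last inequality accounts for the fuel: each round lowers
    the abscissa by at least one. *)
Lemma chain_reaches (p : Z) (k : Z -> Z -> Z -> Z -> bool) (F : nat) : prime p -> (Z.to_nat p < F)%nat ->
  forall n a b c d, b = Z.of_nat n -> 2 <= a -> a * d - b * c = p -> 0 <= c < a -> b < a -> b < d ->
  exists j f, 0 <= j < p /\ chain k F j 1 (p - j) 1 = chain k f c d (a - c) (d - b) /\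
    Z.of_nat F <= Z.of_nat f + p - a.
Proof.
  intros Pp LF. assert (P1 := prime_ge_2 p Pp).
  induction n as [n IH] using (well_founded_induction Wf_nat.lt_wf).
  intros a b c d Eb Ha D C B1 B2.
  destruct (Z.eq_dec b 0) as [E0|N0].
  - subst b. rewrite E0 in *. assert (Dv : (a | p)) by (exists d; lia).
    destruct (prime_divisors p Pp a Dv) as [|[|[->|]]]; try lia.
    assert (d = 1) by nia. subst d. exists c, F. repeat split; lia.
  - assert (Hb : 0 < b) by lia.
    set (q := - ((- d) / b)).
    assert (Hq : 0 <= q * b - d < b).
    { unfold q. assert (E := Z_div_mod_eq_full (- d) b). assert (M := Z.mod_pos_bound (- d) b Hb). lia. }
    set (a0 := q * a - c). set (b0 := q * b - d) in *.
    assert (Q2 : 2 <= q) by (destruct (Z_le_gt_dec q 1); [exfalso; assert (q * b <= 1 * b) by (apply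
        Z.mul_le_mono_nonneg_r; lia); lia|lia]).
    assert (QA : (q - 2) * 1 <= (q - 2) * a) by (apply Z.mul_le_mono_nonneg_l; lia).
    assert (HA : a < a0) by (unfold a0; lia).
    assert (D0 : a0 * b - b0 * a = p) by (unfold a0, b0; lia).
    destruct (IH (Z.to_nat b0) ltac:(lia) a0 b0 a b) as (j & f & Hj & E & Lf); try lia.
    assert (a0 <= p).
    { assert (b0 * a <= (b - 1) * a) by (apply Z.mul_le_mono_nonneg_r; lia).
      assert (a0 * b - (b - 1) * a <= p) by lia. assert (0 <= (a0 - a) * (b - 1)) by (apply Z.mul_nonneg_nonneg;
          lia). lia. }
    set (m := Z.to_nat (q - 2)).
    assert (Em : Z.of_nat m = q - 2) by (unfold m; lia).
    assert (Hf : exists f', f = (m + S f')%nat).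
    { exists (f - S m)%nat. unfold a0 in Lf. lia. }
    destruct Hf as [f' ->]. exists j, f'. split; [assumption|]. split; [|unfold a0 in Lf; lia].
    rewrite E. replace (a0 - a) with (Z.of_nat m * a + (a - c)) by (rewrite Em; unfold a0; ring).
    rewrite chain_turn by lia. cbn [chain]. rewrite (proj2 (Z.compare_gt_iff a b)) by lia.
    replace (a - (a - c)) with c by ring.
    replace (b - b0 + Z.of_nat m * b) with (d - b) by (rewrite Em; unfold b0; ring).
    replace (b + (d - b)) with d by ring. destruct c; [reflexivity|reflexivity|lia].
Qed.

Lemma all_balanced_spec (p : Z) (k : Z -> Z -> Z -> Z -> bool) (a b c d : Z) : prime p ->
  all_balanced p k = true -> a * d - b * c = p -> 0 <= b < a -> 0 <= c < a -> b < d -> c < d ->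
  k b c (a - c) (d - b) = true.
Proof.
  intros Pp H D B C B2 C2. apply andb_true_iff in H as [H0 H].
  assert (P2 := prime_ge_2 p Pp).
  destruct (Z.eq_dec a 1) as [->|Na].
  - replace b with 0 by lia. replace c with 0 by lia. replace (d - 0) with p by lia. exact H0.
  - destruct (chain_reaches p k (S (Z.to_nat p)) Pp ltac:(lia) (Z.to_nat b) a b c d) as (j & f & Hj & E & Lf); try
      lia.
    assert (H1 := all_from_spec _ _ _ j H ltac:(lia)). cbv beta in H1. rewrite E in H1.
    assert (Hf : exists f', f = S f') by (exists (pred f); lia).
    destruct Hf as [f' ->]. cbn [chain] in H1.
    rewrite (proj2 (Z.compare_lt_iff c d)) in H1 by lia.
    now replace (d - (d - b)) with b in H1 by ring.
Qed.

Open Scope R_scope.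

(** * Farey paths of real numbers *)

(** The relation y = M x with denominators cleared, so that composing and inverting need no
    division. *)
Definition mob (M : mat) (x y : R) : Prop :=
  (IZR (m21 M) * x + IZR (m22 M)) * y = IZR (m11 M) * x + IZR (m12 M).

Lemma mob_mul (M N : mat) (x y z : R) : mob M x y -> mob N y z -> mob (mmul N M) x z.
Proof.
  unfold mob, mmul; cbn [m11 m12 m21 m22]; rewrite !plus_IZR, !mult_IZR; intros H1 H2.
  transitivity ((IZR (m21 M) * x + IZR (m22 M)) * ((IZR (m21 N) * y + IZR (m22 N)) * z)).
  - transitivity ((IZR (m21 N) * (IZR (m11 M) * x + IZR (m12 M)) + IZR (m22 N) * (IZR (m21 M) * x + IZR (m22 M))) *
      z);
      [ring|]. rewrite <- H1. ring.
  - rewrite H2. transitivity (IZR (m11 N) * (IZR (m11 M) * x + IZR (m12 M)) + IZR (m12 N) * (IZR (m21 M) * x + IZR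
      (m22 M)));
      [rewrite <- H1|]; ring.
Qed.
Lemma mob_adj (M : mat) (x y : R) : mob M x y -> mob (madj M) y x.
Proof. unfold mob, madj; cbn [m11 m12 m21 m22]; rewrite !opp_IZR; intros H; lra. Qed.
Lemma mob_id (x : R) : mob mid x x.
Proof. unfold mob, mid; simpl; ring. Qed.

Lemma irrational_mob (M : mat) (x y : R) : mdet M <> 0%Z -> mob M x y -> irrational y -> irrational x.
Proof.
  unfold mob, mdet; intros D H I (p & q & Hq & ->). apply I. apply eq_IZR_contrapositive in Hq.
  assert (E : IZR (m21 M * p + m22 M * q) * y = IZR (m11 M * p + m12 M * q)).
  { rewrite !plus_IZR, !mult_IZR. apply (f_equal (fun u => u * IZR q)) in H.
    field_simplify in H; try assumption. lra. }
  destruct (Z.eq_dec (m21 M * p + m22 M * q) 0) as [Z0|Z0].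
  (* If the denominator of M vanished at p/q, so would the numerator, against the nonzero
     determinant. *)
  - exfalso. rewrite Z0, Rmult_0_l in E. symmetry in E. apply eq_IZR in E.
    assert (q <> 0)%Z by (intros ->; now apply Hq).
    assert (X : ((m11 M * m22 M - m12 M * m21 M) * q = m11 M * (m21 M * p + m22 M * q) - m21 M * (m11 M * p + m12 M
        * q))%Z) by ring.
    rewrite Z0, E in X. apply D. apply Z.eq_mul_0_l with q; [|assumption]. rewrite X. ring.
  - exists (m11 M * p + m12 M * q)%Z, (m21 M * p + m22 M * q)%Z. split; [assumption|].
    rewrite <- E. field. now apply eq_IZR_contrapositive.
Qed.
Lemma irrational_mob_r (M : mat) (x y : R) : mdet M <> 0%Z -> mob M x y -> irrational x -> irrational y.
Proof.
  intros D H. apply mob_adj in H. apply irrational_mob with (2 := H).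
  unfold mdet, madj in *; cbn [m11 m12 m21 m22]. lia.
Qed.

Definition first_letter (x : R) : bool := if Rlt_dec 1 x then true else false.
(** The additive continued fraction algorithm, which removes one letter; a run of equal letters
    corresponds to one partial quotient. *)
Definition fstep (x : R) : R := if Rlt_dec 1 x then x - 1 else x / (1 - x).
Fixpoint tail (x : R) (n : nat) : R := match n with O => x | S n => fstep (tail x n) end.
Definition word (x : R) (n : nat) : bool := first_letter (tail x n).
Fixpoint path (M : mat) (x : R) (n : nat) : mat :=
  match n with O => M | S n => mmul (path M x n) (elem (word x n)) end.

Lemma irrational_neq1 (x : R) : irrational x -> x <> 1.
Proof. intros I ->. apply I. exists 1%Z, 1%Z. split; [easy|]. field. Qed.

Lemma fstep_spec (x : R) : 0 < x -> irrational x ->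
  0 < fstep x /\ irrational (fstep x) /\ mob (elem (first_letter x)) (fstep x) x.
Proof.
  intros P I. assert (N := irrational_neq1 _ I).
  assert (Q : 0 < fstep x /\ mob (elem (first_letter x)) (fstep x) x).
  { unfold fstep, first_letter. destruct (Rlt_dec 1 x) as [L|L]; unfold mob; simpl.
    - split; [lra|ring].
    - assert (0 < 1 - x) by lra. split; [now apply Rdiv_lt_0_compat|field; lra]. }
  destruct Q as [Q1 Q2]. repeat split; auto.
  apply irrational_mob with (2 := Q2); [now rewrite mdet_elem|assumption].
Qed.

Section Path.
Variable x : R.
Hypothesis x_pos : 0 < x.
Hypothesis x_irr : irrational x.

Lemma tail_spec (n : nat) : 0 < tail x n /\ irrational (tail x n).
Proof. induction n as [|n [P I]]; simpl; [auto|]. destruct (fstep_spec _ P I) as (? & ? & _); auto. Qed.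
Lemma tail_pos (n : nat) : 0 < tail x n. Proof. apply tail_spec. Qed.
Lemma tail_step (n : nat) : mob (elem (word x n)) (tail x (S n)) (tail x n).
Proof. destruct (tail_spec n) as [P I]. now apply fstep_spec. Qed.
Lemma tail_hist (n k : nat) : (k <= n)%nat -> mob (rmat (hist (word x) n k)) (tail x n) (tail x (n - k)).
Proof.
  revert n; induction k as [|k IH]; intros n L.
  - rewrite Nat.sub_0_r. apply mob_id.
  - destruct n as [|n]; [lia|]. simpl hist. rewrite rmat_cons. simpl Nat.sub.
    eapply mob_mul; [apply tail_step|apply IH; lia].
Qed.
Lemma path_hist (M : mat) (n k : nat) : (k <= n)%nat ->
  path M x n = mmul (path M x (n - k)) (rmat (hist (word x) n k)).
Proof.
  revert n; induction k as [|k IH]; intros n L.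
  - rewrite Nat.sub_0_r. symmetry. apply mmul_1_r.
  - destruct n as [|n]; [lia|]. simpl hist. rewrite rmat_cons, mmul_assoc. simpl Nat.sub.
    rewrite <- IH by lia. reflexivity.
Qed.
Lemma path_mob (M : mat) (xi : R) (n : nat) : mob M x xi -> mob (path M x n) (tail x n) xi.
Proof. intros H; induction n as [|n IH]; simpl; [assumption|]. eapply mob_mul; [apply tail_step|exact IH]. Qed.
Lemma path_det (M : mat) (n : nat) : mdet M = 1%Z -> mdet (path M x n) = 1%Z.
Proof. intros H; induction n as [|n IH]; simpl; [assumption|]. now rewrite mdet_mul, IH, mdet_elem. Qed.

(** If one letter were repeated for ever, the tail or its reciprocal would drop by 1 at each step
    and yet stay positive. *)
Lemma word_io (b : bool) (n : nat) : exists k, (n <= k)%nat /\ word x k = b.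
Proof.
  apply NNPP; intros H.
  assert (H' : forall k, (n <= k)%nat -> word x k = negb b).
  { intros k L. destruct (word x k) eqn:E, b; try reflexivity; exfalso; apply H; exists k; auto. }
  set (r := fun n => if b then / tail x n else tail x n).
  assert (R0 : forall k, 0 < r k)
    by (intros k; unfold r; assert (P := tail_pos k); destruct b; [now apply Rinv_0_lt_compat|assumption]).
  assert (A : forall j, r (n + j)%nat = r n - INR j).
  { induction j as [|j IH]; [rewrite Nat.add_0_r; simpl; ring|].
    assert (L := H' (n + j)%nat ltac:(lia)). assert (S1 := tail_step (n + j)). rewrite L in S1.
    replace (n + S j)%nat with (S (n + j)) by lia. rewrite S_INR.
    assert (V := tail_pos (n + j)). assert (U := tail_pos (S (n + j))).
    replace (r n - (INR j + 1)) with (r (n + j)%nat - 1) by (rewrite IH; ring).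
    unfold r, mob in *. destruct b; simpl negb in S1; cbn [elem m11 m12 m21 m22] in S1; [|lra].
    replace (tail x (n + j)) with (tail x (S (n + j)) / (tail x (S (n + j)) + 1)).
    - field. lra.
    - apply (Rmult_eq_reg_l (1 * tail x (S (n + j)) + 1)); [|lra]. rewrite S1. field. lra. }
  destruct (INR_unbounded (r n)) as [j Hj].
  specialize (A j). specialize (R0 (n + j)%nat). lra.
Qed.

Lemma path_low_le (M : mat) (n k : nat) : (0 <= m21 M)%Z -> (0 <= m22 M)%Z -> (n <= k)%nat ->
  (0 <= m21 (path M x n) <= m21 (path M x k))%Z /\ (0 <= m22 (path M x n) <= m22 (path M x k))%Z.
Proof.
  intros C D L.
  assert (P : forall n, (0 <= m21 (path M x n) /\ 0 <= m22 (path M x n))%Z).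
  { clear n k L. induction n as [|n IH]; cbn [path]; [auto|]. destruct (path M x n) as [a b c d].
    rewrite mmul_elem_r. cbn [m21 m22] in IH. destruct (word x n); simpl; lia. }
  induction L as [|k L IH]; [specialize (P n); lia|]. specialize (P k). cbn [path].
  destruct (path M x k) as [a b c d]. rewrite mmul_elem_r. simpl in *. destruct (word x k); simpl; lia.
Qed.

(** L adds the right entry of the lower row to the left one and R does the converse, so an L
    followed later by an R raises the lower bound of both entries by one. *)
Lemma path_grow (M : mat) (N : nat) : mdet M = 1%Z -> (0 <= m21 M)%Z -> (0 <= m22 M)%Z ->
  exists n0, forall n, (n0 <= n)%nat -> (Z.of_nat N <= m21 (path M x n) /\ Z.of_nat N <= m22 (path M x n))%Z.
Proof.
  intros D C1 C2. induction N as [|N [n0 IH]].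
  - exists O. intros n L. destruct (path_low_le M n n C1 C2 (Nat.le_refl _)). lia.
  - destruct (word_io false n0) as (k1 & L1 & E1). destruct (word_io true (S k1)) as (k2 & L2 & E2).
    exists (S k2). intros n L.
    assert (B1 := IH k1 L1). assert (B2 := path_low_le M (S k1) k2 C1 C2 L2).
    assert (B3 := path_low_le M (S k2) n C1 C2 L).
    assert (DD := path_det M k1 D). unfold mdet in DD.
    cbn [path] in B2, B3. destruct (path M x k1) as [a b c d], (path M x k2) as [a' b' c' d'].
    rewrite mmul_elem_r, E1 in B2. rewrite mmul_elem_r, E2 in B3.
    cbn [m11 m12 m21 m22] in *.
    assert (1 <= c + d)%Z by (destruct (Z.eq_dec c 0); [destruct (Z.eq_dec d 0); [subst; lia|lia]|lia]).
    lia.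
Qed.
End Path.

(** The columns of M are two Farey neighbours with xi between them; together with [mob_right] this
    gives their exact errors. *)
Lemma mob_left (M : mat) (x xi : R) : mdet M = 1%Z -> mob M x xi -> 0 < x -> (0 < m21 M)%Z -> (0 <= m22 M)%Z ->
  IZR (m11 M) / IZR (m21 M) - xi = / (IZR (m21 M) * (IZR (m21 M) * x + IZR (m22 M))).
Proof.
  unfold mob, mdet; intros D H P C C'. apply IZR_lt in C. apply IZR_le in C'. apply (f_equal IZR) in D.
  rewrite minus_IZR, !mult_IZR in D.
  assert (0 < IZR (m21 M) * x + IZR (m22 M)) by nra.
  apply (Rmult_eq_reg_r (IZR (m21 M) * (IZR (m21 M) * x + IZR (m22 M)))); [|nra].
  rewrite Rinv_l by nra. field_simplify; [|lra].
  apply (f_equal (fun u => u * IZR (m21 M))) in H. lra.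
Qed.
Lemma mob_right (M : mat) (x xi : R) : mdet M = 1%Z -> mob M x xi -> 0 < x -> (0 <= m21 M)%Z -> (0 < m22 M)%Z ->
  xi - IZR (m12 M) / IZR (m22 M) = x / (IZR (m22 M) * (IZR (m21 M) * x + IZR (m22 M))).
Proof.
  unfold mob, mdet; intros D H P C C'. apply IZR_le in C. apply IZR_lt in C'. apply (f_equal IZR) in D.
  rewrite minus_IZR, !mult_IZR in D.
  assert (0 < IZR (m21 M) * x + IZR (m22 M)) by nra.
  apply (Rmult_eq_reg_r (IZR (m22 M) * (IZR (m21 M) * x + IZR (m22 M)))); [|nra].
  replace (x / (IZR (m22 M) * (IZR (m21 M) * x + IZR (m22 M))) * (IZR (m22 M) * (IZR (m21 M) * x + IZR (m22 M))))
      with x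
    by (field; split; lra).
  field_simplify; [|lra].
  apply (f_equal (fun u => u * IZR (m22 M))) in H. nra.
Qed.

Lemma path_conv (M : mat) (x xi eps : R) : 0 < x -> irrational x -> mdet M = 1%Z -> (0 <= m21 M)%Z -> (0 <= m22
    M)%Z ->
  mob M x xi -> 0 < eps ->
  exists n0, forall n, (n0 <= n)%nat -> let P := path M x n in
    (0 < m21 P)%Z /\ (0 < m22 P)%Z /\
    Rabs (IZR (m11 P) / IZR (m21 P) - xi) < eps /\ Rabs (IZR (m12 P) / IZR (m22 P) - xi) < eps.
Proof.
  intros Px Ix D C1 C2 H E.
  destruct (INR_unbounded (/ eps)) as [N HN].
  destruct (path_grow x Px Ix M (S N) D C1 C2) as [n0 G]. exists n0. intros n L P.
  assert (G' := G n L). fold P in G'.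
  assert (HD : mdet P = 1%Z) by (now apply path_det).
  assert (HM : mob P (tail x n) xi) by (now apply path_mob).
  assert (Pn := tail_pos x Px Ix n).
  assert (c0 : (0 < m21 P)%Z) by lia. assert (d0 : (0 < m22 P)%Z) by lia.
  assert (HL := mob_left _ _ _ HD HM Pn c0 ltac:(lia)).
  assert (HR := mob_right _ _ _ HD HM Pn ltac:(lia) d0).
  split; [assumption|split; [assumption|]].
  assert (Hc : INR N + 1 <= IZR (m21 P)) by (rewrite INR_IZR_INZ, <- plus_IZR; apply IZR_le; lia).
  assert (Hd : INR N + 1 <= IZR (m22 P)) by (rewrite INR_IZR_INZ, <- plus_IZR; apply IZR_le; lia).
  set (c := IZR (m21 P)) in *. set (d := IZR (m22 P)) in *. set (y := tail x n) in *.
  assert (N0 := pos_INR N).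
  assert (I1 : / (INR N + 1) < eps).
  { rewrite <- (Rinv_inv eps). apply Rinv_lt_contravar; [|lra].
    apply Rmult_lt_0_compat; [now apply Rinv_0_lt_compat|lra]. }
  assert (K : 0 < c * y + d) by nra.
  split.
  - rewrite HL, Rabs_pos_eq by (left; apply Rinv_0_lt_compat; nra).
    apply Rle_lt_trans with (2 := I1). apply Rinv_le_contravar; [lra|]. nra.
  - rewrite <- Rabs_Ropp, Ropp_minus_distr, HR, Rabs_pos_eq
      by (left; apply Rdiv_lt_0_compat; nra).
    apply Rle_lt_trans with (2 := I1). set (X := d * (c * y + d)).
    assert (1 <= d) by lra. assert (X1 : y * (INR N + 1) <= X) by (unfold X; nra).
    assert (X0 : 0 < X) by (unfold X; nra).
    replace (y / X) with (y * (INR N + 1) * / ((INR N + 1) * X)) by (field; lra).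
    replace (/ (INR N + 1)) with (X * / ((INR N + 1) * X)) by (field; lra).
    apply Rmult_le_compat_r; [|assumption]. left; apply Rinv_0_lt_compat; nra.
Qed.

(** Equal words produce the same Farey neighbours, and these converge to both numbers. *)
Lemma word_inj (x y : R) : 0 < x -> irrational x -> 0 < y -> irrational y ->
  (forall n, word x n = word y n) -> x = y.
Proof.
  intros Px Ix Py Iy H. apply cond_eq. intros eps E.
  assert (EM : forall n, path mid x n = path mid y n) by (induction n as [|n IH]; simpl; congruence).
  assert (I : (0 <= m21 mid)%Z /\ (0 <= m22 mid)%Z) by (simpl; lia).
  destruct (path_conv mid x x (eps / 2) Px Ix eq_refl (proj1 I) (proj2 I) (mob_id x) ltac:(lra)) as [n1 H1].
  destruct (path_conv mid y y (eps / 2) Py Iy eq_refl (proj1 I) (proj2 I) (mob_id y) ltac:(lra)) as [n2 H2].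
  destruct (H1 (n1 + n2)%nat ltac:(lia)) as (_ & _ & A1 & _).
  destruct (H2 (n1 + n2)%nat ltac:(lia)) as (_ & _ & A2 & _).
  rewrite EM in A1. set (q := IZR _ / IZR _) in *.
  replace (x - y) with ((q - y) - (q - x)) by ring.
  apply Rle_lt_trans with (1 := Rabs_triang _ _). rewrite Rabs_Ropp. lra.
Qed.

(** * Approximation quotients along a Farey path *)

Definition good (xi C : R) : Prop := exists eps, 0 < eps /\ forall s t : Z, (0 < t)%Z ->
  0 < Rabs (IZR s / IZR t - xi) < eps -> / (IZR t ^ 2 * Rabs (IZR s / IZR t - xi)) < C.

(** With x the tail and y = d/c the past, the quotients at the two Farey neighbours are x + y and
    1/x + 1/y. *)
Lemma good_tail (M : mat) (x xi C : R) : good xi C ->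
  0 < x -> irrational x -> mdet M = 1%Z -> (0 <= m21 M)%Z -> (0 <= m22 M)%Z -> mob M x xi ->
  exists n0, forall n, (n0 <= n)%nat -> let P := path M x n in let c := IZR (m21 P) in let d := IZR (m22 P) in
    0 < c /\ 0 < d /\ c * tail x n + d < C * c /\ c * tail x n + d < C * (d * tail x n).
Proof.
  intros (eps & E & G) Px Ix D C1 C2 H.
  destruct (path_conv M x xi eps Px Ix D C1 C2 H E) as [n0 K]. exists n0. intros n L P.
  destruct (K n L) as (c0 & d0 & A1 & A2). fold P in c0, d0, A1, A2.
  assert (HD : mdet P = 1%Z) by (now apply path_det).
  assert (HM : mob P (tail x n) xi) by (now apply path_mob).
  assert (Pn := tail_pos x Px Ix n).
  assert (HL := mob_left _ _ _ HD HM Pn c0 ltac:(lia)).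
  assert (HR := mob_right _ _ _ HD HM Pn ltac:(lia) d0).
  assert (G1 := G (m11 P) (m21 P) c0). assert (G2 := G (m12 P) (m22 P) d0).
  rewrite <- Rabs_Ropp, Ropp_minus_distr in A2. rewrite <- Rabs_Ropp, Ropp_minus_distr in G2.
  apply IZR_lt in c0, d0. cbv zeta.
  set (c := IZR (m21 P)) in *. set (d := IZR (m22 P)) in *. set (y := tail x n) in *.
  assert (K0 : 0 < c * y + d) by nra.
  rewrite HL in A1, G1. rewrite HR in A2, G2.
  assert (P1 : 0 < / (c * (c * y + d))) by (apply Rinv_0_lt_compat; nra).
  assert (P2 : 0 < y / (d * (c * y + d))) by (apply Rdiv_lt_0_compat; nra).
  rewrite Rabs_pos_eq in A1, G1, A2, G2 by lra.
  specialize (G1 (conj P1 A1)). specialize (G2 (conj P2 A2)).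
  replace (/ (c ^ 2 * / (c * (c * y + d)))) with ((c * y + d) / c) in G1 by (field; lra).
  replace (/ (d ^ 2 * (y / (d * (c * y + d))))) with ((c * y + d) / (d * y)) in G2 by (field; lra).
  repeat split; auto.
  - apply (Rmult_lt_compat_r c) in G1; [|lra]. unfold Rdiv in G1. rewrite Rmult_assoc, Rinv_l in G1; lra.
  - assert (0 < d * y) by nra. apply (Rmult_lt_compat_r (d * y)) in G2; [|lra].
    unfold Rdiv in G2. rewrite Rmult_assoc, Rinv_l in G2; lra.
Qed.

(** A dead word is bad at some cut, possibly after further letters. There V bounds the future and U
    the past so that one of the two quotients of [good_tail] is at least C. *)
Lemma good_not_dead (cn cd : Z) (t : trie) (M : mat) (x xi : R) :
  (0 < cd)%Z -> check_trie cn cd t [] = true -> good xi (IZR cn / IZR cd) ->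
  0 < x -> irrational x -> mdet M = 1%Z -> (0 <= m21 M)%Z -> (0 <= m22 M)%Z -> mob M x xi ->
  exists n0, forall n k, (n0 + k <= n)%nat -> dead t (hist (word x) n k) = false.
Proof.
  intros Hcd CT G Px Ix D C1 C2 H.
  destruct (good_tail M x xi _ G Px Ix D C1 C2 H) as [n0 K]. exists n0. intros n k L.
  apply not_true_is_false. intros Dd.
  destruct (dead_doom _ _ _ _ _ CT Dd) as (h1 & h2 & s & E & B). simpl in B.
  apply hist_prefix in E as [E L1]; [|lia]. rewrite E in B. clear E.
  destruct (doom_bad _ _ _ _ _ _ B) as (i0 & j & B'). clear B. rename B' into B.
  assert (Ln : (n0 + (length h1 + i0) <= n + i0)%nat) by lia.
  (* The bad cut is seen [i0] letters after the dead word; from here on [n] and [k] stand for the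
     later time and the longer history. *)
  revert B Ln. generalize (n + i0)%nat (length h1 + i0)%nat. clear n k L Dd h1 h2 L1 i0. intros n k B L. unfold
      bad_at in B.
  destruct (hist_split (word x) n k j ltac:(lia)) as (i & l & L2 & F1 & F2).
  rewrite F1, F2 in B. clear F1 F2.
  assert (HV := tail_hist x Px Ix n i ltac:(lia)).
  assert (HU := path_hist x M (n - i) l ltac:(lia)).
  destruct (K (n - i)%nat ltac:(lia)) as (c0 & d0 & K1 & K2).
  assert (LL := path_low_le x M (n - i - l) (n - i - l) C1 C2 (Nat.le_refl _)).
  assert (NV := nonneg_rmat (hist (word x) n i)). assert (DV := mdet_rmat (hist (word x) n i)).
  assert (NU := nonneg_rmat (hist (word x) (n - i) l)). assert (DU := mdet_rmat (hist (word x) (n - i) l)).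
  assert (Pn := tail_pos x Px Ix n). assert (Pi := tail_pos x Px Ix (n - i)).
  rewrite HU in c0, d0, K1, K2. unfold mob in HV. unfold bad_cut in B. unfold nonneg, mdet in *.
  destruct (rmat (hist (word x) n i)) as [v11 v12 v21 v22].
  destruct (rmat (hist (word x) (n - i) l)) as [u11 u12 u21 u22].
  unfold mmul in *. cbn [m11 m12 m21 m22] in *.
  set (p := m21 (path M x (n - i - l))) in *. set (q := m22 (path M x (n - i - l))) in *.
  set (y := tail x (n - i)) in *. set (z := tail x n) in *.
  assert (0 < v11 /\ 0 < v22 /\ 0 < u11 /\ 0 < u22)%Z as (V1 & V2 & U1 & U2) by nia.
  destruct LL as [[LL1 _] [LL2 _]].
  (* The lower row (c,d) at the cut is a nonnegative row (p,q) times U, so d/c lies between U12/U11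
     and U22/U21. *)
  assert (X1 : (u12 * (p * u11 + q * u21) <= u11 * (p * u12 + q * u22))%Z) by nia.
  assert (X2 : (u21 * (p * u12 + q * u22) <= u22 * (p * u11 + q * u21))%Z) by nia.
  set (c := (p * u11 + q * u21)%Z) in *. set (d := (p * u12 + q * u22)%Z) in *.
  (* V takes the positive tail [z] to [y], hence [y] lies between V12/V22 and V11/V21. *)
  assert (Y1 : IZR v12 <= IZR v22 * y).
  { apply (f_equal IZR) in DV. rewrite minus_IZR, !mult_IZR in DV.
    destruct NV as (W1 & W2 & W3 & W4). apply IZR_le in W1, W2, W3, W4.
    assert (S0 : 0 < IZR v21 * z + IZR v22) by (apply IZR_lt in V2; nra).
    apply (Rmult_le_reg_l (IZR v21 * z + IZR v22)); [assumption|].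
    replace ((IZR v21 * z + IZR v22) * (IZR v22 * y)) with (IZR v22 * (IZR v11 * z + IZR v12)) by (rewrite <- HV;
        ring).
    nra. }
  assert (Y2 : IZR v21 * y <= IZR v11).
  { apply (f_equal IZR) in DV. rewrite minus_IZR, !mult_IZR in DV.
    destruct NV as (W1 & W2 & W3 & W4). apply IZR_le in W1, W2, W3, W4.
    assert (S0 : 0 < IZR v21 * z + IZR v22) by (apply IZR_lt in V2; nra).
    apply (Rmult_le_reg_l (IZR v21 * z + IZR v22)); [assumption|].
    replace ((IZR v21 * z + IZR v22) * (IZR v21 * y)) with (IZR v21 * (IZR v11 * z + IZR v12)) by (rewrite <- HV;
        ring).
    nra. }
  apply IZR_le in X1, X2. rewrite !mult_IZR in X1, X2. apply IZR_lt in V1, V2, U1, U2, Hcd.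
  apply orb_true_iff in B as [B|B]; apply Z.leb_le, IZR_le in B; rewrite !mult_IZR, plus_IZR, !mult_IZR in B.
  - apply (Rmult_lt_compat_l (IZR cd)) in K1; [|assumption].
    replace (IZR cd * (IZR cn / IZR cd * IZR c)) with (IZR cn * IZR c) in K1 by (field; lra).
    apply (Rmult_lt_compat_l (IZR v22 * IZR u11)) in K1; [|nra].
    apply (Rmult_le_compat_r (IZR c)) in B; [|lra].
    assert (Q1 : IZR v12 * (IZR u11 * IZR cd * IZR c) <= IZR v22 * y * (IZR u11 * IZR cd * IZR c))
      by (apply Rmult_le_compat_r; [repeat apply Rmult_le_pos; lra|assumption]).
    assert (Q2 : (IZR u12 * IZR c) * (IZR v22 * IZR cd) <= (IZR u11 * IZR d) * (IZR v22 * IZR cd))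
      by (apply Rmult_le_compat_r; [repeat apply Rmult_le_pos; lra|assumption]).
    lra.
  - apply (Rmult_lt_compat_l (IZR cd)) in K2; [|assumption].
    replace (IZR cd * (IZR cn / IZR cd * (IZR d * y))) with (IZR cn * (IZR d * y)) in K2 by (field; lra).
    apply (Rmult_lt_compat_l (IZR v11 * IZR u22)) in K2; [|nra].
    assert (0 <= IZR d * y) by (apply Rmult_le_pos; lra).
    apply (Rmult_le_compat_r (IZR d * y)) in B; [|lra].
    assert (Q1 : IZR v21 * y * (IZR u22 * IZR cd * IZR d) <= IZR v11 * (IZR u22 * IZR cd * IZR d))
      by (apply Rmult_le_compat_r; [repeat apply Rmult_le_pos; lra|assumption]).
    assert (Q2 : (IZR u21 * IZR d) * (IZR v11 * IZR cd * y) <= (IZR u22 * IZR c) * (IZR v11 * IZR cd * y))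
      by (apply Rmult_le_compat_r; [repeat apply Rmult_le_pos; lra|assumption]).
    lra.
Qed.

(** * The paths of xi and p xi *)

Lemma least_nat (P : nat -> Prop) : (exists n, P n) -> exists n, P n /\ forall k, (k < n)%nat -> ~ P k.
Proof.
  intros [n Hn]. revert Hn. induction n as [n IH] using (well_founded_induction Wf_nat.lt_wf). intros Hn.
  destruct (classic (exists k, (k < n)%nat /\ P k)) as [(k & L & Hk)|N]; [eauto|].
  exists n. split; [assumption|]. intros k L Hk. apply N; eauto.
Qed.

(** Raney's notion: neither row dominates the other, and neither column does. *)
Definition doubly_balanced (T : mat) : Prop :=
  (0 <= m12 T /\ 0 <= m21 T /\ m12 T < m11 T /\ m21 T < m11 T /\ m12 T < m22 T /\ m21 T < m22 T)%Z.

Section Pair.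
Variables (p : Z) (M0 N0 : mat) (xi x z : R).
Hypotheses (p_pos : (0 < p)%Z) (x_pos : 0 < x) (z_pos : 0 < z) (x_irr : irrational x) (z_irr : irrational z).
Hypotheses (M0_det : mdet M0 = 1%Z) (N0_det : mdet N0 = 1%Z).
Hypotheses (M0_1 : (0 <= m21 M0)%Z) (M0_2 : (0 <= m22 M0)%Z) (N0_1 : (0 <= m21 N0)%Z) (N0_2 : (0 <= m22 N0)%Z).
Hypotheses (M0_mob : mob M0 x xi) (N0_mob : mob N0 z (IZR p * xi)).

Definition pmat : mat := Mat p 0 0 1.
Definition trans (n m : nat) : mat := mmul (madj (path N0 z m)) (mmul pmat (path M0 x n)).

Lemma trans_in (n m : nat) : trans (S n) m = mmul (trans n m) (elem (word x n)).
Proof. unfold trans. cbn [path]. now rewrite !mmul_assoc. Qed.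
Lemma trans_out (n m : nat) : trans n m = mmul (elem (word z m)) (trans n (S m)).
Proof.
  unfold trans. cbn [path]. rewrite madj_mul, !mmul_assoc, mmul_adj_r by apply mdet_elem.
  now rewrite mmul_1_l.
Qed.
Lemma trans_eq (n m : nat) : mmul (path N0 z m) (trans n m) = mmul pmat (path M0 x n).
Proof.
  unfold trans. rewrite mmul_assoc, mmul_adj_r by (now apply path_det). apply mmul_1_l.
Qed.
Lemma trans_det (n m : nat) : mdet (trans n m) = p.
Proof.
  assert (E := f_equal mdet (trans_eq n m)). rewrite !mdet_mul, !path_det in E by assumption.
  assert (D : mdet pmat = p) by (unfold mdet, pmat; cbn [m11 m12 m21 m22]; ring). lia.
Qed.
Lemma trans_mob (n m : nat) : mob (trans n m) (tail x n) (tail z m).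
Proof.
  apply mob_mul with (IZR p * xi).
  - apply mob_mul with xi; [now apply path_mob|]. unfold mob, pmat; simpl. ring.
  - apply mob_adj. now apply path_mob.
Qed.

Lemma trans_den (n m : nat) : nonneg (trans n m) ->
  0 < IZR (m21 (trans n m)) * tail x n + IZR (m22 (trans n m)).
Proof.
  intros (_ & _ & C & D). assert (Det := trans_det n m). unfold mdet in Det.
  assert (P := tail_pos x x_pos x_irr n).
  assert (H : (0 < m21 (trans n m) \/ 0 < m22 (trans n m))%Z).
  { destruct (Z.eq_dec (m21 (trans n m)) 0) as [E1|E1]; [|left; lia].
    destruct (Z.eq_dec (m22 (trans n m)) 0) as [E2|E2]; [|right; lia].
    rewrite E1, E2 in Det. lia. }
  apply IZR_le in C, D. assert (0 <= IZR (m21 (trans n m)) * tail x n) by (apply Rmult_le_pos; lra).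
  destruct H as [H|H]; apply IZR_lt in H; [|lra].
  assert (0 < IZR (m21 (trans n m)) * tail x n) by (now apply Rmult_lt_0_compat). lra.
Qed.
Lemma trans_R (n m : nat) : nonneg (trans n m) -> (m21 (trans n m) <= m11 (trans n m))%Z ->
  (m22 (trans n m) <= m12 (trans n m))%Z -> word z m = true.
Proof.
  intros N A1 A2. assert (K := trans_den n m N). assert (H := trans_mob n m). unfold mob in H.
  assert (P := tail_pos x x_pos x_irr n).
  destruct (tail_spec z z_pos z_irr m) as [_ I]. apply irrational_neq1 in I.
  apply IZR_le in A1, A2. unfold word, first_letter. destruct (Rlt_dec 1 (tail z m)) as [|L]; [reflexivity|exfalso].
  assert (tail z m < 1) by lra. nra.
Qed.
Lemma trans_L (n m : nat) : nonneg (trans n m) -> (m11 (trans n m) <= m21 (trans n m))%Z ->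
  (m12 (trans n m) <= m22 (trans n m))%Z -> word z m = false.
Proof.
  intros N A1 A2. assert (K := trans_den n m N). assert (H := trans_mob n m). unfold mob in H.
  assert (P := tail_pos x x_pos x_irr n).
  apply IZR_le in A1, A2. unfold word, first_letter. destruct (Rlt_dec 1 (tail z m)) as [L|];
      [exfalso|reflexivity]. nra.
Qed.

(** diag(p,1) leaves the lower row alone, so T carries the lower row of the path of p xi to that of
    xi. This is how T relates the two pasts. *)
Lemma trans_low (n m : nat) :
  let T := trans n m in let M := path M0 x n in let N := path N0 z m in
  (m21 M = m21 N * m11 T + m22 N * m21 T /\ m22 M = m21 N * m12 T + m22 N * m22 T)%Z.
Proof.
  assert (E := trans_eq n m). cbv zeta.
  assert (E1 := f_equal m21 E). assert (E2 := f_equal m22 E).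
  unfold mmul, pmat in E1, E2. cbn [m11 m12 m21 m22] in E1, E2. split; lia.
Qed.

(** T is nonnegative when the columns of the path of xi, multiplied by diag(p,1), lie in the cone of
    the columns of N. Their slopes tend to p xi, which is interior to that cone. *)
Lemma trans_nonneg_ex (m : nat) : exists n, nonneg (trans n m).
Proof.
  set (N := path N0 z m). set (zm := tail z m).
  assert (Pz : 0 < zm) by now apply tail_pos.
  assert (HN : mob N zm (IZR p * xi)) by now apply path_mob.
  assert (DN : mdet N = 1%Z) by now apply path_det.
  assert (LN := path_low_le z N0 m m N0_1 N0_2 (Nat.le_refl _)). fold N in LN.
  destruct LN as [[L1 _] [L2 _]]. apply IZR_le in L1, L2.
  unfold mdet in DN. apply (f_equal IZR) in DN. rewrite minus_IZR, !mult_IZR in DN.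
  unfold mob in HN. apply IZR_lt in p_pos.
  set (a' := IZR (m11 N)) in *. set (b' := IZR (m12 N)) in *.
  set (c' := IZR (m21 N)) in *. set (d' := IZR (m22 N)) in *.
  assert (K : 0 < c' * zm + d').
  { assert (0 <= c' * zm) by (apply Rmult_le_pos; lra).
    destruct (Req_dec d' 0) as [E|]; [|lra]. destruct (Req_dec c' 0) as [E'|]; [rewrite E, E' in DN; lra|].
    assert (0 < c' * zm) by (apply Rmult_lt_0_compat; lra). lra. }
  set (zeta := IZR p * xi) in *.
  (* [alpha] and [beta] are the coordinates of (p xi, 1) in the basis of the columns of N; [eps] is
     so small that the perturbed coordinates do not become negative. *)
  set (beta := a' - c' * zeta). set (alpha := d' * zeta - b').
  assert (Eb : (c' * zm + d') * beta = 1) by (unfold beta; nra).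
  assert (Ea : (c' * zm + d') * alpha = zm) by (unfold alpha; nra).
  assert (Pb : 0 < beta) by nra. assert (Pa : 0 < alpha) by nra.
  set (eps := Rmin alpha beta / (IZR p * (c' + d' + 1))).
  assert (Pe : 0 < eps) by (apply Rdiv_lt_0_compat; [now apply Rmin_glb_lt|nra]).
  assert (Ee : eps * (IZR p * (c' + d' + 1)) = Rmin alpha beta) by (unfold eps; field; nra).
  destruct (path_conv M0 x xi eps x_pos x_irr M0_det M0_1 M0_2 M0_mob Pe) as [n Hn].
  destruct (Hn n (Nat.le_refl _)) as (C & D & H1 & H2).
  assert (Key : forall u v : Z, (0 < v)%Z -> Rabs (IZR u / IZR v - xi) < eps ->
    (0 <= m22 N * (p * u) - m12 N * v)%Z /\ (0 <= m11 N * v - m21 N * (p * u))%Z).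
  { intros u v V H. apply IZR_lt in V. apply Rabs_def2 in H as [Hu Hl].
    set (s := IZR u / IZR v - xi) in *.
    assert (Eu : IZR p * IZR u = IZR v * (IZR p * s + zeta)) by (unfold s, zeta; field; lra).
    assert (Q1 := Rmin_l alpha beta). assert (Q2 := Rmin_r alpha beta).
    assert (0 <= eps * (c' + 1)) by (apply Rmult_le_pos; lra).
    assert (0 <= eps * (d' + 1)) by (apply Rmult_le_pos; lra).
    assert (0 <= d' * (s + eps)) by (apply Rmult_le_pos; lra).
    assert (0 <= c' * (eps - s)) by (apply Rmult_le_pos; lra).
    assert (B1 : 0 <= IZR p * (d' * (s + eps) + eps * (c' + 1))) by (apply Rmult_le_pos; lra).
    assert (B2 : 0 <= IZR p * (c' * (eps - s) + eps * (d' + 1))) by (apply Rmult_le_pos; lra).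
    split; apply le_IZR; rewrite minus_IZR, !mult_IZR, Eu; fold a' b' c' d'.
    - replace (d' * (IZR v * (IZR p * s + zeta)) - b' * IZR v) with (IZR v * (IZR p * s * d' + alpha)) by (unfold
        alpha; ring).
      apply Rmult_le_pos; lra.
    - replace (a' * IZR v - c' * (IZR v * (IZR p * s + zeta))) with (IZR v * (beta - IZR p * s * c')) by (unfold
        beta; ring).
      apply Rmult_le_pos; lra. }
  destruct (Key _ _ C H1) as [K1 K2]. destruct (Key _ _ D H2) as [K3 K4].
  exists n. unfold trans, nonneg, mmul, madj, pmat. fold N. cbn [m11 m12 m21 m22]. repeat split; lia.
Qed.

(** The lower left entry of the path of xi combines the lower row of N with the weights [m11 T] and
    [m21 T], not both zero; it cannot keep up with the entries of N, which grow with [m]. *)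
Lemma trans_nonneg_fin (n1 : nat) : exists m2, forall n m, (n <= n1)%nat -> (m2 <= m)%nat -> ~ nonneg (trans n m).
Proof.
  set (K := (m21 (path M0 x n1) + 1)%Z).
  destruct (path_grow z z_pos z_irr N0 (Z.to_nat K) N0_det N0_1 N0_2) as [m2 H].
  exists m2. intros n m L1 L2 (T1 & T2 & T3 & T4).
  destruct (H m L2) as [G1 G2].
  destruct (path_low_le x M0 n n1 M0_1 M0_2 L1) as [[B1 B2] _].
  destruct (trans_low n m) as [E1 _]. assert (D := trans_det n m). unfold mdet in D.
  assert (X : (1 <= m11 (trans n m) + m21 (trans n m))%Z) by nia.
  unfold K in *. rewrite Z2Nat.id in G1, G2 by lia. nia.
Qed.

Lemma trans_nonneg_down (n m m' : nat) : (m <= m')%nat -> nonneg (trans n m') -> nonneg (trans n m).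
Proof.
  induction 1 as [|m' L IH]; intros N; [assumption|]. apply IH.
  rewrite trans_out. apply nonneg_mul; [apply nonneg_elem|assumption].
Qed.

(* Take the least n with T(n,m) nonnegative, then the greatest m: the pasts of the two paths, which T also
   relates, forbid the columns of T to be ordered against the last letter. *)
Lemma doubly_balanced_io (n1 m1 : nat) :
  exists n m, (n1 <= n)%nat /\ (m1 <= m)%nat /\ doubly_balanced (trans n m).
Proof.
  destruct (path_grow x x_pos x_irr M0 1 M0_det M0_1 M0_2) as [ng Hg].
  destruct (path_grow z z_pos z_irr N0 1 N0_det N0_1 N0_2) as [mg Hmg].
  destruct (trans_nonneg_fin (n1 + ng)) as [m2 F2].
  set (m := (m1 + m2 + mg)%nat).
  destruct (least_nat _ (trans_nonneg_ex m)) as (n & Nn & Ln).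
  assert (L1 : (n1 + ng < n)%nat).
  { destruct (Nat.le_gt_cases n (n1 + ng)); [exfalso|assumption]. apply (F2 n m); auto. unfold m; lia. }
  destruct n as [|n']; [lia|]. set (n := S n') in *.
  destruct (trans_nonneg_fin n) as [m3 F3].
  destruct (least_nat (fun k => ~ nonneg (trans n (m + k)))) as (k & Nk & Lk).
  { exists m3. apply F3; lia. }
  destruct k as [|k]; [rewrite Nat.add_0_r in Nk; contradiction|].
  assert (P1 : nonneg (trans n (m + k))) by (apply NNPP; apply Lk; lia).
  set (m' := (m + k)%nat) in *. replace (m + S k)%nat with (S m') in Nk by (unfold m'; lia).
  assert (P2 : ~ nonneg (trans n' m')).
  { intros N. apply (Ln n'); [unfold n; lia|]. apply trans_nonneg_down with (2 := N). unfold m'; lia. }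
  exists n, m'. split; [lia|]. split; [unfold m', m; lia|].
  assert (D := trans_det n m'). assert (TO := trans_out n m'). assert (TI := trans_in n' m'). fold n in TI.
  assert (TR := trans_R n m' P1). assert (TL := trans_L n m' P1).
  destruct (trans_low n m') as [W1 W2]. destruct (Hg n' ltac:(lia)) as [G1 G2]. destruct (Hmg m' ltac:(unfold m',
      m; lia)) as [G3 G4].
  assert (MS : path M0 x n = mmul (path M0 x n') (elem (word x n'))) by reflexivity.
  destruct (trans n m') as [a b c d]. destruct (trans n (S m')) as [a1 b1 c1 d1].
  destruct (trans n' m') as [a2 b2 c2 d2]. rewrite mmul_elem_l in TO. rewrite mmul_elem_r in TI.
  destruct (path M0 x n') as [e f g h]. rewrite mmul_elem_r in MS. rewrite MS in W1, W2.
  set (N := path N0 z m') in *. set (q := m21 N) in *. set (r := m22 N) in *.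
  unfold doubly_balanced, nonneg, mdet in *. cbn [m11 m12 m21 m22] in *.
  (* If a row dominated, the next output letter would be forced and would leave a nonnegative
     matrix, against the choice of the greatest m. *)
  assert (R1 : ~ (c <= a /\ d <= b)%Z).
  { intros [A1 A2]. rewrite (TR A1 A2) in TO. injection TO as -> -> -> ->. lia. }
  assert (R2 : ~ (a <= c /\ b <= d)%Z).
  { intros [A1 A2]. rewrite (TL A1 A2) in TO. injection TO as -> -> -> ->. lia. }
  assert (R3 : (c < a /\ b < d)%Z) by nia.
  destruct (word x n'); injection TI as -> -> -> ->; cbn [m21 m22] in W1, W2.
  (* [P2] puts a negative entry into the second column before the letter R, and the positive lower
     rows in [W1], [W2] forbid both of its entries to be nonpositive. *)
  - assert (~ (a2 + b2 < a2 /\ c2 + d2 <= c2)%Z) by nia. nia.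
  - nia.
Qed.
End Pair.

(** * Value of the Lagrange constant on a periodic path *)

Definition reval (f : form) (x : R) : R := IZR (fA f) * x ^ 2 + IZR (fB f) * x + IZR (fC f).
Definition xroot (f : form) : R := (- IZR (fB f) + sqrt (IZR (disc f))) / (2 * IZR (fA f)).

Lemma disc_pos (f : form) : (0 < fA f)%Z -> (fC f < 0)%Z -> (0 < disc f)%Z.
Proof. unfold disc; nia. Qed.

Section Root.
Variable f : form.
Hypotheses (HA : (0 < fA f)%Z) (HC : (fC f < 0)%Z).

Lemma sqrt_disc : sqrt (IZR (disc f)) * sqrt (IZR (disc f)) = IZR (fB f) ^ 2 - 4 * IZR (fA f) * IZR (fC f).
Proof.
  rewrite sqrt_sqrt by (apply IZR_le; apply Z.lt_le_incl; now apply disc_pos).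
  unfold disc. rewrite minus_IZR, !mult_IZR. change (fB f ^ 2)%Z with (fB f ^ Z.of_nat 2)%Z.
  rewrite <- pow_IZR. reflexivity.
Qed.
Lemma xroot_sqrt : 2 * IZR (fA f) * xroot f + IZR (fB f) = sqrt (IZR (disc f)).
Proof. apply IZR_lt in HA. unfold xroot. field. lra. Qed.
Lemma xroot_pos : 0 < xroot f.
Proof.
  assert (S := sqrt_disc). assert (P := sqrt_pos (IZR (disc f))).
  apply IZR_lt in HA, HC. apply Rdiv_lt_0_compat; [|lra].
  destruct (Rlt_dec (IZR (fB f)) (sqrt (IZR (disc f)))) as [|N]; [lra|exfalso]. nra.
Qed.
Lemma xroot_root : reval f (xroot f) = 0.
Proof.
  assert (S := sqrt_disc). rewrite <- xroot_sqrt in S. apply IZR_lt in HA.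
  unfold reval. apply (Rmult_eq_reg_l (4 * IZR (fA f))); lra.
Qed.
Lemma xroot_unique (x : R) : 0 < x -> reval f x = 0 -> x = xroot f.
Proof.
  intros P H. assert (Q := xroot_pos). assert (H' := xroot_root). unfold reval in *.
  apply IZR_lt in HA, HC.
  assert (E : (x - xroot f) * (IZR (fA f) * (x + xroot f) + IZR (fB f)) = 0) by lra.
  apply Rmult_integral in E as [E|E]; [lra|exfalso].
  assert (X : IZR (fC f) = IZR (fA f) * (x * xroot f)).
  { replace (IZR (fB f)) with (- (IZR (fA f) * (x + xroot f))) in H by lra. lra. }
  assert (0 < IZR (fA f) * (x * xroot f)) by (apply Rmult_lt_0_compat; [|apply Rmult_lt_0_compat]; assumption). lra.
Qed.
Lemma xroot_letter : first_letter (xroot f) = letter f.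
Proof.
  assert (Q := xroot_pos). assert (H := xroot_root). unfold reval, first_letter, letter in *.
  apply IZR_lt in HA, HC. set (y := xroot f) in *.
  (* Modulo the equation of the root, y - 1 and the value at (1,1) have opposite signs, because A y
     - C is positive. *)
  assert (E : (y - 1) * (IZR (fA f) * (y * 1) - IZR (fC f)) = - (IZR (fA f + fB f + fC f)) * y)
    by (rewrite !plus_IZR; lra).
  assert (0 < IZR (fA f) * (y * 1) - IZR (fC f)) by (assert (0 < IZR (fA f) * y) by (now apply Rmult_lt_0_compat);
      lra).
  destruct (Rlt_dec 1 y) as [L|L]; symmetry; [apply Z.ltb_lt|apply Z.ltb_ge].
  - apply lt_IZR. nra.
  - apply le_IZR. nra.
Qed.
End Root.

Lemma feval_real (f : form) (u v : Z) : (v <> 0)%Z ->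
  IZR (feval f u v) = IZR v ^ 2 * reval f (IZR u / IZR v).
Proof.
  intros V. apply eq_IZR_contrapositive in V. unfold feval, reval.
  replace (fA f * u ^ 2 + fB f * (u * v) + fC f * v ^ 2)%Z with (fA f * (u * u) + fB f * (u * v) + fC f * (v *
      v))%Z by ring.
  rewrite !plus_IZR, !mult_IZR. field. assumption.
Qed.

(** * Farey paths of the roots of river forms *)

Section River.
Variables (q K : Z) (fs : list form).
Hypotheses (q_pos : (0 < q)%Z) (K_pos : (0 < K)%Z) (HR : river q K fs = true).

Lemma river_sign (f : form) : In f fs -> (0 < fA f /\ fC f < 0)%Z.
Proof. intros H. destruct (river_bounds _ _ _ _ HR H). nia. Qed.
(** A rational root would be an integral zero of the form, against the positive minimum of
    [river_min]. *)
Lemma river_irrational (f : form) : In f fs -> irrational (xroot f).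
Proof.
  intros H (u & v & V & E). destruct (river_sign f H) as [SA SC].
  assert (E' := xroot_root f SA SC). rewrite E in E'.
  assert (F := feval_real f u v V). rewrite E', Rmult_0_r in F. apply eq_IZR in F.
  assert (M := river_min q K fs q_pos K_pos HR f u v H (or_intror V)). rewrite F in M. simpl in M. lia.
Qed.
Lemma river_step (f : form) : In f fs -> fstep (xroot f) = xroot (nextf f).
Proof.
  intros H. destruct (river_sign f H) as [SA SC].
  destruct (river_sign _ (river_next _ _ _ _ HR H)) as [SA' SC'].
  assert (P := xroot_pos f SA SC).
  destruct (fstep_spec _ P (river_irrational f H)) as (P' & _ & M).
  apply xroot_unique; auto.
  assert (E := xroot_root f SA SC). rewrite xroot_letter in M by assumption.
  unfold letter, nextf, mob, reval in *. set (y := fstep (xroot f)) in *. set (x := xroot f) in *.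
  destruct (fA f + fB f + fC f <? 0)%Z; cbn [elem m11 m12 m21 m22 fA fB fC] in *;
    rewrite ?plus_IZR, ?mult_IZR.
  - replace x with (y + 1) in E by lra. lra.
  - assert (Y : y + 1 <> 0) by lra.
    assert (X : x = y / (y + 1)) by (apply (Rmult_eq_reg_l (y + 1)); [field_simplify; lra|assumption]).
    rewrite X in E. apply (f_equal (fun u => u * (y + 1) ^ 2)) in E. field_simplify in E; [|lra]. lra.
Qed.
Lemma river_tail (f : form) (n : nat) : In f fs -> tail (xroot f) n = xroot (iterf n f).
Proof.
  intros H. induction n as [|n IH]; [reflexivity|]. cbn [tail]. rewrite IH, iterf_S.
  apply river_step. eapply river_iter; eassumption.
Qed.
Lemma river_word (f : form) (n : nat) : In f fs -> word (xroot f) n = letter (iterf n f).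
Proof.
  intros H. unfold word. rewrite river_tail by assumption.
  destruct (river_sign _ (river_iter _ _ _ _ n HR H)) as [SA SC]. now apply xroot_letter.
Qed.

(* F(M(1,0)) and F(M(0,1)) are the outer coefficients of f, where F is f transported by M. *)
Lemma river_values (f g : form) (M : mat) (xi : R) (eps : R) : In f fs -> In g fs ->
  mdet M = 1%Z -> (0 <= m21 M)%Z -> (0 <= m22 M)%Z -> mob M (xroot f) xi -> 0 < eps ->
  exists P, (0 < m21 P)%Z /\ (0 < m22 P)%Z /\ fcomp f (mmul (madj M) P) = g /\
    Rabs (IZR (m11 P) / IZR (m21 P) - xi) < eps /\ Rabs (IZR (m12 P) / IZR (m22 P) - xi) < eps.
Proof.
  intros Hf Hg D C1 C2 HM E.
  destruct (river_sign f Hf) as [SA SC].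
  destruct (path_conv M (xroot f) xi eps (xroot_pos f SA SC) (river_irrational f Hf) D C1 C2 HM E) as [n0 Hn].
  destruct (river_io _ _ _ f g n0 HR Hf Hg) as (n & L & <-).
  destruct (Hn n L) as (P1 & P2 & P3 & P4).
  exists (path M (xroot f) n). repeat split; auto. clear - HR Hf D q_pos K_pos.
  induction n as [|n IH]; cbn [path].
  - rewrite mmul_adj_l by assumption. destruct f as [A0 B0 C0]; unfold fcomp, mid; cbn [fA fB fC iterf]. f_equal;
      ring.
  - rewrite mmul_assoc, iterf_S. rewrite river_word by assumption. rewrite <- IH.
    destruct (mmul (madj M) (path M (xroot f) n)) as [a b c d]. rewrite mmul_elem_r.
    set (g := fcomp f (Mat a b c d)) in *. unfold nextf, letter. destruct (fA g + fB g + fC g <? 0)%Z;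
      unfold g, fcomp; cbn [fA fB fC]; f_equal; ring.
Qed.
End River.

(** * The limsup in terms of single quotients *)

Lemma lag_sup_ub (n : Z) (xi eps : R) (s t : Z) : (0 < t)%Z -> 0 < Rabs (IZR s / IZR t - xi) < eps ->
  Rbar_le (Finite (lag_quot n xi s t)) (lag_sup n xi eps).
Proof.
  intros T H. unfold lag_sup, Rbar_lub. destruct (Rbar_ex_lub _) as [l [U L]]; cbn [proj1_sig].
  apply U. exists s, t. auto.
Qed.
Lemma lag_sup_least (n : Z) (xi eps b : R) :
  (forall s t : Z, (0 < t)%Z -> 0 < Rabs (IZR s / IZR t - xi) < eps -> lag_quot n xi s t <= b) ->
  Rbar_le (lag_sup n xi eps) (Finite b).
Proof.
  intros H. unfold lag_sup, Rbar_lub. destruct (Rbar_ex_lub _) as [l [U L]]; cbn [proj1_sig].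
  apply L. intros y (s & t & T & B & ->). simpl. auto.
Qed.

(** The allowed error is linear in the distance because the quotient on a periodic path differs from
    its limit by the second-order term of a quadratic form. *)
Lemma lagrange_approx_eq (n : Z) (xi V c : R) : 0 <= c ->
  (forall s t : Z, (0 < t)%Z -> 0 < Rabs (IZR s / IZR t - xi) ->
     lag_quot n xi s t <= V + c * Rabs (IZR s / IZR t - xi)) ->
  (forall eps, 0 < eps -> exists s t : Z, (0 < t)%Z /\ 0 < Rabs (IZR s / IZR t - xi) < eps /\
     V - c * Rabs (IZR s / IZR t - xi) <= lag_quot n xi s t) ->
  lagrange_approx n xi = Finite V.
Proof.
  intros C U A. unfold lagrange_approx. apply Rbar_is_glb_unique. split.
  - intros y (eps & E & ->).
    destruct (lag_sup n xi eps) as [l| |] eqn:EL; simpl; auto.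
    + apply Rnot_lt_le. intros H.
      (* At a distance below [e] the error is less than [V - l], so the quotient given by [A]
         exceeds the supposed supremum [l]. *)
      set (e := Rmin eps ((V - l) / (c + 1))).
      assert (E' : 0 < e) by (apply Rmin_glb_lt; [assumption|apply Rdiv_lt_0_compat; lra]).
      destruct (A e E') as (s & t & T & [B1 B2] & B3).
      assert (Q := lag_sup_ub n xi eps s t T (conj B1 (Rlt_le_trans _ _ _ B2 (Rmin_l _ _)))).
      rewrite EL in Q. simpl in Q.
      assert (W : e * (c + 1) <= V - l).
      { apply Rle_trans with ((V - l) / (c + 1) * (c + 1)); [apply Rmult_le_compat_r; [lra|apply Rmin_r]|].
        right. field. lra. }
      assert (c * Rabs (IZR s / IZR t - xi) <= c * e) by (apply Rmult_le_compat_l; lra). lra.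
    + destruct (A eps E) as (s & t & T & B & _). assert (Q := lag_sup_ub n xi eps s t T B).
      rewrite EL in Q. exact Q.
  - intros b Hb.
    assert (K : forall eps, 0 < eps -> Rbar_le b (Finite (V + c * eps))).
    { intros eps E. apply Rbar_le_trans with (lag_sup n xi eps); [apply Hb; exists eps; auto|].
      apply lag_sup_least. intros s t T [B1 B2]. apply Rle_trans with (1 := U s t T B1).
      assert (c * Rabs (IZR s / IZR t - xi) <= c * eps) by (apply Rmult_le_compat_l; lra). lra. }
    destruct b as [b| |]; simpl; auto.
    + apply le_epsilon. intros e E. assert (P : 0 < e / (c + 1)) by (apply Rdiv_lt_0_compat; lra).
      specialize (K _ P). simpl in K.
      assert (c * (e / (c + 1)) <= e).
      { apply Rle_trans with ((c + 1) * (e / (c + 1))); [apply Rmult_le_compat_r; lra|right; field; lra]. }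
      lra.
    + exact (K 1 Rlt_0_1).
Qed.

Lemma lag_quot_lt (n : Z) (xi : R) (x C : R) : lagrange_approx n xi = Finite x -> x < C ->
  exists eps, 0 < eps /\ forall s t : Z, (0 < t)%Z -> 0 < Rabs (IZR s / IZR t - xi) < eps -> lag_quot n xi s t < C.
Proof.
  intros H L. unfold lagrange_approx, Rbar_glb in H. destruct (Rbar_ex_glb _) as [l [LB GL]]. simpl in H. subst l.
  apply NNPP. intros N.
  assert (Q : Rbar_le (Finite C) (Finite x)); [|simpl in Q; lra].
  apply GL. intros y (eps & E & ->). apply Rbar_not_lt_le. intros W. apply N.
  exists eps. split; [assumption|]. intros s t T B.
  assert (R := lag_sup_ub n xi eps s t T B).
  destruct (lag_sup n xi eps) as [l| |]; simpl in *; try contradiction; lra.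
Qed.

Lemma gcd_prime (p t : Z) : prime p -> (0 < t)%Z ->
  (Z.gcd t p = 1)%Z \/ exists t', (t = p * t' /\ 0 < t' /\ Z.gcd t p = p)%Z.
Proof.
  intros P T. assert (P2 := prime_ge_2 p P).
  destruct (Zdivide_dec p t) as [[k Hk]|N].
  - right. exists k. assert (0 < k)%Z by nia. split; [lia|]. split; [assumption|].
    rewrite Z.gcd_comm. apply Z.divide_gcd_iff; [lia|]. exists k. lia.
  - left. rewrite Z.gcd_comm. apply Zgcd_1_rel_prime. now apply prime_rel_prime.
Qed.

(** The weight is at least 1, which settles xi. A fraction s/t near p xi corresponds to s/(p t) near
    xi, whose weight p makes the weighted quotient equal to the unweighted one of s/t. *)
Lemma spectrum_good (p : Z) (xi x C : R) : prime p -> irrational xi -> lagrange_approx p xi = Finite x -> x < C ->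
  good xi C /\ good (IZR p * xi) C.
Proof.
  intros Pp I H L. assert (P2 := prime_ge_2 p Pp).
  destruct (lag_quot_lt p xi x C H L) as (eps & E & Q). split.
  - exists eps. split; [assumption|]. intros s t T B. apply Rle_lt_trans with (2 := Q s t T B).
    unfold lag_quot, Rdiv. rewrite <- (Rmult_1_l (/ (_ * _))) at 1. apply Rmult_le_compat_r.
    + left. apply Rinv_0_lt_compat. apply Rmult_lt_0_compat; [apply pow_lt; now apply IZR_lt|apply B].
    + apply IZR_le. assert (0 < Z.gcd t p)%Z; [|lia].
      destruct (gcd_prime p t Pp T) as [->|(? & ? & ? & ->)]; lia.
  - assert (Hp : 0 < IZR p) by (apply IZR_lt; lia).
    exists (IZR p * eps). split; [now apply Rmult_lt_0_compat|]. intros s t T [B1 B2].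
    assert (T' : 0 < IZR t) by (now apply IZR_lt).
    assert (EQ : Rabs (IZR s / IZR (p * t) - xi) = Rabs (IZR s / IZR t - IZR p * xi) / IZR p).
    { rewrite mult_IZR. replace (IZR s / (IZR p * IZR t) - xi) with ((IZR s / IZR t - IZR p * xi) / IZR p) by
        (field; lra).
      unfold Rdiv at 1. rewrite Rabs_mult, (Rabs_pos_eq (/ IZR p)); [reflexivity|]. left; now apply
          Rinv_0_lt_compat. }
    assert (PT : (0 < p * t)%Z) by nia.
    assert (W : lag_quot p xi s (p * t) < C).
    { apply Q; [assumption|]. rewrite EQ. split; [now apply Rdiv_lt_0_compat|].
      apply (Rmult_lt_reg_r (IZR p)); [assumption|]. unfold Rdiv. rewrite Rmult_assoc, Rinv_l; lra. }
    unfold lag_quot in W. rewrite EQ in W.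
    replace (Z.gcd (p * t) p) with p in W.
    + rewrite mult_IZR in W. set (r := Rabs (IZR s / IZR t - IZR p * xi)) in *.
      replace (/ (IZR t ^ 2 * r)) with (IZR p / ((IZR p * IZR t) ^ 2 * (r / IZR p))) by (field; lra). exact W.
    + rewrite Z.gcd_comm. symmetry. apply Z.divide_gcd_iff; [lia|]. exists t. lia.
Qed.

(** The form splits at its root x; for the root [xroot] the number 2 A x + B is sqrt D. *)
Lemma reval_feval (A B C x u v : R) : A * x ^ 2 + B * x + C = 0 ->
  A * u ^ 2 + B * (u * v) + C * v ^ 2 = (u - x * v) * (A * (u - x * v) + (2 * A * x + B) * v).
Proof. intros H. replace C with (- (A * x ^ 2 + B * x)) by lra. ring. Qed.

(** * The exact constant p sqrt D / K *)

Section Value.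
Variables (p K : Z) (M N T : mat) (fs gs : list form) (f : form) (xi : R).
Hypotheses (Hp : prime p) (HK : (0 < K)%Z) (Rf : river p K fs = true) (Rg : river 1 K gs = true).
Hypotheses (Hf : In f fs) (Hg : In (fcomp f (madj T)) gs).
Hypotheses (DM : mdet M = 1%Z) (DN : mdet N = 1%Z) (MN : mmul (pmat p) M = mmul N T) (NT : nonneg T).
Hypotheses (M1 : (0 <= m21 M)%Z) (M2 : (0 <= m22 M)%Z) (N1 : (0 <= m21 N)%Z) (N2 : (0 <= m22 N)%Z).
Hypothesis (HM : mob M (xroot f) xi).
Hypothesis attained :
  (exists g, In g fs /\ (p * fA g = K \/ p * - fC g = K)%Z) \/ (exists g, In g gs /\ (fA g = K \/ - fC g = K)%Z).

Let p_pos : (0 < p)%Z. Proof. assert (H := prime_ge_2 p Hp). lia. Qed.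
Let x := xroot f.
Let w := IZR (m21 M) * x + IZR (m22 M).
Let sD := sqrt (IZR (disc f)).
(** The leading coefficient of [tval], that is its value at (1,0), written by means of the splitting
    at the root. *)
Let kap := IZR (fA f) * w ^ 2 - sD * IZR (m21 M) * w.
(** The form F obtained from f by transport along M; it has the root xi and integral
    coefficients. *)
Definition tval (s t : Z) : Z := feval f (m22 M * s - m12 M * t) (- m21 M * s + m11 M * t).

Lemma w_pos : 0 < w.
Proof.
  destruct (river_sign p K fs p_pos HK Rf f Hf) as [SA SC]. assert (P := xroot_pos f SA SC). fold x in P.
  assert (D := DM). unfold mdet in D.
  assert (H : (0 < m21 M \/ 0 < m22 M)%Z).
  { destruct (Z.eq_dec (m21 M) 0) as [E1|E1]; [|left; lia].
    destruct (Z.eq_dec (m22 M) 0) as [E2|E2]; [|right; lia]. rewrite E1, E2 in D. lia. }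
  unfold w. apply IZR_le in M1, M2. assert (0 <= IZR (m21 M) * x) by (apply Rmult_le_pos; lra).
  destruct H as [H|H]; apply IZR_lt in H; [|lra].
  assert (0 < IZR (m21 M) * x) by (now apply Rmult_lt_0_compat). lra.
Qed.

(** Taylor expansion of F(X,1) at its root xi, with derivative sqrt D and second-order coefficient
    [kap]. *)
Lemma tval_eq (s t : Z) : (0 < t)%Z -> let r := IZR s / IZR t - xi in
  IZR (tval s t) = IZR t ^ 2 * (r * (sD + kap * r)).
Proof.
  intros Ht r. apply IZR_lt in Ht. assert (W := w_pos).
  destruct (river_sign p K fs p_pos HK Rf f Hf) as [SA SC].
  assert (HX := xroot_root f SA SC). fold x in HX. unfold reval in HX.
  assert (HS := xroot_sqrt f SA). fold x sD in HS.
  assert (E : w * xi = IZR (m11 M) * x + IZR (m12 M)) by exact HM.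
  assert (D := f_equal IZR DM). unfold mdet in D. rewrite minus_IZR, !mult_IZR in D.
  unfold tval, feval.
  set (u := (m22 M * s - m12 M * t)%Z). set (v := (- m21 M * s + m11 M * t)%Z).
  replace (fA f * u ^ 2 + fB f * (u * v) + fC f * v ^ 2)%Z with (fA f * (u * u) + fB f * (u * v) + fC f * (v *
      v))%Z by ring.
  rewrite !plus_IZR, !mult_IZR.
  replace (IZR (fA f) * (IZR u * IZR u) + IZR (fB f) * (IZR u * IZR v) + IZR (fC f) * (IZR v * IZR v))
    with (IZR (fA f) * IZR u ^ 2 + IZR (fB f) * (IZR u * IZR v) + IZR (fC f) * IZR v ^ 2) by ring.
  rewrite (reval_feval _ _ _ x) by exact HX. rewrite HS.
  assert (S1 : IZR s = IZR t * (r + xi)) by (unfold r; field; lra).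
  assert (Eu : IZR u - x * IZR v = w * (IZR t * r)).
  { unfold u, v. rewrite minus_IZR, plus_IZR, !mult_IZR, opp_IZR, S1.
    transitivity (IZR t * (w * r + (w * xi - (IZR (m11 M) * x + IZR (m12 M))))); [unfold w; ring|]. rewrite E.
        ring. }
  assert (Ev : w * IZR v = IZR t * (1 - IZR (m21 M) * w * r)).
  { unfold v. rewrite plus_IZR, !mult_IZR, opp_IZR, S1.
    transitivity (IZR t * (IZR (m11 M) * w - IZR (m21 M) * (w * xi) - IZR (m21 M) * w * r)); [ring|]. rewrite E, <-
        D. unfold w. ring. }
  rewrite Eu.
  transitivity (IZR t * r * (IZR (fA f) * w ^ 2 * (IZR t * r) + sD * (w * IZR v))); [ring|]. rewrite Ev. unfold
      kap. ring.
Qed.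

(** The adjugate of diag(p,1) takes (s,t) to (s, p t). Hence the adjugate of the equation [MN]
    expresses F at denominators divisible by p through the dual form. *)
Lemma tval_p (s t : Z) : tval s (p * t) = feval (fcomp f (madj T)) (m22 N * s - m12 N * t) (- m21 N * s + m11 N *
    t).
Proof.
  rewrite feval_comp. unfold tval. assert (E := f_equal madj MN). rewrite !madj_mul in E.
  unfold pmat, madj, mmul in E. cbn [m11 m12 m21 m22] in E. injection E as E1 E2 E3 E4.
  unfold madj; cbn [m11 m12 m21 m22]. f_equal.
  - apply (f_equal (fun k => k * s)%Z) in E1. apply (f_equal (fun k => k * t)%Z) in E2. lia.
  - apply (f_equal (fun k => k * s)%Z) in E3. apply (f_equal (fun k => k * t)%Z) in E4. lia.
Qed.

Lemma unimod_nonzero (P : mat) (s t : Z) : mdet P = 1%Z -> (0 < t)%Z ->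
  (m22 P * s - m12 P * t <> 0 \/ - m21 P * s + m11 P * t <> 0)%Z.
Proof.
  unfold mdet. intros D Ht.
  destruct (Z.eq_dec (m22 P * s - m12 P * t) 0) as [E1|]; [|now left].
  destruct (Z.eq_dec (- m21 P * s + m11 P * t) 0) as [E2|]; [|now right]. exfalso.
  assert (X : ((m11 P * m22 P - m12 P * m21 P) * t = m21 P * (m22 P * s - m12 P * t) + m22 P * (- m21 P * s + m11 P
      * t))%Z) by ring.
  rewrite D, E1, E2 in X. lia.
Qed.

Lemma tval_min (s t : Z) : (0 < t)%Z -> (Z.gcd t p * K <= p * Z.abs (tval s t))%Z.
Proof.
  intros Ht. destruct (gcd_prime p t Hp Ht) as [->|(t' & -> & Ht' & ->)].
  - rewrite Z.mul_1_l. apply (river_min p K fs); auto. now apply unimod_nonzero.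
  - rewrite tval_p. apply Z.mul_le_mono_nonneg_l; [lia|]. rewrite <- (Z.mul_1_l (Z.abs _)).
    apply (river_min 1 K gs); auto; [lia|]. now apply unimod_nonzero.
Qed.

Lemma value_irrational : irrational xi.
Proof.
  apply (irrational_mob_r M (xroot f)); [rewrite DM; lia|assumption|].
  apply (river_irrational p K fs p_pos HK Rf); assumption.
Qed.

Lemma irr_pos (y : R) (s t : Z) : irrational y -> (0 < t)%Z -> 0 < Rabs (IZR s / IZR t - y).
Proof.
  intros I Ht. apply Rabs_pos_lt. intros E. apply I. exists s, t. split; [lia|lra].
Qed.

Lemma quot_val (s t : Z) : (0 < t)%Z -> let r := Rabs (IZR s / IZR t - xi) in
  lag_quot p xi s t * IZR (Z.abs (tval s t)) = IZR (Z.gcd t p) * Rabs (sD + kap * (IZR s / IZR t - xi)).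
Proof.
  intros Ht r. assert (R0 := irr_pos xi s t value_irrational Ht). rewrite abs_IZR, tval_eq by assumption.
  rewrite !Rabs_mult. fold r. fold r in R0. assert (T0 : 0 < IZR t) by (now apply IZR_lt).
  rewrite (Rabs_pos_eq (IZR t ^ 2)) by (apply pow2_ge_0). unfold lag_quot. fold r. field. split; lra.
Qed.

Lemma sD_pos : 0 < sD.
Proof.
  destruct (river_sign p K fs p_pos HK Rf f Hf) as [SA SC]. apply sqrt_lt_R0. apply IZR_lt. now apply disc_pos.
Qed.

(** The dual form composed with T is det(T)^2 f, so it vanishes at T x. This number is positive
    since T is nonnegative, and the positive root is unique. *)
Lemma T_mob : mob T x (xroot (fcomp f (madj T))).
Proof.
  destruct (river_sign p K fs p_pos HK Rf f Hf) as [SA SC].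
  destruct (river_sign 1 K gs eq_refl HK Rg _ Hg) as [GA GC].
  assert (X := xroot_root f SA SC). fold x in X. assert (P := xroot_pos f SA SC). fold x in P.
  assert (D := f_equal mdet MN). rewrite !mdet_mul, DM, DN in D.
  assert (DT : mdet T = p) by (rewrite Z.mul_1_l in D; rewrite <- D; unfold mdet, pmat; cbn [m11 m12 m21 m22];
      ring).
  assert (PP := p_pos).
  destruct NT as (T1 & T2 & T3 & T4). unfold mdet in DT.
  assert (H1 : (0 < m21 T \/ 0 < m22 T)%Z).
  { destruct (Z.eq_dec (m21 T) 0) as [E1|E1]; [|left; lia].
    destruct (Z.eq_dec (m22 T) 0) as [E2|E2]; [|right; lia]. rewrite E1, E2 in DT. lia. }
  assert (H2 : (0 < m11 T \/ 0 < m12 T)%Z).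
  { destruct (Z.eq_dec (m11 T) 0) as [E1|E1]; [|left; lia].
    destruct (Z.eq_dec (m12 T) 0) as [E2|E2]; [|right; lia]. rewrite E1, E2 in DT. lia. }
  apply IZR_le in T1, T2, T3, T4.
  set (a := IZR (m11 T)) in *. set (b := IZR (m12 T)) in *. set (c := IZR (m21 T)) in *. set (d := IZR (m22 T)) in
      *.
  assert (Q1 : 0 < c * x + d).
  { assert (0 <= c * x) by (apply Rmult_le_pos; lra). destruct H1 as [HH|HH]; apply IZR_lt in HH; fold c d in HH;
      [|lra].
    assert (0 < c * x) by (now apply Rmult_lt_0_compat). lra. }
  assert (Q2 : 0 < a * x + b).
  { assert (0 <= a * x) by (apply Rmult_le_pos; lra). destruct H2 as [HH|HH]; apply IZR_lt in HH; fold a b in HH;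
      [|lra].
    assert (0 < a * x) by (now apply Rmult_lt_0_compat). lra. }
  assert (E : (a * x + b) / (c * x + d) = xroot (fcomp f (madj T))).
  { apply xroot_unique; auto; [now apply Rdiv_lt_0_compat|].
    assert (ID : IZR (fA (fcomp f (madj T))) * (a * x + b) ^ 2 + IZR (fB (fcomp f (madj T))) * ((a * x + b) * (c *
        x + d))
      + IZR (fC (fcomp f (madj T))) * (c * x + d) ^ 2 = (a * d - b * c) ^ 2 * reval f x).
    { unfold reval, fcomp, madj. cbn [fA fB fC].
      rewrite !Z.pow_2_r, !plus_IZR, !mult_IZR, !plus_IZR, !mult_IZR, !opp_IZR. fold a b c d. ring. }
    rewrite X, Rmult_0_r in ID. unfold reval.
    apply (Rmult_eq_reg_r ((c * x + d) ^ 2)); [|apply pow_nonzero; lra].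
    rewrite Rmult_0_l, <- ID. field. lra. }
  unfold mob. rewrite <- E. fold a b c d. field. lra.
Qed.

Lemma N_mob : mob N (xroot (fcomp f (madj T))) (IZR p * xi).
Proof.
  set (z := xroot _).
  assert (D := f_equal mdet MN). rewrite !mdet_mul, DM, DN in D.
  assert (DT : mdet T = p) by (rewrite Z.mul_1_l in D; rewrite <- D; unfold mdet, pmat; cbn [m11 m12 m21 m22];
      ring).
  clear D. unfold mdet in DT.
  assert (H1 : mob (mmul (pmat p) M) x (IZR p * xi)).
  { apply mob_mul with xi; [exact HM|]. unfold mob, pmat; cbn [m11 m12 m21 m22]. ring. }
  rewrite MN in H1. assert (H2 := T_mob). fold z in H2. unfold mob, mmul in H1, H2 |- *. cbn [m11 m12 m21 m22] in
      H1.
  rewrite !plus_IZR, !mult_IZR in H1.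
  assert (Q : IZR (m21 T) * x + IZR (m22 T) <> 0).
  { intros Q0. rewrite Q0, Rmult_0_l in H2.
    apply (f_equal IZR) in DT. rewrite minus_IZR, !mult_IZR in DT.
    assert (PP := p_pos). apply IZR_lt in PP.
    assert (X : IZR (m11 T) * IZR (m22 T) - IZR (m12 T) * IZR (m21 T) = 0); [|lra].
    replace (IZR (m22 T)) with (- (IZR (m21 T) * x)) by lra. replace (IZR (m12 T)) with (- (IZR (m11 T) * x)) by
        lra. ring. }
  apply (Rmult_eq_reg_l (IZR (m21 T) * x + IZR (m22 T))); [|assumption].
  transitivity ((IZR (m21 N) * ((IZR (m21 T) * x + IZR (m22 T)) * z) + IZR (m22 N) * (IZR (m21 T) * x + IZR (m22
      T))) * (IZR p * xi)); [ring|].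
  rewrite H2.
  transitivity (IZR (m11 N) * ((IZR (m21 T) * x + IZR (m22 T)) * z) + IZR (m12 N) * (IZR (m21 T) * x + IZR (m22
      T))); [|ring].
  rewrite H2. lra.
Qed.

(** The extremal coefficient recurs along its river. On the river of f it is taken at Farey
    neighbours of xi, on the dual river at Farey neighbours of p xi, whose denominators are then
    multiplied by p. *)
Lemma tval_attained (eps : R) : 0 < eps -> exists s t : Z, (0 < t)%Z /\ Rabs (IZR s / IZR t - xi) < eps /\
  (p * Z.abs (tval s t) <= Z.gcd t p * K)%Z.
Proof.
  intros E. assert (PP := p_pos).
  assert (col : forall (P Q : mat) g k, fcomp k (mmul (madj Q) P) = g ->
    feval k (m22 Q * m11 P - m12 Q * m21 P) (- m21 Q * m11 P + m11 Q * m21 P) = fA g /\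
    feval k (m22 Q * m12 P - m12 Q * m22 P) (- m21 Q * m12 P + m11 Q * m22 P) = fC g).
  { intros P Q g k <-. unfold fcomp, mmul, madj, feval. cbn [fA fB fC m11 m12 m21 m22]. split; ring. }
  destruct attained as [(g & Hg' & A)|(g & Hg' & A)].
  - destruct (river_values p K fs p_pos HK Rf f g M xi eps Hf Hg' DM M1 M2 HM E) as (P & P1 & P2 & P3 & P4 & P5).
    destruct (col P M g f P3) as [C1 C2].
    destruct (river_bounds _ _ _ _ Rf Hg') as [B1 B2].
    assert (G : forall t, (0 < t)%Z -> (1 <= Z.gcd t p)%Z)
      by (intros t Ht; destruct (gcd_prime p t Hp Ht) as [->|(? & ? & ? & ->)]; lia).
    destruct A as [A|A].
    + exists (m11 P), (m21 P). repeat split; auto. unfold tval. rewrite C1, Z.abs_eq by nia. specialize (G _ P1).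
        nia.
    + exists (m12 P), (m22 P). repeat split; auto. unfold tval. rewrite C2, <- Z.abs_opp, Z.abs_eq by nia.
        specialize (G _ P2). nia.
  - assert (HN := N_mob). apply IZR_lt in PP as PP'.
    destruct (river_values 1 K gs eq_refl HK Rg _ g N _ (IZR p * eps) Hg Hg' DN N1 N2 HN ltac:(now apply
        Rmult_lt_0_compat))
      as (P & P1 & P2 & P3 & P4 & P5).
    destruct (col P N g _ P3) as [C1 C2].
    destruct (river_bounds _ _ _ _ Rg Hg') as [B1 B2].
    assert (G : forall t, (0 < t)%Z -> Z.gcd (p * t) p = p).
    { intros t Ht. rewrite Z.gcd_comm. apply Z.divide_gcd_iff; [lia|]. exists t; lia. }
    assert (NR : forall s t, (0 < t)%Z -> Rabs (IZR s / IZR t - IZR p * xi) < IZR p * eps -> Rabs (IZR s / IZR (p *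
        t) - xi) < eps).
    { intros s t Ht HR. apply IZR_lt in Ht. rewrite mult_IZR.
      replace (IZR s / (IZR p * IZR t) - xi) with (/ IZR p * (IZR s / IZR t - IZR p * xi)) by (field; lra).
      rewrite Rabs_mult, (Rabs_pos_eq (/ IZR p)) by (left; now apply Rinv_0_lt_compat).
      apply (Rmult_lt_reg_l (IZR p)); [assumption|]. rewrite <- Rmult_assoc, Rinv_r; lra. }
    destruct A as [A|A].
    + exists (m11 P), (p * m21 P)%Z. rewrite G, tval_p, C1, Z.abs_eq by (assumption || lia). split; [nia|]. split;
        [auto|nia].
    + exists (m12 P), (p * m22 P)%Z. rewrite G, tval_p, C2, <- Z.abs_opp, Z.abs_eq by (assumption || lia). split;
        [nia|]. split; [auto|nia].
Qed.

(** By [quot_val] the quotient is gcd(t,p) |sqrt D + kap r| / |F(s,t)|. Here gcd(t,p) / |F(s,t)| is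
    at most p/K by [tval_min], with equality at the fractions of [tval_attained], and kap r is the
    linear error. *)
Lemma lagrange_value : lagrange_approx p xi = Finite (IZR p * sD / IZR K).
Proof.
  assert (PP := p_pos). assert (S0 := sD_pos). apply IZR_lt in PP. apply IZR_lt in HK as HK'.
  assert (Cp : 0 <= IZR p / IZR K * Rabs kap)
    by (apply Rmult_le_pos; [left; now apply Rdiv_lt_0_compat|apply Rabs_pos]).
  apply lagrange_approx_eq with (IZR p / IZR K * Rabs kap); [assumption| |].
  - intros s t Ht R0. assert (Q := quot_val s t Ht). cbv zeta in Q. set (r := IZR s / IZR t - xi) in *.
    assert (Mn := tval_min s t Ht). apply IZR_le in Mn. rewrite !mult_IZR in Mn.
    assert (U : Rabs (sD + kap * r) <= sD + Rabs kap * Rabs r).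
    { apply Rle_trans with (1 := Rabs_triang _ _). rewrite Rabs_mult, (Rabs_pos_eq sD); lra. }
    assert (G0 : (0 < Z.gcd t p)%Z) by (destruct (gcd_prime p t Hp Ht) as [->|(? & ? & ? & ->)]; lia).
    apply IZR_lt in G0. set (F := IZR (Z.abs (tval s t))) in *.
    assert (F0 : 0 < F) by (apply (Rmult_lt_reg_l (IZR p)); nra).
    apply (Rmult_le_reg_r F); [assumption|]. rewrite Q.
    apply Rle_trans with ((IZR p * F / IZR K) * (sD + Rabs kap * Rabs r)).
    + apply Rmult_le_compat; [lra|apply Rabs_pos| |assumption].
      apply (Rmult_le_reg_r (IZR K)); [assumption|]. unfold Rdiv. rewrite Rmult_assoc, Rinv_l; lra.
    + right. field. lra.
  - intros eps E. destruct (tval_attained eps E) as (s & t & Ht & R1 & A). exists s, t.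
    assert (R0 := irr_pos xi s t value_irrational Ht). split; [assumption|]. split; [split; assumption|].
    assert (Q := quot_val s t Ht). cbv zeta in Q. set (r := IZR s / IZR t - xi) in *.
    assert (Mn := tval_min s t Ht). apply IZR_le in Mn, A. rewrite !mult_IZR in Mn, A.
    assert (U : sD - Rabs kap * Rabs r <= Rabs (sD + kap * r)).
    { rewrite <- Rabs_mult, <- (Rabs_Ropp (kap * r)), <- (Rabs_pos_eq sD) at 1 by lra.
      apply Rle_trans with (1 := Rabs_triang_inv _ _). right. f_equal. ring. }
    assert (G0 : (0 < Z.gcd t p)%Z) by (destruct (gcd_prime p t Hp Ht) as [->|(? & ? & ? & ->)]; lia).
    apply IZR_lt in G0. set (F := IZR (Z.abs (tval s t))) in *.
    assert (F0 : 0 < F) by (apply (Rmult_lt_reg_l (IZR p)); nra).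
    apply (Rmult_le_reg_r F); [assumption|]. rewrite Q.
    replace (IZR (Z.gcd t p)) with (IZR p * F / IZR K) by (apply (Rmult_eq_reg_r (IZR K)); [field_simplify;
        lra|lra]).
    replace ((IZR p * sD / IZR K - IZR p / IZR K * Rabs kap * Rabs r) * F)
      with (IZR p * F / IZR K * (sD - Rabs kap * Rabs r)) by (field; lra).
    apply Rmult_le_compat_l; [|assumption]. left. apply Rdiv_lt_0_compat; [now apply Rmult_lt_0_compat|assumption].
Qed.
End Value.

(* Replacing xi by - xi exchanges R and L, so that only the doubly balanced matrices with a <= d
   have to be searched. *)
Definition mstar (M : mat) : mat := Mat (- m12 M) (- m11 M) (m22 M) (m21 M).
Definition mswap (M : mat) : mat := Mat (m22 M) (m21 M) (m12 M) (m11 M).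

Lemma mob_star (M : mat) (x y : R) : x <> 0 -> mob M x y -> mob (mstar M) (/ x) (- y).
Proof.
  unfold mob, mstar. cbn [m11 m12 m21 m22]. rewrite !opp_IZR. intros X H.
  apply (Rmult_eq_reg_l x); [|assumption]. field_simplify; [|assumption|assumption]. lra.
Qed.
Lemma irrational_inv (x : R) : irrational x -> irrational (/ x).
Proof.
  intros I (a & b & Hb & E). apply I. apply eq_IZR_contrapositive in Hb as Hb'.
  destruct (Z.eq_dec a 0) as [->|Ha].
  - exists 0%Z, 1%Z. split; [easy|]. rewrite <- (Rinv_inv x), E. unfold Rdiv. rewrite !Rmult_0_l. apply Rinv_0.
  - exists b, a. split; [assumption|]. apply eq_IZR_contrapositive in Ha.
    rewrite <- (Rinv_inv x), E. field. split; assumption.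
Qed.

Lemma fstep_inv (x : R) : 0 < x -> irrational x -> fstep (/ x) = / fstep x /\ first_letter (/ x) = negb
    (first_letter x).
Proof.
  intros P I. assert (N := irrational_neq1 _ I). unfold fstep, first_letter.
  destruct (Rlt_dec 1 x) as [L|L].
  - assert (/ x < 1) by (rewrite <- Rinv_1; apply Rinv_lt_contravar; lra).
    destruct (Rlt_dec 1 (/ x)); [lra|]. split; [field; split; lra|reflexivity].
  - assert (1 < / x) by (rewrite <- Rinv_1; apply Rinv_lt_contravar; lra).
    destruct (Rlt_dec 1 (/ x)); [|lra]. split; [field; split; lra|reflexivity].
Qed.
Lemma tail_inv (x : R) (n : nat) : 0 < x -> irrational x -> tail (/ x) n = / tail x n.
Proof.
  intros P I. induction n as [|n IH]; [reflexivity|]. cbn [tail]. rewrite IH.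
  apply fstep_inv; now apply tail_spec.
Qed.
Lemma path_star (M : mat) (x : R) (n : nat) : 0 < x -> irrational x -> path (mstar M) (/ x) n = mstar (path M x n).
Proof.
  intros P I. induction n as [|n IH]; [reflexivity|]. cbn [path]. rewrite IH.
  replace (word (/ x) n) with (negb (word x n)).
  - destruct (path M x n) as [a b c d]. unfold mstar. cbn [m11 m12 m21 m22]. rewrite !mmul_elem_r.
    destruct (word x n); cbn [negb m11 m12 m21 m22]; f_equal; ring.
  - unfold word. rewrite tail_inv by assumption. symmetry. apply fstep_inv; now apply tail_spec.
Qed.
Lemma trans_star (p : Z) (M0 N0 : mat) (x z : R) (n m : nat) : 0 < x -> irrational x -> 0 < z -> irrational z ->
  trans p (mstar M0) (mstar N0) (/ x) (/ z) n m = mswap (trans p M0 N0 x z n m).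
Proof.
  intros. unfold trans. rewrite !path_star by assumption.
  destruct (path M0 x n) as [a b c d], (path N0 z m) as [a' b' c' d'].
  unfold mstar, mswap, mmul, madj, pmat. cbn [m11 m12 m21 m22]. f_equal; ring.
Qed.
Lemma lag_quot_opp (n : Z) (xi : R) (s t : Z) : lag_quot n (- xi) (- s) t = lag_quot n xi s t.
Proof.
  unfold lag_quot. replace (IZR (- s) / IZR t - - xi) with (- (IZR s / IZR t - xi)) by (rewrite opp_IZR; unfold
      Rdiv; ring).
  now rewrite Rabs_Ropp.
Qed.
Lemma lagrange_approx_opp (n : Z) (xi : R) : lagrange_approx n (- xi) = lagrange_approx n xi.
Proof.
  assert (S : forall xi eps, Rbar_le (lag_sup n (- xi) eps) (lag_sup n xi eps)).
  { clear xi. intros xi eps. unfold lag_sup at 1, Rbar_lub. destruct (Rbar_ex_lub _) as [l [U L]]; cbn [proj1_sig].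
    apply L. intros y (s & t & T & B & ->). rewrite <- (Z.opp_involutive s), lag_quot_opp.
    apply lag_sup_ub; [assumption|].
    replace (IZR (- s) / IZR t - xi) with (- (IZR s / IZR t - - xi)) by (rewrite opp_IZR; unfold Rdiv; ring).
    now rewrite Rabs_Ropp. }
  assert (S' : forall eps, lag_sup n (- xi) eps = lag_sup n xi eps).
  { intros eps. apply Rbar_le_antisym; [apply S|]. rewrite <- (Ropp_involutive xi) at 1. apply S. }
  unfold lagrange_approx, Rbar_glb.
  destruct (Rbar_ex_glb _) as [l1 [U1 L1]], (Rbar_ex_glb _) as [l2 [U2 L2]]; cbn [proj1_sig].
  apply Rbar_le_antisym.
  - apply L2. intros y (eps & E & ->). rewrite <- S'. apply U1. exists eps; auto.
  - apply L1. intros y (eps & E & ->). rewrite S'. apply U2. exists eps; auto.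
Qed.

Open Scope Z_scope.

(** * Certificates *)

(** The emissions of [emit] without pruning. It only produces data for [check_cycle], so nothing is
    proved about it. *)
Fixpoint settle (n : nat) (M : mat) (ho : list bool) : mat * list bool :=
  match n with
  | O => (M, ho)
  | S n =>
    let 'Mat a b c d := M in
    if c <? a then if d <=? b then settle n (Mat (a - c) (b - d) c d) (true :: ho) else (M, ho)
    else if b <=? d then settle n (Mat a b (c - a) (d - b)) (false :: ho) else (M, ho)
  end.
Definition advance (l : nat) (e : entry) : entry :=
  let x := letter (e_form e) in
  let (M, ho) := settle 200 (mmul (e_mat e) (elem x)) (e_ho e) in
  Ent M (firstn l (x :: e_hi e)) (firstn l ho) (nextf (e_form e)).
Fixpoint walk {X : Type} (next : X -> X) (n : nat) (x : X) : list X :=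
  match n with O => [] | S n => x :: walk next n (next x) end.

(* The periodic path on which x is the positive root of [c_form], p xi = N T x and xi = M x with T = [c_mat];
   its constant is p sqrt D / [c_K], and the periods of the rivers of f and of f o adj T are given last. *)
Record cycle := Cycle { c_mat : mat; c_form : form; c_K : Z; c_len : nat; c_dual_len : nat }.
(** Before entries are recorded the cycle is run for a whole number of rounds and more than [l]
    letters, so that the input histories have full length. *)
Definition entries (l : nat) (c : cycle) : list entry :=
  walk (advance l) (c_len c)
    (Nat.iter (c_len c * S (S (Nat.div l (c_len c)))) (advance l) (Ent (c_mat c) [] [] (c_form c))).
Definition dual (c : cycle) : list form := walk nextf (c_dual_len c) (fcomp (c_form c) (madj (c_mat c))).

(** The last equation says that D / K^2 is the same as for the first cycle [c0], so that all cycles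
    have one constant. *)
Definition check_entry (c0 c : cycle) (gs : list form) (e : entry) : bool :=
  let 'Mat x y z w := e_mat e in
  (0 <=? x) && (0 <=? y) && (0 <=? z) && (0 <=? w)
  && existsb (form_eqb (fcomp (e_form e) (madj (e_mat e)))) gs
  && (disc (e_form e) * c_K c0 ^ 2 =? disc (c_form c0) * c_K c ^ 2).
Definition check_cycle (t : trie) (N : nat) (p : Z) (c0 : cycle) (ce : cycle * list entry) : bool :=
  let (c, es) := ce in
  let fs := map e_form es in
  let gs := dual c in
  (0 <? c_K c)
  && ring_links (follow t N) es && river p (c_K c) fs && river 1 (c_K c) gs
  && (existsb (fun f => (p * fA f =? c_K c) || (p * - fC f =? c_K c)) fs
      || existsb (fun g => (fA g =? c_K c) || (- fC g =? c_K c)) gs)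
  && forallb (check_entry c0 c gs) es.

Definition witness_mat (p nu : Z) (T : mat) : mat :=
  let 'Mat a b c d := T in Mat ((a + nu * c) / p) ((b + nu * d) / p) c d.
Definition check_witness (p nu : Z) (es : list entry) : bool :=
  match es with
  | [] => false
  | e :: _ =>
    mat_eqb (mmul (pmat p) (witness_mat p nu (e_mat e))) (mmul (Mat 1 nu 0 1) (e_mat e))
    && (mdet (witness_mat p nu (e_mat e)) =? 1)
  end.

(* [ct_nu] is the entry nu of N = (1 nu; 0 1) for which diag(p,1) M = N T has an integral solution M on the first
   cycle; M x is then a number whose constant is the minimum. *)
Record cert := Cert { ct_p : Z; ct_nu : Z; ct_cycles : list cycle }.
(* Certificates for the threshold C = [g_num]/[g_den] with the doomed words [g_words].  A search reads
   [g_N0] letters; a surviving branch is then on a cycle, recognized by its last [g_hist] letters, or dies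
   within [g_N1] more letters. *)
Record group := Group { g_num : Z; g_den : Z; g_words : list positive; g_N0 : nat; g_N1 : nat; g_hist : nat;
    g_certs : list cert }.

(** The first test is the square of p sqrt D / K < C. The condition [c + u <= b + v] is a <= d, the
    half that remains after reflection. *)
Definition check_cert (t : trie) (g : group) (ct : cert) : bool :=
  let p := ct_p ct in
  match ct_cycles ct with
  | [] => false
  | c0 :: _ =>
    let ess := map (entries (g_hist g)) (ct_cycles ct) in
    let es := concat ess in
    (p ^ 2 * disc (c_form c0) * g_den g ^ 2 <? g_num g ^ 2 * c_K c0 ^ 2)
    && check_witness p (ct_nu ct) (hd [] ess)
    && forallb (check_cycle t (g_N1 g) p c0) (combine (ct_cycles ct) ess)
    && all_balanced p (fun b c u v =>
         if c + u <=? b + v then explore t (landed t es (g_N1 g)) (g_N0 g) [] b c u v [] else true)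
  end.
Definition check_group (g : group) : bool :=
  let t := mk_trie (g_num g) (g_den g) (g_words g) in
  (0 <? g_den g) && (0 <? g_num g) && check_trie (g_num g) (g_den g) t [] && forallb (check_cert t g) (g_certs g).

Open Scope R_scope.

(** * Soundness of the certificates *)

Lemma good_opp (xi C : R) : good xi C -> good (- xi) C.
Proof.
  intros (eps & E & H). exists eps. split; [assumption|]. intros s t T B.
  assert (Q : IZR (- s) / IZR t - xi = - (IZR s / IZR t - - xi)) by (rewrite opp_IZR; unfold Rdiv; ring).
  rewrite <- Rabs_Ropp, <- Q in B. rewrite <- Rabs_Ropp, <- Q. auto.
Qed.
Lemma tail_shift (x : R) (n j : nat) : tail (tail x n) j = tail x (n + j).
Proof. induction j as [|j IH]; [now rewrite Nat.add_0_r|]. rewrite Nat.add_succ_r. cbn [tail]. now rewrite IH. Qed.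

Section Sound.
Variables (t : trie) (g : group) (ct : cert) (c0 : cycle).
Let p := ct_p ct.
Let C := IZR (g_num g) / IZR (g_den g).
Let V := IZR p * sqrt (IZR (disc (c_form c0))) / IZR (c_K c0).
Let ess := map (entries (g_hist g)) (ct_cycles ct).
Hypothesis Hp : prime p.
Hypothesis Hden : (0 < g_den g)%Z.
Hypothesis Htrie : check_trie (g_num g) (g_den g) t [] = true.
Hypothesis HK0 : (0 < c_K c0)%Z.
Hypothesis Hcyc : forallb (check_cycle t (g_N1 g) p c0) (combine (ct_cycles ct) ess) = true.
Hypothesis Hall : all_balanced p (fun b c u v =>
  if (c + u <=? b + v)%Z then explore t (landed t (concat ess) (g_N1 g)) (g_N0 g) [] b c u v [] else true) = true.

Lemma p_gt0 : (0 < p)%Z. Proof. assert (H := prime_ge_2 p Hp). lia. Qed.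

Lemma cycle_of (es : list entry) : In es ess ->
  exists c, check_cycle t (g_N1 g) p c0 (c, es) = true.
Proof.
  intros H. unfold ess in H. apply in_map_iff in H as (c & <- & Hc). exists c.
  rewrite forallb_forall in Hcyc. apply Hcyc. unfold ess. clear - Hc.
  induction (ct_cycles ct) as [|d l IH]; [destruct Hc|]. destruct Hc as [->|Hc]; simpl; auto.
Qed.

Lemma entry_value (es : list entry) (e : entry) (M N : mat) (xi : R) : In es ess -> In e es ->
  mdet M = 1%Z -> mdet N = 1%Z -> mmul (pmat p) M = mmul N (e_mat e) ->
  (0 <= m21 M)%Z -> (0 <= m22 M)%Z -> (0 <= m21 N)%Z -> (0 <= m22 N)%Z ->
  mob M (xroot (e_form e)) xi -> lagrange_approx p xi = Finite V /\ irrational xi.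
Proof.
  intros Hes He DM DN MN M1 M2 N1 N2 HM.
  destruct (cycle_of es Hes) as (c & H). unfold check_cycle in H.
  rewrite !andb_true_iff in H. destruct H as [[[[[HK HF] Rf] Rg] At] Ent]. apply Z.ltb_lt in HK.
  rewrite forallb_forall in Ent. specialize (Ent e He). unfold check_entry in Ent.
  destruct (e_mat e) as [x y z w] eqn:ET. rewrite !andb_true_iff, !Z.leb_le, Z.eqb_eq in Ent.
  destruct Ent as [[[[[E1 E2] E3] E4] E5] E6].
  assert (Hf : In (e_form e) (map e_form es)) by (apply in_map; assumption).
  assert (Hg : In (fcomp (e_form e) (madj (Mat x y z w))) (dual c)).
  { apply existsb_exists in E5 as (h & Hh & E5). apply form_eqb_spec in E5. now rewrite E5. }
  assert (NT : nonneg (Mat x y z w)) by (unfold nonneg; cbn [m11 m12 m21 m22]; auto).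
  assert (A : (exists g, In g (map e_form es) /\ (p * fA g = c_K c \/ p * - fC g = c_K c)%Z) \/
              (exists g, In g (dual c) /\ (fA g = c_K c \/ - fC g = c_K c)%Z)).
  { apply orb_true_iff in At as [At|At]; apply existsb_exists in At as (h & Hh & At);
      rewrite orb_true_iff, !Z.eqb_eq in At; [left|right]; eauto. }
  split; [|exact (value_irrational p (c_K c) M (map e_form es) (e_form e) xi Hp HK Rf Hf DM HM)].
  rewrite (lagrange_value p (c_K c) M N (Mat x y z w) (map e_form es) (dual c) (e_form e) xi); auto.
  f_equal. unfold V.
  destruct (river_sign p (c_K c) _ p_gt0 HK Rf _ Hf) as [SA SC].
  assert (D1 := disc_pos _ SA SC).
  assert (EQ : sqrt (IZR (disc (e_form e))) * IZR (c_K c0) = sqrt (IZR (disc (c_form c0))) * IZR (c_K c)).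
  { apply IZR_lt in HK, HK0 as HK0', D1.
    apply (f_equal IZR) in E6. rewrite !Z.pow_2_r, !mult_IZR in E6.
    rewrite <- (sqrt_square (IZR (c_K c0))), <- (sqrt_square (IZR (c_K c))) by lra.
    rewrite <- !sqrt_mult_alt; [now rewrite E6| |lra].
    apply (Rmult_le_reg_r (IZR (c_K c) * IZR (c_K c))); [now apply Rmult_lt_0_compat|].
    rewrite <- E6, Rmult_0_l. apply Rmult_le_pos; [lra|]. apply Rmult_le_pos; lra. }
  apply IZR_lt in HK, HK0 as HK0'.
  apply (Rmult_eq_reg_r (IZR (c_K c) * IZR (c_K c0))); [|apply Rgt_not_eq; now apply Rmult_lt_0_compat].
  field_simplify; [|lra|lra]. rewrite Rmult_assoc, EQ. ring.
Qed.

Section Path.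
Variables (M0 N0 : mat) (xi x z : R).
Hypotheses (x_pos : 0 < x) (z_pos : 0 < z) (x_irr : irrational x) (z_irr : irrational z).
Hypotheses (M0_det : mdet M0 = 1%Z) (N0_det : mdet N0 = 1%Z).
Hypotheses (M0_1 : (0 <= m21 M0)%Z) (M0_2 : (0 <= m22 M0)%Z) (N0_1 : (0 <= m21 N0)%Z) (N0_2 : (0 <= m22 N0)%Z).
Hypotheses (M0_mob : mob M0 x xi) (N0_mob : mob N0 z (IZR p * xi)).
Hypotheses (G1 : good xi C) (G2 : good (IZR p * xi) C).

(** Histories reaching back no further than [n0] and [m0] are not dead, so the search applies to any
    later doubly balanced matrix and puts xi on a cycle. The letters determine the tail by
    [word_inj], and [entry_value] gives the constant. *)
Lemma balanced_value : exists n0 m0, forall n m, (n0 <= n)%nat -> (m0 <= m)%nat ->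
  let T := trans p M0 N0 x z n m in
  doubly_balanced T -> (m11 T <= m22 T)%Z -> lagrange_approx p xi = Finite V.
Proof.
  destruct (good_not_dead _ _ _ M0 x xi Hden Htrie G1 x_pos x_irr M0_det M0_1 M0_2 M0_mob) as [n0 Hn0].
  destruct (good_not_dead _ _ _ N0 z (IZR p * xi) Hden Htrie G2 z_pos z_irr N0_det N0_1 N0_2 N0_mob) as [m0 Hm0].
  exists n0, m0. intros n m Ln Lm T DB Half.
  assert (PP := p_gt0). assert (DT := trans_det p M0 N0 x z M0_det N0_det n m). fold T in DT.
  destruct T as [a b c d] eqn:ET. unfold doubly_balanced, mdet in *. cbn [m11 m12 m21 m22] in *.
  assert (S := all_balanced_spec p _ a b c d Hp Hall ltac:(lia) ltac:(lia) ltac:(lia) ltac:(lia) ltac:(lia)).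
  cbv beta in S. rewrite (proj2 (Z.leb_le (c + (a - c)) (b + (d - b)))) in S by lia.
  destruct (search_sound t (word x) (word z) (trans p M0 N0 x z) n0 m0) with (N0 := g_N0 g) (N1 := g_N1 g) (cycles
      := ess)
    (n := n) (m := m) (a := a) (b := b) (c := c) (d := d) as (n' & m' & es & e & Hes & He & EM & HL); auto.
  - intros; apply trans_in.
  - intros; apply trans_out.
  - intros i j; apply (trans_R p M0 N0 xi x z PP x_pos z_pos x_irr z_irr M0_det N0_det M0_mob N0_mob).
  - intros i j; apply (trans_L p M0 N0 xi x z PP x_pos z_pos x_irr z_irr M0_det N0_det M0_mob N0_mob).
  - intros es Hes. destruct (cycle_of es Hes) as (cc & H). unfold check_cycle in H.
    rewrite !andb_true_iff in H. apply H.
  - fold T. rewrite ET. unfold nonneg. cbn [m11 m12 m21 m22]. lia.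
  - destruct (cycle_of es Hes) as (cc & H). unfold check_cycle in H.
    rewrite !andb_true_iff in H. destruct H as [[[[[HK _] Rf] _] _] _]. apply Z.ltb_lt in HK.
    assert (Hf : In (e_form e) (map e_form es)) by (apply in_map; assumption).
    destruct (river_sign p (c_K cc) _ PP HK Rf _ Hf) as [SA SC].
    assert (EX : tail x n' = xroot (e_form e)).
    { apply word_inj.
      - now apply tail_pos.
      - now apply tail_spec.
      - now apply xroot_pos.
      - now apply (river_irrational p (c_K cc) (map e_form es)).
      - intros j. rewrite (river_word p (c_K cc) (map e_form es)) by assumption.
        unfold word. rewrite tail_shift. apply HL. }
    apply (entry_value es e (path M0 x n') (path N0 z m') xi Hes He); try (now apply path_det).
    + rewrite <- EM. symmetry. now apply trans_eq.
    + apply (path_low_le x M0 n' n' M0_1 M0_2 (Nat.le_refl _)).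
    + apply (path_low_le x M0 n' n' M0_1 M0_2 (Nat.le_refl _)).
    + apply (path_low_le z N0 m' m' N0_1 N0_2 (Nat.le_refl _)).
    + apply (path_low_le z N0 m' m' N0_1 N0_2 (Nat.le_refl _)).
    + rewrite <- EX. now apply path_mob.
Qed.
End Path.

Lemma spectrum_value (xi y : R) : irrational xi -> lagrange_approx p xi = Finite y -> y < C -> y = V.
Proof.
  intros I H L. assert (PP := p_gt0). destruct (spectrum_good p xi y C Hp I H L) as [G1 G2].
  (* An integral translation makes xi positive; [M0] and [N0] undo it for xi and p xi, and their
     lower row is (0,1). *)
  destruct (INR_unbounded (- xi)) as [k Hk]. set (z0 := Z.of_nat k). rewrite INR_IZR_INZ in Hk. fold z0 in Hk.
  set (M0 := Mat 1 (- z0) 0 1). set (N0 := Mat 1 (- (p * z0)) 0 1).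
  set (x := xi + IZR z0). set (z := IZR p * x).
  assert (PR : 0 < IZR p) by (now apply IZR_lt).
  assert (x_pos : 0 < x) by (unfold x; lra).
  assert (z_pos : 0 < z) by (now apply Rmult_lt_0_compat).
  assert (HM : mob M0 x xi) by (unfold mob, M0, x; cbn [m11 m12 m21 m22]; rewrite opp_IZR; ring).
  assert (HN : mob N0 z (IZR p * xi)) by (unfold mob, N0, z, x; cbn [m11 m12 m21 m22]; rewrite opp_IZR, mult_IZR;
      ring).
  assert (DM : mdet M0 = 1%Z) by (unfold mdet, M0; cbn [m11 m12 m21 m22]; ring).
  assert (DN : mdet N0 = 1%Z) by (unfold mdet, N0; cbn [m11 m12 m21 m22]; ring).
  assert (x_irr : irrational x) by (apply (irrational_mob M0 x xi); [rewrite DM; lia|assumption|assumption]).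
  assert (z_irr : irrational z).
  { apply (irrational_mob_r (pmat p) x z); [|unfold mob, pmat, z; cbn [m11 m12 m21 m22]; ring|assumption].
    unfold mdet, pmat; cbn [m11 m12 m21 m22]; lia. }
  assert (L0 : (0 <= m21 M0 /\ 0 <= m22 M0 /\ 0 <= m21 N0 /\ 0 <= m22 N0)%Z) by (unfold M0, N0; cbn [m21 m22]; lia).
  destruct L0 as (L1 & L2 & L3 & L4).
  assert (x_pos' : 0 < / x) by (now apply Rinv_0_lt_compat).
  assert (z_pos' : 0 < / z) by (now apply Rinv_0_lt_compat).
  assert (G1' := good_opp _ _ G1). assert (G2' := good_opp _ _ G2).
  replace (- (IZR p * xi)) with (IZR p * - xi) in G2' by ring.
  assert (HM' : mob (mstar M0) (/ x) (- xi)) by (apply mob_star; [lra|assumption]).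
  assert (HN' : mob (mstar N0) (/ z) (IZR p * - xi))
    by (replace (IZR p * - xi) with (- (IZR p * xi)) by ring; apply mob_star; [lra|assumption]).
  destruct (balanced_value M0 N0 xi x z) as (n1 & m1 & B1); auto.
  (* For - xi the transducer matrix has its diagonal entries exchanged ([trans_star]), so at a
     common balanced time one of the two runs has a <= d. *)
  destruct (balanced_value (mstar M0) (mstar N0) (- xi) (/ x) (/ z)) as (n2 & m2 & B2); auto;
    try (now apply irrational_inv); try (unfold M0, N0, mstar; cbn [m11 m12 m21 m22]; lia);
    try (unfold mdet, M0, N0, mstar; cbn [m11 m12 m21 m22]; ring).
  destruct (doubly_balanced_io p M0 N0 xi x z) with (n1 := (n1 + n2)%nat) (m1 := (m1 + m2)%nat) as (n & m & Ln & Lm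
      & DB); auto.
  destruct (Z_le_gt_dec (m11 (trans p M0 N0 x z n m)) (m22 (trans p M0 N0 x z n m))) as [W|W].
  - assert (E := B1 n m ltac:(lia) ltac:(lia) DB W). rewrite H in E. injection E as E. exact E.
  - assert (E : lagrange_approx p (- xi) = Finite V).
    { apply (B2 n m); try lia; rewrite trans_star by assumption; unfold doubly_balanced, mswap in *;
        cbn [m11 m12 m21 m22]; lia. }
    rewrite lagrange_approx_opp, H in E. injection E as E. exact E.
Qed.
End Sound.

Lemma check_cert_sound (g : group) (ct : cert) : check_group g = true -> In ct (g_certs g) -> prime (ct_p ct) ->
  exists m : R,
    lagrange_spectrum (ct_p ct) m /\
    (forall x : R, lagrange_spectrum (ct_p ct) x -> m <= x) /\
    (exists eps : R, 0 < eps /\ forall x : R, lagrange_spectrum (ct_p ct) x -> Rabs (x - m) < eps -> x = m) /\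
    irrational m /\ (exists a b : Z, (0 < b)%Z /\ m = sqrt (IZR a / IZR b)).
Proof.
  intros HG Hct Hp. unfold check_group in HG. cbv zeta in HG.
  set (t := mk_trie _ _ _) in HG. rewrite !andb_true_iff, !Z.ltb_lt, forallb_forall in HG.
  destruct HG as [[[Hden Hnum] Htrie] HC]. specialize (HC ct Hct). unfold check_cert in HC. cbv zeta in HC.
  destruct (ct_cycles ct) as [|c0 cs] eqn:Ecs; [discriminate|]. rewrite <- Ecs in HC.
  rewrite !andb_true_iff, Z.ltb_lt in HC. destruct HC as [[[Hlt Hw] Hcyc] Hall].
  set (ess := map (entries (g_hist g)) (ct_cycles ct)) in *.
  assert (PP : (0 < ct_p ct)%Z) by (assert (H := prime_ge_2 _ Hp); lia).
  assert (Hess : exists es ess', ess = es :: ess') by (unfold ess; rewrite Ecs; simpl; eauto).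
  destruct Hess as (es & ess' & Eess). rewrite Eess in Hw. cbn [hd] in Hw.
  unfold check_witness in Hw. destruct es as [|e es]; [discriminate|].
  apply andb_true_iff in Hw as [W1 W2]. apply mat_eqb_spec in W1. apply Z.eqb_eq in W2.
  assert (C0 : check_cycle t (g_N1 g) (ct_p ct) c0 (c0, e :: es) = true).
  { rewrite forallb_forall in Hcyc. apply Hcyc. rewrite Eess, Ecs. simpl. auto. }
  unfold check_cycle in C0. rewrite !andb_true_iff in C0. destruct C0 as [[[[[HK _] Rf] _] _] Ent]. apply Z.ltb_lt
      in HK.
  rewrite forallb_forall in Ent. specialize (Ent e (or_introl eq_refl)). unfold check_entry in Ent.
  set (f := e_form e) in *. assert (Hf : In f (map e_form (e :: es))) by (left; reflexivity).
  destruct (river_sign _ _ _ PP HK Rf f Hf) as [SA SC].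
  (* For the first cycle the equation of [check_entry] has the same K on both sides, and K^2
     cancels. *)
  assert (Ed : disc f = disc (c_form c0)).
  { destruct (e_mat e) as [? ? ? ?]. rewrite !andb_true_iff, Z.eqb_eq in Ent.
    destruct Ent as [_ Ent]. apply Z.mul_cancel_r in Ent; [assumption|]. apply Z.pow_nonzero; lia. }
  assert (LW : (0 <= m21 (witness_mat (ct_p ct) (ct_nu ct) (e_mat e)) /\ 0 <= m22 (witness_mat (ct_p ct) (ct_nu ct)
      (e_mat e)))%Z).
  { destruct (e_mat e) as [? ? ? ?]. rewrite !andb_true_iff, !Z.leb_le in Ent. simpl. tauto. }
  set (M := witness_mat (ct_p ct) (ct_nu ct) (e_mat e)) in *. set (N := Mat 1 (ct_nu ct) 0 1) in *.
  set (x := xroot f). set (m := IZR (ct_p ct) * sqrt (IZR (disc (c_form c0))) / IZR (c_K c0)).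
  assert (Px : 0 < x) by (now apply xroot_pos).
  assert (W : 0 < IZR (m21 M) * x + IZR (m22 M)).
  { assert (D := W2). unfold mdet in D.
    assert (H : (0 < m21 M \/ 0 < m22 M)%Z).
    { destruct (Z.eq_dec (m21 M) 0) as [E1|E1]; [|left; lia].
      destruct (Z.eq_dec (m22 M) 0) as [E2|E2]; [|right; lia]. rewrite E1, E2 in D. lia. }
    destruct LW as [L1 L2]. apply IZR_le in L1, L2. assert (0 <= IZR (m21 M) * x) by (apply Rmult_le_pos; lra).
    destruct H as [H|H]; apply IZR_lt in H; [|lra].
    assert (0 < IZR (m21 M) * x) by (now apply Rmult_lt_0_compat). lra. }
  set (xi := (IZR (m11 M) * x + IZR (m12 M)) / (IZR (m21 M) * x + IZR (m22 M))).
  assert (HM : mob M x xi) by (unfold mob, xi; field; lra).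
  destruct (entry_value t g ct c0 Hp HK Hcyc (e :: es) e M N xi) as [HV HI];
    try assumption; try (fold ess; rewrite Eess; now left); try (now left); try apply LW;
    try (unfold N, mdet; cbn [m11 m12 m21 m22]; lia).
  assert (Hm : lagrange_spectrum (ct_p ct) m) by (exists xi; split; assumption).
  assert (mC : m < IZR (g_num g) / IZR (g_den g)).
  { apply IZR_lt in Hlt. rewrite !Z.pow_2_r, !mult_IZR in Hlt. apply IZR_lt in Hden, Hnum, HK.
    assert (PR : 0 < IZR (ct_p ct)) by (now apply IZR_lt).
    assert (D0 := disc_pos f SA SC). rewrite Ed in D0. apply IZR_lt in D0.
    assert (SQ := sqrt_sqrt _ (Rlt_le _ _ D0)). set (s := sqrt (IZR (disc (c_form c0)))) in *.
    assert (S0 : 0 <= s) by apply sqrt_pos.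
    apply (Rmult_lt_reg_r (IZR (c_K c0) * IZR (g_den g))); [now apply Rmult_lt_0_compat|].
    replace (m * (IZR (c_K c0) * IZR (g_den g))) with (IZR (ct_p ct) * s * IZR (g_den g)) by (unfold m, s; field;
        lra).
    replace (IZR (g_num g) / IZR (g_den g) * (IZR (c_K c0) * IZR (g_den g))) with (IZR (g_num g) * IZR (c_K c0)) by
        (field; lra).
    apply Rsqr_incrst_0.
    - unfold Rsqr. replace (IZR (ct_p ct) * s * IZR (g_den g) * (IZR (ct_p ct) * s * IZR (g_den g)))
        with (IZR (ct_p ct) * IZR (ct_p ct) * (s * s) * (IZR (g_den g) * IZR (g_den g))) by ring. rewrite SQ. lra.
    - repeat apply Rmult_le_pos; lra.
    - apply Rmult_le_pos; lra. }
  assert (Val : forall y, lagrange_spectrum (ct_p ct) y -> y < IZR (g_num g) / IZR (g_den g) -> y = m).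
  { intros y (xi' & I' & H') L'. apply (spectrum_value t g ct c0 Hp Hden Htrie HK Hcyc Hall xi'); assumption. }
  exists m. split; [assumption|]. split; [|split; [|split]].
  - intros y Hy. destruct (Rle_lt_dec m y) as [|L]; [assumption|]. right. symmetry. apply Val; [assumption|lra].
  (* The isolation radius is the gap between m and the threshold C. *)
  - exists (IZR (g_num g) / IZR (g_den g) - m). split; [lra|]. intros y Hy A. apply Val; [assumption|].
    apply Rabs_def2 in A. lra.
  (* A rational m would make sqrt D rational, and with it the root of f. *)
  - intros (a & b & Hb & E). apply (river_irrational _ _ _ PP HK Rf f Hf).
    assert (XS := xroot_sqrt f SA). rewrite Ed in XS.
    exists (a * c_K c0 - ct_p ct * b * fB f)%Z, (2 * fA f * ct_p ct * b)%Z. split; [nia|].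
    apply IZR_lt in SA, HK, PP. apply eq_IZR_contrapositive in Hb.
    rewrite minus_IZR, !mult_IZR.
    apply (Rmult_eq_reg_l (2 * IZR (fA f))); [|lra].
    replace (2 * IZR (fA f) * xroot f) with (sqrt (IZR (disc (c_form c0))) - IZR (fB f)) by lra.
    replace (sqrt (IZR (disc (c_form c0)))) with (m * IZR (c_K c0) / IZR (ct_p ct)) by (unfold m; field; lra).
    rewrite E. field. lra.
  - exists (ct_p ct ^ 2 * disc (c_form c0))%Z, (c_K c0 ^ 2)%Z. split; [nia|].
    assert (D0 := disc_pos f SA SC). rewrite Ed in D0. apply IZR_lt in D0. apply IZR_lt in HK, PP.
    rewrite !Z.pow_2_r, !mult_IZR.
    replace (IZR (ct_p ct) * IZR (ct_p ct) * IZR (disc (c_form c0)) / (IZR (c_K c0) * IZR (c_K c0)))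
      with (Rsqr (IZR (ct_p ct) / IZR (c_K c0)) * IZR (disc (c_form c0))) by (unfold Rsqr; field; lra).
    rewrite sqrt_mult_alt by apply Rle_0_sqr. rewrite sqrt_Rsqr by (left; now apply Rdiv_lt_0_compat).
    unfold m. field. lra.
Qed.

(** * Certificates for the primes below 2000 *)

Open Scope Z_scope.

(** Primes with a common threshold share one trie. The thresholds increase; the minima of the first
    four groups are sqrt 5, sqrt 8, sqrt 221 / 5 and sqrt 1517 / 13, the first four Lagrange
    numbers. The words 4 and 7 of the first group encode LL and RR, which leaves the alternating
    word of the golden ratio. The largest minimum is sqrt 7157 / 23, for p = 67. *)
Definition groups : list group := [
Group 224 100 [4; 7]%positive 30 60 24 [
  Cert 5 3 [Cycle (Mat 2 1 1 3) (Form 1 (1) (-1)) 5 2 2];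
  Cert 11 8 [Cycle (Mat 3 1 1 4) (Form 1 (1) (-1)) 11 2 2; Cycle (Mat 5 2 2 3) (Form 1 (-1) (-1)) 11 2 2];
  Cert 19 15 [Cycle (Mat 4 1 1 5) (Form 1 (1) (-1)) 19 2 2; Cycle (Mat 7 3 3 4) (Form 1 (-1) (-1)) 19 2 2];
  Cert 29 6 [Cycle (Mat 5 4 4 9) (Form 1 (1) (-1)) 29 2 2; Cycle (Mat 5 1 1 6) (Form 1 (1) (-1)) 29 2 2];
  Cert 31 19 [Cycle (Mat 5 3 3 8) (Form 1 (1) (-1)) 31 2 2; Cycle (Mat 5 2 2 7) (Form 1 (1) (-1)) 31 2 2];
  Cert 41 35 [Cycle (Mat 6 1 1 7) (Form 1 (1) (-1)) 41 2 2; Cycle (Mat 11 5 5 6) (Form 1 (-1) (-1)) 41 2 2];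
  Cert 59 34 [Cycle (Mat 7 5 5 12) (Form 1 (1) (-1)) 59 2 2; Cycle (Mat 7 2 2 9) (Form 1 (1) (-1)) 59 2 2];
  Cert 61 44 [Cycle (Mat 7 4 4 11) (Form 1 (1) (-1)) 61 2 2; Cycle (Mat 7 3 3 10) (Form 1 (1) (-1)) 61 2 2];
  Cert 71 63 [Cycle (Mat 8 1 1 9) (Form 1 (1) (-1)) 71 2 2; Cycle (Mat 15 7 7 8) (Form 1 (-1) (-1)) 71 2 2];
  Cert 79 30 [Cycle (Mat 8 5 5 13) (Form 1 (1) (-1)) 79 2 2; Cycle (Mat 8 3 3 11) (Form 1 (1) (-1)) 79 2 2];
  Cert 89 80 [Cycle (Mat 9 1 1 10) (Form 1 (1) (-1)) 89 2 2; Cycle (Mat 9 8 8 17) (Form 1 (1) (-1)) 89 2 2];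
  Cert 101 23 [Cycle (Mat 9 4 4 13) (Form 1 (1) (-1)) 101 2 2; Cycle (Mat 14 5 5 9) (Form 1 (-1) (-1)) 101 2 2];
  Cert 109 99 [Cycle (Mat 10 1 1 11) (Form 1 (1) (-1)) 109 2 2; Cycle (Mat 19 9 9 10) (Form 1 (-1) (-1)) 109 2 2];
  Cert 131 12 [Cycle (Mat 11 10 10 21) (Form 1 (1) (-1)) 131 2 2; Cycle (Mat 11 1 1 12) (Form 1 (1) (-1)) 131 2 2];
  Cert 139 76 [Cycle (Mat 11 9 9 20) (Form 1 (1) (-1)) 139 2 2; Cycle (Mat 13 2 2 11) (Form 1 (-1) (-1)) 139 2 2];
  Cert 149 109 [Cycle (Mat 11 4 4 15) (Form 1 (1) (-1)) 149 2 2; Cycle (Mat 18 7 7 11) (Form 1 (-1) (-1)) 149 2 2];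
  Cert 151 28 [Cycle (Mat 11 5 5 16) (Form 1 (1) (-1)) 151 2 2; Cycle (Mat 11 6 6 17) (Form 1 (1) (-1)) 151 2 2];
  Cert 179 75 [Cycle (Mat 12 7 7 19) (Form 1 (1) (-1)) 179 2 2; Cycle (Mat 12 5 5 17) (Form 1 (1) (-1)) 179 2 2];
  Cert 181 14 [Cycle (Mat 13 12 12 25) (Form 1 (1) (-1)) 181 2 2; Cycle (Mat 14 1 1 13) (Form 1 (-1) (-1)) 181 2 2];
  Cert 191 89 [Cycle (Mat 13 2 2 15) (Form 1 (1) (-1)) 191 2 2; Cycle (Mat 24 11 11 13) (Form 1 (-1) (-1)) 191 2 2];
  Cert 199 138 [Cycle (Mat 13 10 10 23) (Form 1 (1) (-1)) 199 2 2; Cycle (Mat 13 3 3 16) (Form 1 (1) (-1)) 199 2 2];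
  Cert 211 33 [Cycle (Mat 13 6 6 19) (Form 1 (1) (-1)) 211 2 2; Cycle (Mat 13 7 7 20) (Form 1 (1) (-1)) 211 2 2];
  Cert 229 82 [Cycle (Mat 14 11 11 25) (Form 1 (1) (-1)) 229 2 2; Cycle (Mat 17 3 3 14) (Form 1 (-1) (-1)) 229 2 2];
  Cert 239 16 [Cycle (Mat 15 14 14 29) (Form 1 (1) (-1)) 239 2 2; Cycle (Mat 16 1 1 15) (Form 1 (-1) (-1)) 239 2 2];
  Cert 241 190 [Cycle (Mat 14 5 5 19) (Form 1 (1) (-1)) 241 2 2; Cycle (Mat 23 9 9 14) (Form 1 (-1) (-1)) 241 2 2];
  Cert 251 118 [Cycle (Mat 15 2 2 17) (Form 1 (1) (-1)) 251 2 2; Cycle (Mat 15 13 13 28) (Form 1 (1) (-1)) 251 2 2];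
  Cert 269 198 [Cycle (Mat 15 4 4 19) (Form 1 (1) (-1)) 269 2 2; Cycle (Mat 15 11 11 26) (Form 1 (1) (-1)) 269 2 2];
  Cert 271 17 [Cycle (Mat 16 15 15 31) (Form 1 (1) (-1)) 271 2 2; Cycle (Mat 17 1 1 16) (Form 1 (-1) (-1)) 271 2 2];
  Cert 281 244 [Cycle (Mat 15 8 8 23) (Form 1 (1) (-1)) 281 2 2; Cycle (Mat 22 7 7 15) (Form 1 (-1) (-1)) 281 2 2];
  Cert 311 253 [Cycle (Mat 16 11 11 27) (Form 1 (1) (-1)) 311 2 2; Cycle (Mat 16 5 5 21) (Form 1 (1) (-1)) 311 2 2];
  Cert 331 215 [Cycle (Mat 17 3 3 20) (Form 1 (1) (-1)) 331 2 2; Cycle (Mat 31 14 14 17) (Form 1 (-1) (-1)) 331 2 2];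
  Cert 349 144 [Cycle (Mat 17 12 12 29) (Form 1 (1) (-1)) 349 2 2; Cycle (Mat 17 5 5 22) (Form 1 (1) (-1)) 349 2 2];
  Cert 359 254 [Cycle (Mat 17 7 7 24) (Form 1 (1) (-1)) 359 2 2; Cycle (Mat 27 10 10 17) (Form 1 (-1) (-1)) 359 2 2];
  Cert 379 20 [Cycle (Mat 19 18 18 37) (Form 1 (1) (-1)) 379 2 2; Cycle (Mat 20 1 1 19) (Form 1 (-1) (-1)) 379 2 2];
  Cert 389 152 [Cycle (Mat 18 5 5 23) (Form 1 (1) (-1)) 389 2 2; Cycle (Mat 31 13 13 18) (Form 1 (-1) (-1)) 389 2 2];
  Cert 401 290 [Cycle (Mat 18 11 11 29) (Form 1 (1) (-1)) 401 2 2; Cycle (Mat 25 7 7 18) (Form 1 (-1) (-1)) 401 2 2];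
  Cert 409 130 [Cycle (Mat 19 3 3 22) (Form 1 (1) (-1)) 409 2 2; Cycle (Mat 35 16 16 19) (Form 1 (-1) (-1)) 409 2 2];
  Cert 419 21 [Cycle (Mat 20 19 19 39) (Form 1 (1) (-1)) 419 2 2; Cycle (Mat 20 1 1 21) (Form 1 (1) (-1)) 419 2 2];
  Cert 421 111 [Cycle (Mat 19 15 15 34) (Form 1 (1) (-1)) 421 2 2; Cycle (Mat 23 4 4 19) (Form 1 (-1) (-1)) 421 2 2];
  Cert 431 341 [Cycle (Mat 19 5 5 24) (Form 1 (1) (-1)) 431 2 2; Cycle (Mat 19 14 14 33) (Form 1 (1) (-1)) 431 2 2];
  Cert 439 70 [Cycle (Mat 19 6 6 25) (Form 1 (1) (-1)) 439 2 2; Cycle (Mat 19 13 13 32) (Form 1 (1) (-1)) 439 2 2];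
  Cert 449 166 [Cycle (Mat 19 8 8 27) (Form 1 (1) (-1)) 449 2 2; Cycle (Mat 30 11 11 19) (Form 1 (-1) (-1)) 449 2 2];
  Cert 461 440 [Cycle (Mat 21 1 1 22) (Form 1 (1) (-1)) 461 2 2; Cycle (Mat 41 20 20 21) (Form 1 (-1) (-1)) 461 2 2];
  Cert 479 251 [Cycle (Mat 21 19 19 40) (Form 1 (1) (-1)) 479 2 2; Cycle (Mat 21 2 2 23) (Form 1 (1) (-1)) 479 2 2];
  Cert 491 418 [Cycle (Mat 20 7 7 27) (Form 1 (1) (-1)) 491 2 2; Cycle (Mat 33 13 13 20) (Form 1 (-1) (-1)) 491 2 2];
  Cert 499 225 [Cycle (Mat 20 11 11 31) (Form 1 (1) (-1)) 499 2 2; Cycle (Mat 29 9 9 20) (Form 1 (-1) (-1)) 499 2 2];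
  Cert 509 122 [Cycle (Mat 21 4 4 25) (Form 1 (1) (-1)) 509 2 2; Cycle (Mat 21 17 17 38) (Form 1 (1) (-1)) 509 2 2];
  Cert 521 100 [Cycle (Mat 21 5 5 26) (Form 1 (1) (-1)) 521 2 2; Cycle (Mat 37 16 16 21) (Form 1 (-1) (-1)) 521 2 2];
  Cert 541 369 [Cycle (Mat 22 19 19 41) (Form 1 (1) (-1)) 541 2 2; Cycle (Mat 25 3 3 22) (Form 1 (-1) (-1)) 541 2 2];
  Cert 569 233 [Cycle (Mat 22 17 17 39) (Form 1 (1) (-1)) 569 2 2; Cycle (Mat 22 5 5 27) (Form 1 (1) (-1)) 569 2 2];
  Cert 571 298 [Cycle (Mat 23 21 21 44) (Form 1 (1) (-1)) 571 2 2; Cycle (Mat 25 2 2 23) (Form 1 (-1) (-1)) 571 2 2];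
  Cert 599 25 [Cycle (Mat 24 23 23 47) (Form 1 (1) (-1)) 599 2 2; Cycle (Mat 25 1 1 24) (Form 1 (-1) (-1)) 599 2 2];
  Cert 601 465 [Cycle (Mat 22 9 9 31) (Form 1 (1) (-1)) 601 2 2; Cycle (Mat 22 13 13 35) (Form 1 (1) (-1)) 601 2 2];
  Cert 619 243 [Cycle (Mat 23 5 5 28) (Form 1 (1) (-1)) 619 2 2; Cycle (Mat 23 18 18 41) (Form 1 (1) (-1)) 619 2 2];
  Cert 631 110 [Cycle (Mat 23 17 17 40) (Form 1 (1) (-1)) 631 2 2; Cycle (Mat 29 6 6 23) (Form 1 (-1) (-1)) 631 2 2];
  Cert 641 279 [Cycle (Mat 23 16 16 39) (Form 1 (1) (-1)) 641 2 2; Cycle (Mat 30 7 7 23) (Form 1 (-1) (-1)) 641 2 2];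
  Cert 659 201 [Cycle (Mat 23 13 13 36) (Form 1 (1) (-1)) 659 2 2; Cycle (Mat 33 10 10 23) (Form 1 (-1) (-1)) 659 2
   2];
  Cert 661 58 [Cycle (Mat 23 11 11 34) (Form 1 (1) (-1)) 661 2 2; Cycle (Mat 35 12 12 23) (Form 1 (-1) (-1)) 661 2 2];
  Cert 691 222 [Cycle (Mat 25 3 3 28) (Form 1 (1) (-1)) 691 2 2; Cycle (Mat 47 22 22 25) (Form 1 (-1) (-1)) 691 2 2];
  Cert 701 27 [Cycle (Mat 26 25 25 51) (Form 1 (1) (-1)) 701 2 2; Cycle (Mat 27 1 1 26) (Form 1 (-1) (-1)) 701 2 2];
  Cert 709 171 [Cycle (Mat 25 4 4 29) (Form 1 (1) (-1)) 709 2 2; Cycle (Mat 46 21 21 25) (Form 1 (-1) (-1)) 709 2 2];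
  Cert 719 390 [Cycle (Mat 24 11 11 35) (Form 1 (1) (-1)) 719 2 2; Cycle (Mat 37 13 13 24) (Form 1 (-1) (-1)) 719 2
   2];
  Cert 739 119 [Cycle (Mat 25 6 6 31) (Form 1 (1) (-1)) 739 2 2; Cycle (Mat 25 19 19 44) (Form 1 (1) (-1)) 739 2 2];
  Cert 751 541 [Cycle (Mat 25 18 18 43) (Form 1 (1) (-1)) 751 2 2; Cycle (Mat 25 7 7 32) (Form 1 (1) (-1)) 751 2 2];
  Cert 761 670 [Cycle (Mat 25 17 17 42) (Form 1 (1) (-1)) 761 2 2; Cycle (Mat 33 8 8 25) (Form 1 (-1) (-1)) 761 2 2];
  Cert 769 431 [Cycle (Mat 25 16 16 41) (Form 1 (1) (-1)) 769 2 2; Cycle (Mat 25 9 9 34) (Form 1 (1) (-1)) 769 2 2];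
  Cert 809 467 [Cycle (Mat 26 19 19 45) (Form 1 (1) (-1)) 809 2 2; Cycle (Mat 33 7 7 26) (Form 1 (-1) (-1)) 809 2 2];
  Cert 811 783 [Cycle (Mat 28 1 1 29) (Form 1 (1) (-1)) 811 2 2; Cycle (Mat 55 27 27 28) (Form 1 (-1) (-1)) 811 2 2];
  Cert 821 213 [Cycle (Mat 27 23 23 50) (Form 1 (1) (-1)) 821 2 2; Cycle (Mat 27 4 4 31) (Form 1 (1) (-1)) 821 2 2];
  Cert 829 96 [Cycle (Mat 26 17 17 43) (Form 1 (1) (-1)) 829 2 2; Cycle (Mat 35 9 9 26) (Form 1 (-1) (-1)) 829 2 2];
  Cert 839 498 [Cycle (Mat 27 5 5 32) (Form 1 (1) (-1)) 839 2 2; Cycle (Mat 27 22 22 49) (Form 1 (1) (-1)) 839 2 2];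
  Cert 859 277 [Cycle (Mat 28 3 3 31) (Form 1 (1) (-1)) 859 2 2; Cycle (Mat 28 25 25 53) (Form 1 (1) (-1)) 859 2 2];
  Cert 881 555 [Cycle (Mat 27 19 19 46) (Form 1 (1) (-1)) 881 2 2; Cycle (Mat 35 8 8 27) (Form 1 (-1) (-1)) 881 2 2];
  Cert 911 68 [Cycle (Mat 27 13 13 40) (Form 1 (1) (-1)) 911 2 2; Cycle (Mat 27 14 14 41) (Form 1 (1) (-1)) 911 2 2];
  Cert 919 603 [Cycle (Mat 29 3 3 32) (Form 1 (1) (-1)) 919 2 2; Cycle (Mat 55 26 26 29) (Form 1 (-1) (-1)) 919 2 2];
  Cert 929 31 [Cycle (Mat 30 29 29 59) (Form 1 (1) (-1)) 929 2 2; Cycle (Mat 31 1 1 30) (Form 1 (-1) (-1)) 929 2 2];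
  Cert 941 714 [Cycle (Mat 29 25 25 54) (Form 1 (1) (-1)) 941 2 2; Cycle (Mat 29 4 4 33) (Form 1 (1) (-1)) 941 2 2];
  Cert 971 174 [Cycle (Mat 28 11 11 39) (Form 1 (1) (-1)) 971 2 2; Cycle (Mat 45 17 17 28) (Form 1 (-1) (-1)) 971 2
   2];
  Cert 991 32 [Cycle (Mat 31 30 30 61) (Form 1 (1) (-1)) 991 2 2; Cycle (Mat 31 1 1 32) (Form 1 (1) (-1)) 991 2 2];
  Cert 1009 627 [Cycle (Mat 29 8 8 37) (Form 1 (1) (-1)) 1009 2 2; Cycle (Mat 50 21 21 29) (Form 1 (-1) (-1)) 1009 2
   2];
  Cert 1019 526 [Cycle (Mat 31 29 29 60) (Form 1 (1) (-1)) 1019 2 2; Cycle (Mat 31 2 2 33) (Form 1 (1) (-1)) 1019 2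
   2];
  Cert 1021 564 [Cycle (Mat 29 9 9 38) (Form 1 (1) (-1)) 1021 2 2; Cycle (Mat 49 20 20 29) (Form 1 (-1) (-1)) 1021 2
   2];
  Cert 1031 107 [Cycle (Mat 29 19 19 48) (Form 1 (1) (-1)) 1031 2 2; Cycle (Mat 39 10 10 29) (Form 1 (-1) (-1)) 1031
   2 2];
  Cert 1039 753 [Cycle (Mat 29 11 11 40) (Form 1 (1) (-1)) 1039 2 2; Cycle (Mat 47 18 18 29) (Form 1 (-1) (-1)) 1039
   2 2];
  Cert 1049 724 [Cycle (Mat 29 13 13 42) (Form 1 (1) (-1)) 1049 2 2; Cycle (Mat 29 16 16 45) (Form 1 (1) (-1)) 1049 2
   2];
  Cert 1051 73 [Cycle (Mat 29 14 14 43) (Form 1 (1) (-1)) 1051 2 2; Cycle (Mat 44 15 15 29) (Form 1 (-1) (-1)) 1051 2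
   2];
  Cert 1061 460 [Cycle (Mat 30 23 23 53) (Form 1 (1) (-1)) 1061 2 2; Cycle (Mat 37 7 7 30) (Form 1 (-1) (-1)) 1061 2
   2];
  Cert 1069 276 [Cycle (Mat 31 27 27 58) (Form 1 (1) (-1)) 1069 2 2; Cycle (Mat 35 4 4 31) (Form 1 (-1) (-1)) 1069 2
   2];
  Cert 1091 212 [Cycle (Mat 31 5 5 36) (Form 1 (1) (-1)) 1091 2 2; Cycle (Mat 31 26 26 57) (Form 1 (1) (-1)) 1091 2
   2];
  Cert 1109 407 [Cycle (Mat 30 19 19 49) (Form 1 (1) (-1)) 1109 2 2; Cycle (Mat 30 11 11 41) (Form 1 (1) (-1)) 1109 2
   2];
  Cert 1129 328 [Cycle (Mat 31 24 24 55) (Form 1 (1) (-1)) 1129 2 2; Cycle (Mat 38 7 7 31) (Form 1 (-1) (-1)) 1129 2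
   2];
  Cert 1151 559 [Cycle (Mat 33 2 2 35) (Form 1 (1) (-1)) 1151 2 2; Cycle (Mat 33 31 31 64) (Form 1 (1) (-1)) 1151 2
   2];
  Cert 1171 1058 [Cycle (Mat 31 21 21 52) (Form 1 (1) (-1)) 1171 2 2; Cycle (Mat 41 10 10 31) (Form 1 (-1) (-1)) 1171
   2 2];
  Cert 1181 648 [Cycle (Mat 31 20 20 51) (Form 1 (1) (-1)) 1181 2 2; Cycle (Mat 42 11 11 31) (Form 1 (-1) (-1)) 1181
   2 2];
  Cert 1201 78 [Cycle (Mat 31 15 15 46) (Form 1 (1) (-1)) 1201 2 2; Cycle (Mat 31 16 16 47) (Form 1 (1) (-1)) 1201 2
   2];
  Cert 1229 745 [Cycle (Mat 33 28 28 61) (Form 1 (1) (-1)) 1229 2 2; Cycle (Mat 38 5 5 33) (Form 1 (-1) (-1)) 1229 2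
   2];
  Cert 1231 270 [Cycle (Mat 32 9 9 41) (Form 1 (1) (-1)) 1231 2 2; Cycle (Mat 32 23 23 55) (Form 1 (1) (-1)) 1231 2
   2];
  Cert 1249 405 [Cycle (Mat 34 3 3 37) (Form 1 (1) (-1)) 1249 2 2; Cycle (Mat 65 31 31 34) (Form 1 (-1) (-1)) 1249 2
   2];
  Cert 1259 36 [Cycle (Mat 35 34 34 69) (Form 1 (1) (-1)) 1259 2 2; Cycle (Mat 36 1 1 35) (Form 1 (-1) (-1)) 1259 2
   2];
  Cert 1279 600 [Cycle (Mat 32 17 17 49) (Form 1 (1) (-1)) 1279 2 2; Cycle (Mat 47 15 15 32) (Form 1 (-1) (-1)) 1279
   2 2];
  Cert 1289 157 [Cycle (Mat 33 8 8 41) (Form 1 (1) (-1)) 1289 2 2; Cycle (Mat 58 25 25 33) (Form 1 (-1) (-1)) 1289 2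
   2];
  Cert 1291 628 [Cycle (Mat 35 2 2 37) (Form 1 (1) (-1)) 1291 2 2; Cycle (Mat 68 33 33 35) (Form 1 (-1) (-1)) 1291 2
   2];
  Cert 1301 268 [Cycle (Mat 34 29 29 63) (Form 1 (1) (-1)) 1301 2 2; Cycle (Mat 39 5 5 34) (Form 1 (-1) (-1)) 1301 2
   2];
  Cert 1319 920 [Cycle (Mat 33 10 10 43) (Form 1 (1) (-1)) 1319 2 2; Cycle (Mat 33 23 23 56) (Form 1 (1) (-1)) 1319 2
   2];
  Cert 1321 869 [Cycle (Mat 35 3 3 38) (Form 1 (1) (-1)) 1321 2 2; Cycle (Mat 67 32 32 35) (Form 1 (-1) (-1)) 1321 2
   2];
  Cert 1361 1279 [Cycle (Mat 33 17 17 50) (Form 1 (1) (-1)) 1361 2 2; Cycle (Mat 49 16 16 33) (Form 1 (-1) (-1)) 1361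
   2 2];
  Cert 1381 610 [Cycle (Mat 34 9 9 43) (Form 1 (1) (-1)) 1381 2 2; Cycle (Mat 59 25 25 34) (Form 1 (-1) (-1)) 1381 2
   2];
  Cert 1399 1160 [Cycle (Mat 35 6 6 41) (Form 1 (1) (-1)) 1399 2 2; Cycle (Mat 35 29 29 64) (Form 1 (1) (-1)) 1399 2
   2];
  Cert 1409 125 [Cycle (Mat 34 11 11 45) (Form 1 (1) (-1)) 1409 2 2; Cycle (Mat 34 23 23 57) (Form 1 (1) (-1)) 1409 2
   2];
  Cert 1429 547 [Cycle (Mat 34 13 13 47) (Form 1 (1) (-1)) 1429 2 2; Cycle (Mat 34 21 21 55) (Form 1 (1) (-1)) 1429 2
   2];
  Cert 1439 739 [Cycle (Mat 37 35 35 72) (Form 1 (1) (-1)) 1439 2 2; Cycle (Mat 39 2 2 37) (Form 1 (-1) (-1)) 1439 2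
   2];
  Cert 1451 1169 [Cycle (Mat 36 31 31 67) (Form 1 (1) (-1)) 1451 2 2; Cycle (Mat 41 5 5 36) (Form 1 (-1) (-1)) 1451 2
   2];
  Cert 1459 167 [Cycle (Mat 35 26 26 61) (Form 1 (1) (-1)) 1459 2 2; Cycle (Mat 44 9 9 35) (Form 1 (-1) (-1)) 1459 2
   2];
  Cert 1471 478 [Cycle (Mat 37 3 3 40) (Form 1 (1) (-1)) 1471 2 2; Cycle (Mat 37 34 34 71) (Form 1 (1) (-1)) 1471 2
   2];
  Cert 1481 39 [Cycle (Mat 38 37 37 75) (Form 1 (1) (-1)) 1481 2 2; Cycle (Mat 38 1 1 39) (Form 1 (1) (-1)) 1481 2 2];
  Cert 1489 809 [Cycle (Mat 35 11 11 46) (Form 1 (1) (-1)) 1489 2 2; Cycle (Mat 59 24 24 35) (Form 1 (-1) (-1)) 1489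
   2 2];
  Cert 1499 209 [Cycle (Mat 36 7 7 43) (Form 1 (1) (-1)) 1499 2 2; Cycle (Mat 65 29 29 36) (Form 1 (-1) (-1)) 1499 2
   2];
  Cert 1511 346 [Cycle (Mat 35 13 13 48) (Form 1 (1) (-1)) 1511 2 2; Cycle (Mat 57 22 22 35) (Form 1 (-1) (-1)) 1511
   2 2];
  Cert 1531 1444 [Cycle (Mat 35 18 18 53) (Form 1 (1) (-1)) 1531 2 2; Cycle (Mat 52 17 17 35) (Form 1 (-1) (-1)) 1531
   2 2];
  Cert 1549 530 [Cycle (Mat 38 35 35 73) (Form 1 (1) (-1)) 1549 2 2; Cycle (Mat 38 3 3 41) (Form 1 (1) (-1)) 1549 2
   2];
  Cert 1559 40 [Cycle (Mat 39 38 38 77) (Form 1 (1) (-1)) 1559 2 2; Cycle (Mat 40 1 1 39) (Form 1 (-1) (-1)) 1559 2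
   2];
  Cert 1571 1004 [Cycle (Mat 36 25 25 61) (Form 1 (1) (-1)) 1571 2 2; Cycle (Mat 47 11 11 36) (Form 1 (-1) (-1)) 1571
   2 2];
  Cert 1579 897 [Cycle (Mat 37 7 7 44) (Form 1 (1) (-1)) 1579 2 2; Cycle (Mat 37 30 30 67) (Form 1 (1) (-1)) 1579 2
   2];
  Cert 1601 996 [Cycle (Mat 37 8 8 45) (Form 1 (1) (-1)) 1601 2 2; Cycle (Mat 37 29 29 66) (Form 1 (1) (-1)) 1601 2
   2];
  Cert 1609 636 [Cycle (Mat 38 5 5 43) (Form 1 (1) (-1)) 1609 2 2; Cycle (Mat 71 33 33 38) (Form 1 (-1) (-1)) 1609 2
   2];
  Cert 1619 765 [Cycle (Mat 36 19 19 55) (Form 1 (1) (-1)) 1619 2 2; Cycle (Mat 36 17 17 53) (Form 1 (1) (-1)) 1619 2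
   2];
  Cert 1621 1446 [Cycle (Mat 37 28 28 65) (Form 1 (1) (-1)) 1621 2 2; Cycle (Mat 46 9 9 37) (Form 1 (-1) (-1)) 1621 2
   2];
  Cert 1669 136 [Cycle (Mat 37 12 12 49) (Form 1 (1) (-1)) 1669 2 2; Cycle (Mat 37 25 25 62) (Form 1 (1) (-1)) 1669 2
   2];
  Cert 1699 230 [Cycle (Mat 37 22 22 59) (Form 1 (1) (-1)) 1699 2 2; Cycle (Mat 37 15 15 52) (Form 1 (1) (-1)) 1699 2
   2];
  Cert 1709 1109 [Cycle (Mat 37 20 20 57) (Form 1 (1) (-1)) 1709 2 2; Cycle (Mat 54 17 17 37) (Form 1 (-1) (-1)) 1709
   2 2];
  Cert 1721 42 [Cycle (Mat 41 40 40 81) (Form 1 (1) (-1)) 1721 2 2; Cycle (Mat 41 1 1 42) (Form 1 (1) (-1)) 1721 2 2];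
  Cert 1741 1421 [Cycle (Mat 38 11 11 49) (Form 1 (1) (-1)) 1741 2 2; Cycle (Mat 38 27 27 65) (Form 1 (1) (-1)) 1741
   2 2];
  Cert 1759 859 [Cycle (Mat 41 2 2 43) (Form 1 (1) (-1)) 1759 2 2; Cycle (Mat 80 39 39 41) (Form 1 (-1) (-1)) 1759 2
   2];
  Cert 1789 236 [Cycle (Mat 38 15 15 53) (Form 1 (1) (-1)) 1789 2 2; Cycle (Mat 61 23 23 38) (Form 1 (-1) (-1)) 1789
   2 2];
  Cert 1801 427 [Cycle (Mat 38 21 21 59) (Form 1 (1) (-1)) 1801 2 2; Cycle (Mat 55 17 17 38) (Form 1 (-1) (-1)) 1801
   2 2];
  Cert 1811 186 [Cycle (Mat 39 29 29 68) (Form 1 (1) (-1)) 1811 2 2; Cycle (Mat 39 10 10 49) (Form 1 (1) (-1)) 1811 2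
   2];
  Cert 1831 1053 [Cycle (Mat 40 33 33 73) (Form 1 (1) (-1)) 1831 2 2; Cycle (Mat 40 7 7 47) (Form 1 (1) (-1)) 1831 2
   2];
  Cert 1861 1498 [Cycle (Mat 41 36 36 77) (Form 1 (1) (-1)) 1861 2 2; Cycle (Mat 46 5 5 41) (Form 1 (-1) (-1)) 1861 2
   2];
  Cert 1871 672 [Cycle (Mat 39 25 25 64) (Form 1 (1) (-1)) 1871 2 2; Cycle (Mat 53 14 14 39) (Form 1 (-1) (-1)) 1871
   2 2];
  Cert 1879 423 [Cycle (Mat 40 31 31 71) (Form 1 (1) (-1)) 1879 2 2; Cycle (Mat 49 9 9 40) (Form 1 (-1) (-1)) 1879 2
   2];
  Cert 1889 1066 [Cycle (Mat 39 23 23 62) (Form 1 (1) (-1)) 1889 2 2; Cycle (Mat 55 16 16 39) (Form 1 (-1) (-1)) 1889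
   2 2];
  Cert 1901 98 [Cycle (Mat 39 19 19 58) (Form 1 (1) (-1)) 1901 2 2; Cycle (Mat 39 20 20 59) (Form 1 (1) (-1)) 1901 2
   2];
  Cert 1931 988 [Cycle (Mat 43 41 41 84) (Form 1 (1) (-1)) 1931 2 2; Cycle (Mat 43 2 2 45) (Form 1 (1) (-1)) 1931 2
   2];
  Cert 1949 1161 [Cycle (Mat 42 5 5 47) (Form 1 (1) (-1)) 1949 2 2; Cycle (Mat 42 37 37 79) (Form 1 (1) (-1)) 1949 2
   2];
  Cert 1951 147 [Cycle (Mat 40 13 13 53) (Form 1 (1) (-1)) 1951 2 2; Cycle (Mat 40 27 27 67) (Form 1 (1) (-1)) 1951 2
   2];
  Cert 1979 45 [Cycle (Mat 44 43 43 87) (Form 1 (1) (-1)) 1979 2 2; Cycle (Mat 44 1 1 45) (Form 1 (1) (-1)) 1979 2 2];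
  Cert 1999 1050 [Cycle (Mat 40 19 19 59) (Form 1 (1) (-1)) 1999 2 2; Cycle (Mat 40 21 21 61) (Form 1 (1) (-1)) 1999
   2 2]];
Group 2829 1000 [8; 15; 20; 27; 178; 205]%positive 30 60 24 [
  Cert 2 0 [Cycle (Mat 2 0 0 1) (Form 2 (0) (-1)) 2 4 4];
  Cert 7 5 [Cycle (Mat 2 1 1 4) (Form 1 (0) (-2)) 7 4 4; Cycle (Mat 2 1 1 4) (Form 1 (2) (-1)) 7 4 4];
  Cert 17 3 [Cycle (Mat 5 2 4 5) (Form 2 (0) (-1)) 17 4 4; Cycle (Mat 3 4 1 7) (Form 1 (2) (-1)) 17 4 4];
  Cert 23 14 [Cycle (Mat 4 3 3 8) (Form 1 (0) (-2)) 23 4 4; Cycle (Mat 6 1 1 4) (Form 1 (-2) (-1)) 23 4 4];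
  Cert 47 20 [Cycle (Mat 7 1 2 7) (Form 2 (0) (-1)) 47 4 4; Cycle (Mat 12 5 5 6) (Form 2 (0) (-1)) 47 4 4];
  Cert 73 16 [Cycle (Mat 9 2 4 9) (Form 2 (0) (-1)) 73 4 4; Cycle (Mat 7 12 5 19) (Form 1 (2) (-1)) 73 4 4];
  Cert 97 7 [Cycle (Mat 13 6 12 13) (Form 2 (0) (-1)) 97 4 4; Cycle (Mat 7 1 1 14) (Form 1 (0) (-2)) 97 4 4];
  Cert 103 19 [Cycle (Mat 8 5 5 16) (Form 1 (0) (-2)) 103 4 4; Cycle (Mat 14 3 3 8) (Form 1 (-2) (-1)) 103 4 4];
  Cert 113 31 [Cycle (Mat 9 7 7 18) (Form 1 (0) (-2)) 113 4 4; Cycle (Mat 11 2 4 11) (Form 2 (0) (-1)) 113 4 4];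
  Cert 127 8 [Cycle (Mat 15 7 14 15) (Form 2 (0) (-1)) 127 4 4; Cycle (Mat 8 1 1 16) (Form 1 (0) (-2)) 127 4 4];
  Cert 137 53 [Cycle (Mat 9 5 5 18) (Form 1 (0) (-2)) 137 4 4; Cycle (Mat 13 8 4 13) (Form 1 (0) (-2)) 137 4 4];
  Cert 167 77 [Cycle (Mat 13 1 2 13) (Form 2 (0) (-1)) 167 4 4; Cycle (Mat 12 11 11 24) (Form 1 (0) (-2)) 167 4 4];
  Cert 193 26 [Cycle (Mat 11 7 7 22) (Form 1 (0) (-2)) 193 4 4; Cycle (Mat 19 4 4 11) (Form 1 (-2) (-1)) 193 4 4];
  Cert 223 119 [Cycle (Mat 14 13 13 28) (Form 1 (0) (-2)) 223 4 4; Cycle (Mat 15 2 1 15) (Form 1 (0) (-2)) 223 4 4];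
  Cert 233 159 [Cycle (Mat 19 8 16 19) (Form 2 (0) (-1)) 233 4 4; Cycle (Mat 25 3 14 11) (Form 1 (-2) (-1)) 233 4 4];
  Cert 257 30 [Cycle (Mat 17 4 8 17) (Form 2 (0) (-1)) 257 4 4; Cycle (Mat 13 22 9 35) (Form 1 (2) (-1)) 257 4 4];
  Cert 263 55 [Cycle (Mat 19 7 14 19) (Form 2 (0) (-1)) 263 4 4; Cycle (Mat 24 5 5 12) (Form 2 (0) (-1)) 263 4 4];
  Cert 313 60 [Cycle (Mat 13 5 5 26) (Form 1 (0) (-2)) 313 4 4; Cycle (Mat 21 16 8 21) (Form 1 (0) (-2)) 313 4 4];
  Cert 337 324 [Cycle (Mat 13 1 1 26) (Form 1 (0) (-2)) 337 4 4; Cycle (Mat 13 12 12 37) (Form 1 (2) (-1)) 337 4 4];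
  Cert 353 93 [Cycle (Mat 17 15 15 34) (Form 1 (0) (-2)) 353 4 4; Cycle (Mat 21 2 2 17) (Form 1 (-2) (-1)) 353 4 4];
  Cert 367 223 [Cycle (Mat 23 9 18 23) (Form 2 (0) (-1)) 367 4 4; Cycle (Mat 14 5 5 28) (Form 1 (0) (-2)) 367 4 4];
  Cert 383 260 [Cycle (Mat 25 11 22 25) (Form 2 (0) (-1)) 383 4 4; Cycle (Mat 28 3 3 14) (Form 2 (0) (-1)) 383 4 4];
  Cert 433 330 [Cycle (Mat 19 17 17 38) (Form 1 (0) (-2)) 433 4 4; Cycle (Mat 21 2 4 21) (Form 2 (0) (-1)) 433 4 4];
  Cert 457 40 [Cycle (Mat 17 11 11 34) (Form 1 (0) (-2)) 457 4 4; Cycle (Mat 29 6 6 17) (Form 1 (-2) (-1)) 457 4 4];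
  Cert 463 130 [Cycle (Mat 16 7 7 32) (Form 1 (0) (-2)) 463 4 4; Cycle (Mat 34 9 9 16) (Form 1 (-2) (-1)) 463 4 4];
  Cert 487 289 [Cycle (Mat 16 5 5 32) (Form 1 (0) (-2)) 487 4 4; Cycle (Mat 16 11 11 38) (Form 1 (2) (-1)) 487 4 4];
  Cert 503 173 [Cycle (Mat 29 13 26 29) (Form 2 (0) (-1)) 503 4 4; Cycle (Mat 32 3 3 16) (Form 2 (0) (-1)) 503 4 4];
  Cert 577 560 [Cycle (Mat 17 1 1 34) (Form 1 (0) (-2)) 577 4 4; Cycle (Mat 17 16 16 49) (Form 1 (2) (-1)) 577 4 4];
  Cert 593 522 [Cycle (Mat 21 17 17 42) (Form 1 (0) (-2)) 593 4 4; Cycle (Mat 29 4 4 21) (Form 1 (-2) (-1)) 593 4 4];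
  Cert 607 97 [Cycle (Mat 25 3 6 25) (Form 2 (0) (-1)) 607 4 4; Cycle (Mat 63 19 41 22) (Form 1 (-2) (-1)) 607 4 4];
  Cert 617 469 [Cycle (Mat 23 21 21 46) (Form 1 (0) (-2)) 617 4 4; Cycle (Mat 27 2 2 23) (Form 1 (-2) (-1)) 617 4 4];
  Cert 647 18 [Cycle (Mat 35 17 34 35) (Form 2 (0) (-1)) 647 4 4; Cycle (Mat 18 1 1 36) (Form 1 (0) (-2)) 647 4 4];
  Cert 673 478 [Cycle (Mat 19 7 7 38) (Form 1 (0) (-2)) 673 4 4; Cycle (Mat 31 12 24 31) (Form 2 (0) (-1)) 673 4 4];
  Cert 727 377 [Cycle (Mat 26 25 25 52) (Form 1 (0) (-2)) 727 4 4; Cycle (Mat 26 1 1 28) (Form 1 (2) (-1)) 727 4 4];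
  Cert 743 692 [Cycle (Mat 22 15 15 44) (Form 1 (0) (-2)) 743 4 4; Cycle (Mat 22 7 7 36) (Form 1 (2) (-1)) 743 4 4];
  Cert 823 681 [Cycle (Mat 29 3 6 29) (Form 2 (0) (-1)) 823 4 4; Cycle (Mat 52 23 23 26) (Form 2 (0) (-1)) 823 4 4];
  Cert 857 510 [Cycle (Mat 21 5 5 42) (Form 1 (0) (-2)) 857 4 4; Cycle (Mat 37 32 16 37) (Form 1 (0) (-2)) 857 4 4];
  Cert 863 306 [Cycle (Mat 31 7 14 31) (Form 2 (0) (-1)) 863 4 4; Cycle (Mat 48 17 17 24) (Form 2 (0) (-1)) 863 4 4];
  Cert 887 101 [Cycle (Mat 35 13 26 35) (Form 2 (0) (-1)) 887 4 4; Cycle (Mat 53 9 31 22) (Form 1 (-2) (-1)) 887 4 4];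
  Cert 937 428 [Cycle (Mat 35 12 24 35) (Form 2 (0) (-1)) 937 4 4; Cycle (Mat 46 11 11 23) (Form 2 (0) (-1)) 937 4 4];
  Cert 953 246 [Cycle (Mat 29 27 27 58) (Form 1 (0) (-2)) 953 4 4; Cycle (Mat 33 2 2 29) (Form 1 (-2) (-1)) 953 4 4];
  Cert 967 22 [Cycle (Mat 43 21 42 43) (Form 2 (0) (-1)) 967 4 4; Cycle (Mat 22 1 1 44) (Form 1 (0) (-2)) 967 4 4];
  Cert 977 106 [Cycle (Mat 23 9 9 46) (Form 1 (0) (-2)) 977 4 4; Cycle (Mat 37 14 28 37) (Form 2 (0) (-1)) 977 4 4];
  Cert 983 225 [Cycle (Mat 24 13 13 48) (Form 1 (0) (-2)) 983 4 4; Cycle (Mat 46 11 11 24) (Form 1 (-2) (-1)) 983 4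
   4];
  Cert 1033 202 [Cycle (Mat 23 5 5 46) (Form 1 (0) (-2)) 1033 4 4; Cycle (Mat 59 18 18 23) (Form 1 (-2) (-1)) 1033 4
   4];
  Cert 1063 1002 [Cycle (Mat 35 9 18 35) (Form 2 (0) (-1)) 1063 4 4; Cycle (Mat 69 17 43 26) (Form 1 (-2) (-1)) 1063
   4 4];
  Cert 1087 560 [Cycle (Mat 32 31 31 64) (Form 1 (0) (-2)) 1087 4 4; Cycle (Mat 34 1 1 32) (Form 1 (-2) (-1)) 1087 4
   4];
  Cert 1097 345 [Cycle (Mat 27 19 19 54) (Form 1 (0) (-2)) 1097 4 4; Cycle (Mat 35 8 16 35) (Form 2 (0) (-1)) 1097 4
   4];
  Cert 1103 942 [Cycle (Mat 24 7 7 48) (Form 1 (0) (-2)) 1103 4 4; Cycle (Mat 24 17 17 58) (Form 1 (2) (-1)) 1103 4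
   4];
  Cert 1153 99 [Cycle (Mat 29 23 23 58) (Form 1 (0) (-2)) 1153 4 4; Cycle (Mat 35 12 6 35) (Form 1 (0) (-2)) 1153 4
   4];
  Cert 1193 750 [Cycle (Mat 31 27 27 62) (Form 1 (0) (-2)) 1193 4 4; Cycle (Mat 35 4 8 35) (Form 2 (0) (-1)) 1193 4
   4];
  Cert 1217 904 [Cycle (Mat 35 2 4 35) (Form 2 (0) (-1)) 1217 4 4; Cycle (Mat 66 31 31 33) (Form 2 (0) (-1)) 1217 4
   4];
  Cert 1223 629 [Cycle (Mat 34 33 33 68) (Form 1 (0) (-2)) 1223 4 4; Cycle (Mat 35 2 1 35) (Form 1 (0) (-2)) 1223 4
   4];
  Cert 1297 1192 [Cycle (Mat 31 25 25 62) (Form 1 (0) (-2)) 1297 4 4; Cycle (Mat 37 6 12 37) (Form 2 (0) (-1)) 1297 4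
   4];
  Cert 1303 927 [Cycle (Mat 26 7 7 52) (Form 1 (0) (-2)) 1303 4 4; Cycle (Mat 45 38 19 45) (Form 1 (0) (-2)) 1303 4
   4];
  Cert 1327 536 [Cycle (Mat 47 21 42 47) (Form 2 (0) (-1)) 1327 4 4; Cycle (Mat 26 31 5 57) (Form 1 (2) (-1)) 1327 4
   4];
  Cert 1367 665 [Cycle (Mat 37 1 2 37) (Form 2 (0) (-1)) 1367 4 4; Cycle (Mat 36 35 35 72) (Form 1 (0) (-2)) 1367 4
   4];
  Cert 1423 912 [Cycle (Mat 39 7 14 39) (Form 2 (0) (-1)) 1423 4 4; Cycle (Mat 32 25 25 64) (Form 1 (0) (-2)) 1423 4
   4];
  Cert 1433 292 [Cycle (Mat 49 22 44 49) (Form 2 (0) (-1)) 1433 4 4; Cycle (Mat 27 32 5 59) (Form 1 (2) (-1)) 1433 4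
   4];
  Cert 1447 1318 [Cycle (Mat 45 17 34 45) (Form 2 (0) (-1)) 1447 4 4; Cycle (Mat 28 39 11 67) (Form 1 (2) (-1)) 1447
   4 4];
  Cert 1487 823 [Cycle (Mat 28 9 9 56) (Form 1 (0) (-2)) 1487 4 4; Cycle (Mat 47 38 19 47) (Form 1 (0) (-2)) 1487 4
   4];
  Cert 1543 1240 [Cycle (Mat 51 23 46 51) (Form 2 (0) (-1)) 1543 4 4; Cycle (Mat 28 33 5 61) (Form 1 (2) (-1)) 1543 4
   4];
  Cert 1553 871 [Cycle (Mat 41 8 16 41) (Form 2 (0) (-1)) 1553 4 4; Cycle (Mat 66 25 25 33) (Form 2 (0) (-1)) 1553 4
   4];
  Cert 1567 28 [Cycle (Mat 55 27 54 55) (Form 2 (0) (-1)) 1567 4 4; Cycle (Mat 57 1 29 28) (Form 1 (-2) (-1)) 1567 4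
   4];
  Cert 1583 1467 [Cycle (Mat 41 7 14 41) (Form 2 (0) (-1)) 1583 4 4; Cycle (Mat 34 27 27 68) (Form 1 (0) (-2)) 1583 4
   4];
  Cert 1607 1532 [Cycle (Mat 43 11 22 43) (Form 2 (0) (-1)) 1607 4 4; Cycle (Mat 64 21 21 32) (Form 2 (0) (-1)) 1607
   4 4];
  Cert 1657 1000 [Cycle (Mat 53 24 48 53) (Form 2 (0) (-1)) 1657 4 4; Cycle (Mat 29 34 5 63) (Form 1 (2) (-1)) 1657 4
   4];
  Cert 1663 1379 [Cycle (Mat 41 3 6 41) (Form 2 (0) (-1)) 1663 4 4; Cycle (Mat 76 35 35 38) (Form 2 (0) (-1)) 1663 4
   4];
  Cert 1697 903 [Cycle (Mat 31 15 15 62) (Form 1 (0) (-2)) 1697 4 4; Cycle (Mat 31 16 16 63) (Form 1 (2) (-1)) 1697 4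
   4];
  Cert 1753 1216 [Cycle (Mat 49 18 36 49) (Form 2 (0) (-1)) 1753 4 4; Cycle (Mat 62 13 13 31) (Form 2 (0) (-1)) 1753
   4 4];
  Cert 1777 1033 [Cycle (Mat 43 6 12 43) (Form 2 (0) (-1)) 1777 4 4; Cycle (Mat 37 31 31 74) (Form 1 (0) (-2)) 1777 4
   4];
  Cert 1783 79 [Cycle (Mat 45 11 22 45) (Form 2 (0) (-1)) 1783 4 4; Cycle (Mat 34 57 23 91) (Form 1 (2) (-1)) 1783 4
   4];
  Cert 1823 484 [Cycle (Mat 32 15 15 64) (Form 1 (0) (-2)) 1823 4 4; Cycle (Mat 49 17 34 49) (Form 2 (0) (-1)) 1823 4
   4];
  Cert 1847 945 [Cycle (Mat 42 41 41 84) (Form 1 (0) (-2)) 1847 4 4; Cycle (Mat 44 1 1 42) (Form 1 (-2) (-1)) 1847 4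
   4];
  Cert 1873 272 [Cycle (Mat 55 24 48 55) (Form 2 (0) (-1)) 1873 4 4; Cycle (Mat 31 38 7 69) (Form 1 (2) (-1)) 1873 4
   4];
  Cert 1913 648 [Cycle (Mat 59 28 56 59) (Form 2 (0) (-1)) 1913 4 4; Cycle (Mat 31 3 3 62) (Form 1 (0) (-2)) 1913 4
   4];
  Cert 1993 1240 [Cycle (Mat 45 4 8 45) (Form 2 (0) (-1)) 1993 4 4; Cycle (Mat 82 37 37 41) (Form 2 (0) (-1)) 1993 4
   4]];
Group 29733 10000 [8; 15; 36; 59; 82; 109; 169; 214; 306; 461; 2762; 2892; 3251; 3381]%positive 30 60 24 [
  Cert 13 9 [Cycle (Mat 4 3 1 4) (Form 5 (1) (-11)) 65 6 6; Cycle (Mat 5 1 2 3) (Form 7 (-5) (-7)) 65 6 6];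
  Cert 43 36 [Cycle (Mat 7 6 1 7) (Form 7 (5) (-7)) 215 6 6; Cycle (Mat 14 3 9 5) (Form 5 (-11) (-5)) 215 6 6; Cycle
   (Mat 6 7 5 13) (Form 7 (9) (-5)) 215 6 6; Cycle (Mat 8 5 1 6) (Form 7 (5) (-7)) 215 6 6];
  Cert 53 48 [Cycle (Mat 5 2 1 11) (Form 5 (1) (-11)) 265 6 6; Cycle (Mat 11 6 4 7) (Form 7 (-5) (-7)) 265 6 6; Cycle
   (Mat 7 1 3 8) (Form 7 (5) (-7)) 265 6 6; Cycle (Mat 8 3 1 7) (Form 7 (-5) (-7)) 265 6 6];
  Cert 157 100 [Cycle (Mat 14 13 3 14) (Form 7 (5) (-7)) 785 6 6; Cycle (Mat 14 17 13 27) (Form 7 (9) (-5)) 785 6 6;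
   Cycle (Mat 10 1 3 16) (Form 5 (9) (-7)) 785 6 6; Cycle (Mat 13 3 4 13) (Form 11 (1) (-5)) 785 6 6];
  Cert 373 356 [Cycle (Mat 17 1 1 22) (Form 5 (-9) (-7)) 1865 6 6; Cycle (Mat 28 15 5 16) (Form 11 (1) (-5)) 1865 6
   6; Cycle (Mat 13 11 11 38) (Form 5 (9) (-7)) 1865 6 6; Cycle (Mat 16 15 5 28) (Form 7 (9) (-5)) 1865 6 6];
  Cert 443 141 [Cycle (Mat 20 19 3 25) (Form 5 (-1) (-11)) 2215 6 6; Cycle (Mat 21 19 1 22) (Form 5 (9) (-7)) 2215 6
   6; Cycle (Mat 20 3 19 25) (Form 5 (-9) (-7)) 2215 6 6; Cycle (Mat 22 23 19 40) (Form 7 (5) (-7)) 2215 6 6];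
  Cert 467 223 [Cycle (Mat 21 8 2 23) (Form 7 (9) (-5)) 2335 6 6; Cycle (Mat 15 22 4 37) (Form 5 (11) (-5)) 2335 6 6;
   Cycle (Mat 15 19 7 40) (Form 5 (9) (-7)) 2335 6 6; Cycle (Mat 21 2 8 23) (Form 7 (5) (-7)) 2335 6 6];
  Cert 523 503 [Cycle (Mat 20 17 1 27) (Form 5 (-1) (-11)) 2615 6 6; Cycle (Mat 20 1 17 27) (Form 5 (-9) (-7)) 2615 6
   6; Cycle (Mat 37 10 18 19) (Form 5 (-9) (-7)) 2615 6 6; Cycle (Mat 37 18 10 19) (Form 11 (-1) (-5)) 2615 6 6];
  Cert 563 122 [Cycle (Mat 28 9 9 23) (Form 5 (-9) (-7)) 2815 6 6; Cycle (Mat 23 9 9 28) (Form 7 (9) (-5)) 2815 6 6;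
   Cycle (Mat 29 10 22 27) (Form 11 (-1) (-5)) 2815 6 6; Cycle (Mat 23 14 14 33) (Form 7 (5) (-7)) 2815 6 6];
  Cert 757 158 [Cycle (Mat 26 19 19 43) (Form 7 (9) (-5)) 3785 6 6; Cycle (Mat 26 7 7 31) (Form 7 (5) (-7)) 3785 6 6;
   Cycle (Mat 24 7 5 33) (Form 5 (9) (-7)) 3785 6 6; Cycle (Mat 24 19 17 45) (Form 7 (5) (-7)) 3785 6 6];
  Cert 797 521 [Cycle (Mat 31 3 3 26) (Form 7 (9) (-5)) 3985 6 6; Cycle (Mat 23 20 5 39) (Form 7 (9) (-5)) 3985 6 6;
   Cycle (Mat 59 20 28 23) (Form 7 (-9) (-5)) 3985 6 6; Cycle (Mat 23 3 18 37) (Form 7 (5) (-7)) 3985 6 6];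
  Cert 883 158 [Cycle (Mat 28 19 11 39) (Form 7 (9) (-5)) 4415 6 6; Cycle (Mat 20 23 19 66) (Form 5 (11) (-5)) 4415 6
   6; Cycle (Mat 62 17 21 20) (Form 5 (-11) (-5)) 4415 6 6; Cycle (Mat 20 1 17 45) (Form 5 (1) (-11)) 4415 6 6];
  Cert 1277 461 [Cycle (Mat 37 5 11 36) (Form 11 (-1) (-5)) 6385 6 6; Cycle (Mat 88 27 57 32) (Form 5 (-11) (-5))
   6385 6 6; Cycle (Mat 32 25 27 61) (Form 5 (1) (-11)) 6385 6 6; Cycle (Mat 31 5 5 42) (Form 5 (11) (-5)) 6385 6 6];
  Cert 1283 911 [Cycle (Mat 38 23 7 38) (Form 5 (1) (-11)) 6415 6 6; Cycle (Mat 31 24 15 53) (Form 7 (5) (-7)) 6415 6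
   6; Cycle (Mat 53 15 24 31) (Form 7 (-5) (-7)) 6415 6 6; Cycle (Mat 45 7 16 31) (Form 5 (-11) (-5)) 6415 6 6];
  Cert 1427 1228 [Cycle (Mat 63 29 29 36) (Form 5 (-9) (-7)) 7135 6 6; Cycle (Mat 34 7 5 43) (Form 5 (9) (-7)) 7135 6
   6; Cycle (Mat 43 5 7 34) (Form 7 (-9) (-5)) 7135 6 6; Cycle (Mat 94 29 61 34) (Form 5 (-11) (-5)) 7135 6 6];
  Cert 1453 88 [Cycle (Mat 45 2 16 33) (Form 11 (1) (-5)) 7265 6 6; Cycle (Mat 67 17 17 26) (Form 7 (-9) (-5)) 7265 6
   6; Cycle (Mat 59 9 9 26) (Form 11 (-1) (-5)) 7265 6 6; Cycle (Mat 103 29 60 31) (Form 5 (-11) (-5)) 7265 6 6];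
  Cert 1483 448 [Cycle (Mat 46 15 33 43) (Form 11 (-1) (-5)) 7415 6 6; Cycle (Mat 31 10 16 53) (Form 5 (1) (-11))
   7415 6 6; Cycle (Mat 53 10 16 31) (Form 7 (-5) (-7)) 7415 6 6; Cycle (Mat 43 15 33 46) (Form 11 (1) (-5)) 7415 6
   6];
  Cert 1613 253 [Cycle (Mat 32 1 19 51) (Form 5 (1) (-11)) 8065 6 6; Cycle (Mat 32 19 1 51) (Form 7 (9) (-5)) 8065 6
   6; Cycle (Mat 37 13 4 45) (Form 5 (11) (-5)) 8065 6 6; Cycle (Mat 63 31 13 32) (Form 7 (-5) (-7)) 8065 6 6];
  Cert 1667 754 [Cycle (Mat 41 5 11 42) (Form 11 (1) (-5)) 8335 6 6; Cycle (Mat 73 31 31 36) (Form 11 (1) (-5)) 8335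
   6 6; Cycle (Mat 36 31 31 73) (Form 5 (-1) (-11)) 8335 6 6; Cycle (Mat 37 7 5 46) (Form 5 (9) (-7)) 8335 6 6];
  Cert 1733 1691 [Cycle (Mat 42 31 1 42) (Form 7 (5) (-7)) 8665 6 6; Cycle (Mat 30 43 19 85) (Form 5 (9) (-7)) 8665 6
   6; Cycle (Mat 41 11 40 53) (Form 7 (-5) (-7)) 8665 6 6; Cycle (Mat 47 17 28 47) (Form 11 (1) (-5)) 8665 6 6];
  Cert 1973 1908 [Cycle (Mat 42 19 31 61) (Form 7 (5) (-7)) 9865 6 6; Cycle (Mat 30 1 7 66) (Form 5 (-1) (-11)) 9865
   6 6; Cycle (Mat 53 64 23 65) (Form 5 (1) (-11)) 9865 6 6; Cycle (Mat 88 23 29 30) (Form 5 (-11) (-5)) 9865 6 6]];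
Group 29961 10000 [8; 15; 36; 59; 82; 109; 297; 470; 1226; 1330; 1356; 1715; 1741; 1845; 2726; 3417; 4810; 4914;
 5524; 6763; 7373; 7477; 9881; 11058; 13517; 14694; 21324; 22934; 26217; 27827; 43818; 45900; 46388; 51915; 52403;
 54485]%positive 30 60 24 [
  Cert 37 31 [Cycle (Mat 6 5 1 7) (Form 13 (-3) (-29)) 481 8 8; Cycle (Mat 6 1 5 7) (Form 17 (-19) (-17)) 481 8 8];
  Cert 83 15 [Cycle (Mat 8 1 5 11) (Form 17 (-15) (-19)) 1079 8 8; Cycle (Mat 10 3 9 11) (Form 19 (-15) (-17)) 1079 8
   8; Cycle (Mat 7 9 4 17) (Form 13 (29) (-13)) 1079 8 8; Cycle (Mat 14 3 5 7) (Form 19 (-23) (-13)) 1079 8 8];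
  Cert 107 68 [Cycle (Mat 10 1 3 11) (Form 17 (15) (-19)) 1391 8 8; Cycle (Mat 15 4 7 9) (Form 17 (-15) (-19)) 1391 8
   8; Cycle (Mat 10 7 9 17) (Form 19 (15) (-17)) 1391 8 8; Cycle (Mat 10 9 7 17) (Form 17 (19) (-17)) 1391 8 8];
  Cert 173 132 [Cycle (Mat 14 5 13 17) (Form 17 (-15) (-19)) 2249 8 8; Cycle (Mat 25 4 13 9) (Form 13 (-29) (-13))
   2249 8 8; Cycle (Mat 9 13 4 25) (Form 13 (29) (-13)) 2249 8 8; Cycle (Mat 21 10 10 13) (Form 13 (-23) (-19)) 2249
   8 8];
  Cert 197 183 [Cycle (Mat 14 13 1 15) (Form 13 (23) (-19)) 2561 8 8; Cycle (Mat 11 5 9 22) (Form 13 (3) (-29)) 2561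
   8 8; Cycle (Mat 19 2 6 11) (Form 19 (-23) (-13)) 2561 8 8; Cycle (Mat 17 6 4 13) (Form 17 (-15) (-19)) 2561 8 8];
  Cert 307 17 [Cycle (Mat 18 1 17 18) (Form 19 (-15) (-17)) 3991 8 8; Cycle (Mat 17 1 16 19) (Form 17 (-15) (-19))
   3991 8 8; Cycle (Mat 33 16 20 19) (Form 13 (-23) (-19)) 3991 8 8; Cycle (Mat 16 15 3 22) (Form 13 (3) (-29)) 3991
   8 8];
  Cert 613 464 [Cycle (Mat 30 13 29 33) (Form 29 (3) (-13)) 7969 8 8; Cycle (Mat 20 13 19 43) (Form 19 (23) (-13))
   7969 8 8; Cycle (Mat 29 5 5 22) (Form 19 (-15) (-17)) 7969 8 8; Cycle (Mat 37 4 4 17) (Form 29 (3) (-13)) 7969 8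
   8];
  Cert 677 81 [Cycle (Mat 29 6 8 25) (Form 13 (-23) (-19)) 8801 8 8; Cycle (Mat 40 19 17 25) (Form 17 (-15) (-19))
   8801 8 8; Cycle (Mat 31 6 6 23) (Form 19 (-15) (-17)) 8801 8 8; Cycle (Mat 31 29 13 34) (Form 13 (3) (-29)) 8801 8
   8];
  Cert 733 288 [Cycle (Mat 26 25 5 33) (Form 13 (-3) (-29)) 9529 8 8; Cycle (Mat 21 29 16 57) (Form 13 (29) (-13))
   9529 8 8; Cycle (Mat 25 9 13 34) (Form 19 (15) (-17)) 9529 8 8; Cycle (Mat 25 16 12 37) (Form 19 (23) (-13)) 9529
   8 8];
  Cert 787 25 [Cycle (Mat 37 12 30 31) (Form 29 (3) (-13)) 10231 8 8; Cycle (Mat 45 13 26 25) (Form 13 (-23) (-19))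
   10231 8 8; Cycle (Mat 24 5 1 33) (Form 13 (23) (-19)) 10231 8 8; Cycle (Mat 31 30 12 37) (Form 13 (-3) (-29))
   10231 8 8];
  Cert 877 100 [Cycle (Mat 31 8 26 35) (Form 19 (-15) (-17)) 11401 8 8; Cycle (Mat 38 15 15 29) (Form 13 (-23) (-19))
   11401 8 8; Cycle (Mat 59 15 32 23) (Form 13 (-29) (-13)) 11401 8 8; Cycle (Mat 35 8 26 31) (Form 29 (3) (-13))
   11401 8 8];
  Cert 1117 1084 [Cycle (Mat 33 5 1 34) (Form 17 (19) (-17)) 14521 8 8; Cycle (Mat 33 1 5 34) (Form 19 (15) (-17))
   14521 8 8; Cycle (Mat 61 32 28 33) (Form 19 (-15) (-17)) 14521 8 8; Cycle (Mat 65 24 32 29) (Form 17 (-19) (-17))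
   14521 8 8];
  Cert 1187 1151 [Cycle (Mat 36 1 1 33) (Form 19 (15) (-17)) 15431 8 8; Cycle (Mat 40 3 31 32) (Form 29 (-3) (-13))
   15431 8 8; Cycle (Mat 29 38 26 75) (Form 13 (23) (-19)) 15431 8 8; Cycle (Mat 49 20 46 43) (Form 29 (3) (-13))
   15431 8 8];
  Cert 1307 1095 [Cycle (Mat 37 2 31 37) (Form 17 (-15) (-19)) 16991 8 8; Cycle (Mat 29 19 6 49) (Form 13 (29) (-13))
   16991 8 8; Cycle (Mat 29 6 19 49) (Form 17 (19) (-17)) 16991 8 8; Cycle (Mat 41 34 11 41) (Form 13 (3) (-29))
   16991 8 8];
  Cert 1373 639 [Cycle (Mat 26 9 15 58) (Form 13 (-3) (-29)) 17849 8 8; Cycle (Mat 60 11 17 26) (Form 13 (-29) (-13))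
   17849 8 8; Cycle (Mat 43 17 28 43) (Form 29 (3) (-13)) 17849 8 8; Cycle (Mat 73 15 35 26) (Form 19 (-23) (-13))
   17849 8 8];
  Cert 1723 1527 [Cycle (Mat 41 9 9 44) (Form 13 (-23) (-19)) 22399 8 8; Cycle (Mat 53 9 50 41) (Form 29 (-3) (-13))
   22399 8 8; Cycle (Mat 32 23 3 56) (Form 17 (19) (-17)) 22399 8 8; Cycle (Mat 33 4 23 55) (Form 17 (15) (-19))
   22399 8 8];
  Cert 1877 1548 [Cycle (Mat 59 21 23 40) (Form 13 (-23) (-19)) 24401 8 8; Cycle (Mat 55 17 19 40) (Form 19 (-15)
   (-17)) 24401 8 8; Cycle (Mat 33 53 20 89) (Form 13 (23) (-19)) 24401 8 8; Cycle (Mat 46 29 13 49) (Form 13 (3)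
   (-29)) 24401 8 8]];
Group 3000223 1000000 [8; 15; 82; 109; 147; 182; 201; 236; 356; 411; 1226; 1356; 1715; 1845; 2381; 2857; 2905; 3238;
 3286; 3762; 5524; 6763; 10646; 11570; 13005; 13929; 19242; 21812; 27339; 29909; 51866; 87636; 108971; 349396;
 437035; 471885; 2446164; 3845291; 5593428; 6989483]%positive 30 60 24 [
  Cert 1987 608 [Cycle (Mat 44 13 13 49) (Form 81 (65) (-71)) 109285 22 22; Cycle (Mat 65 12 24 35) (Form 81 (-97)
   (-55)) 109285 22 22]];
Group 3004620 1000000 [8; 15; 82; 109; 147; 182; 201; 236; 356; 411; 1226; 1356; 1715; 1845; 2857; 3286; 4762; 4953;
 5524; 6763; 7334; 7525; 38196; 60107; 85298; 111309; 314674; 366164; 420267; 1464660; 1681067; 5026474; 5450922;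
 5591884; 6991027; 7556437; 7689817; 11742378; 13423445; 13456790; 22635860; 27695787]%positive 30 60 24 [
  Cert 1093 718 [Cycle (Mat 32 9 3 35) (Form 2683 (3217) (-1819)) 1988167 22 22; Cycle (Mat 66 31 35 33) (Form 1841
   (-3305) (-2573)) 1988167 22 22]];
Group 3004881 1000000 [8; 15; 82; 109; 147; 182; 201; 236; 356; 411; 1226; 1356; 1715; 1845; 4762; 4953; 7334; 7525;
 9620; 11049; 13526; 14955; 21908; 27243; 60107; 85298; 111309; 366164; 420267; 2446156; 3778219; 3845299; 19706537;
 30625110]%positive 30 60 24 [
  Cert 1787 1665 [Cycle (Mat 43 7 15 44) (Form 184 (19) (-82)) 146534 34 34; Cycle (Mat 33 13 25 64) (Form 112 (109)
   (-109)) 146534 34 34]];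
Group 30403 10000 [8; 15; 82; 109; 588; 612; 923; 947; 1178; 1380; 1427; 1458; 1613; 1644; 1691; 1893; 9522; 10644;
 13931; 15053; 22860; 22932; 26219; 26291]%positive 30 60 24 [
  Cert 227 108 [Cycle (Mat 11 2 2 21) (Form 11 (0) (-21)) 2270 11 11; Cycle (Mat 10 3 1 23) (Form 10 (2) (-23)) 2270
   11 11; Cycle (Mat 15 7 4 17) (Form 15 (18) (-10)) 2270 11 11; Cycle (Mat 13 5 4 19) (Form 13 (14) (-14)) 2270 11
   11];
  Cert 1213 287 [Cycle (Mat 38 11 21 38) (Form 21 (0) (-11)) 12130 11 11; Cycle (Mat 27 10 11 49) (Form 11 (22)
   (-10)) 12130 11 11; Cycle (Mat 29 43 19 70) (Form 10 (22) (-11)) 12130 11 11; Cycle (Mat 72 17 43 27) (Form 15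
   (-18) (-10)) 12130 11 11]];
Group 3043791 1000000 [8; 15; 82; 109; 588; 612; 923; 947; 1178; 1380; 1427; 1458; 1613; 1644; 1691; 1893; 9522;
 10644; 13931; 15053; 78633; 117974; 170388; 222827; 627916; 731545; 841318; 943723; 944947; 1414348; 1731379;
 2464076; 2511668; 3779787; 3827379; 5609804; 6973107]%positive 30 60 24 [
  Cert 277 200 [Cycle (Mat 16 1 11 18) (Form 35 (-29) (-29)) 6371 22 22; Cycle (Mat 12 7 5 26) (Form 25 (51) (-23))
   6371 22 22];
  Cert 283 233 [Cycle (Mat 17 1 6 17) (Form 53 (-5) (-23)) 6509 22 22; Cycle (Mat 17 4 10 19) (Form 49 (1) (-25))
   6509 22 22];
  Cert 1637 995 [Cycle (Mat 33 2 23 51) (Form 23 (-5) (-53)) 37651 22 22; Cycle (Mat 28 3 5 59) (Form 23 (-5) (-53))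
   37651 22 22];
  Cert 1907 1115 [Cycle (Mat 53 22 41 53) (Form 49 (1) (-25)) 43861 22 22; Cycle (Mat 31 9 12 65) (Form 23 (-5)
   (-53)) 43861 22 22]];
Group 30498 10000 [8; 15; 82; 109; 588; 612; 923; 947; 1380; 1427; 1644; 1691; 2356; 2916; 3227; 3787; 304723;
 481708; 627914; 878259; 944949]%positive 50 80 30 [
  Cert 997 224 [Cycle (Mat 35 13 31 40) (Form 289 (1) (-151)) 136589 34 34; Cycle (Mat 39 1 17 26) (Form 151 (-303)
   (-137)) 136589 34 34]];
Group 3086224 1000000 [8; 15; 146; 164; 219; 237; 330; 338; 429; 437; 612; 722; 813; 923; 5298; 5708; 6579; 6989;
 9418; 9619; 14956; 15157; 22836; 22884; 26267; 26315; 353492; 432939; 4895338; 6974635; 7687573; 11192746; 13973077;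
 13979029]%positive 50 80 30 [
  Cert 1123 1062 [Cycle (Mat 36 11 19 37) (Form 529937 (-8763) (-271099)) 275859335 30 30; Cycle (Mat 23 27 1 50)
   (Form 249031 (551825) (-271279)) 275859335 30 30; Cycle (Mat 67 20 41 29) (Form 271099 (-550961) (-250075))
   275859335 30 30; Cycle (Mat 26 15 17 53) (Form 245785 (-79679) (-578137)) 275859335 30 30]];
Group 3086277 1000000 [8; 15; 146; 164; 219; 237; 330; 338; 429; 437; 612; 722; 813; 923; 5298; 5708; 6579; 6989;
 9418; 9619; 14956; 15157; 22836; 22884; 26267; 26315; 353492; 432939; 480101; 4895338; 5608276; 6974635;
 7687573]%positive 30 60 24 [
  Cert 1747 1322 [Cycle (Mat 49 2 33 37) (Form 973 (-109) (-439)) 742475 18 18; Cycle (Mat 35 51 33 98) (Form 439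
   (769) (-643)) 742475 18 18; Cycle (Mat 42 31 29 63) (Form 583 (589) (-589)) 742475 18 18; Cycle (Mat 47 4 45 41)
   (Form 595 (-613) (-565)) 742475 18 18]];
Group 3089774 1000000 [8; 15; 146; 164; 219; 237; 330; 338; 429; 437; 612; 722; 813; 923; 5708; 6579; 42387; 55916;
 88372; 108235; 314150; 472281; 732314; 840549; 2829467; 3461988; 5083980; 7498931]%positive 30 60 24 [
  Cert 1237 358 [Cycle (Mat 35 3 31 38) (Form 947 (127) (-401)) 496037 16 16; Cycle (Mat 25 18 16 61) (Form 403 (135)
   (-941)) 496037 16 16]];
Group 3117358 1000000 [8; 15; 146; 164; 219; 237; 338; 429; 660; 722; 813; 875; 2644; 3499; 4708; 5290; 6997; 7579;
 9804; 10643; 10852; 13723; 13932; 14771; 22834; 23140; 26317; 353484; 432947; 1415476; 1730251; 2804122; 2804890;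
 3303115; 5661908; 6921003; 11899700; 13266123; 22647636; 23802474; 26529173; 27684011]%positive 30 60 24 [
  Cert 853 133 [Cycle (Mat 32 9 19 32) (Form 893 (-19) (-455)) 348877 16 16; Cycle (Mat 25 28 24 61) (Form 529 (527)
   (-637)) 348877 16 16; Cycle (Mat 22 13 19 50) (Form 413 (-135) (-973)) 348877 16 16; Cycle (Mat 60 11 37 21) (Form
   455 (-929) (-419)) 348877 16 16]];
Group 3119868 1000000 [8; 15; 146; 164; 219; 237; 338; 429; 660; 722; 813; 875; 4708; 7579; 19044; 30107; 39218;
 42572; 43411; 54892; 55731; 59085; 85146; 88370; 92563; 104044; 108237; 111461; 156876; 157260; 182676; 186674;
 206541; 210539; 235955; 236339; 338532; 353868; 432563; 681177; 707987; 864876; 891686; 2935194; 3356261]%positive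
 30 60 24 [
  Cert 397 290 [Cycle (Mat 17 3 15 26) (Form 17 (-29) (-29)) 6749 18 18; Cycle (Mat 23 2 20 19) (Form 29 (-29) (-17))
   6749 18 18];
  Cert 547 251 [Cycle (Mat 19 12 13 37) (Form 19 (-1) (-37)) 9299 18 18; Cycle (Mat 17 2 7 33) (Form 17 (29) (-29))
   9299 18 18];
  Cert 557 490 [Cycle (Mat 25 4 17 25) (Form 41 (-5) (-17)) 9469 18 18; Cycle (Mat 16 17 3 38) (Form 19 (39) (-17))
   9469 18 18];
  Cert 643 272 [Cycle (Mat 25 1 7 26) (Form 19 (-37) (-19)) 10931 18 18; Cycle (Mat 49 22 22 23) (Form 41 (5) (-17))
   10931 18 18];
  Cert 683 612 [Cycle (Mat 27 10 10 29) (Form 17 (-29) (-29)) 11611 18 18; Cycle (Mat 19 5 4 37) (Form 19 (1) (-37))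
   11611 18 18]];
Group 3124285 1000000 [8; 15; 146; 164; 219; 237; 338; 429; 660; 722; 813; 875; 39218; 59085; 75340; 121267; 150682;
 173644; 176740; 182675; 210540; 216475; 219571; 242533; 370252; 373348; 413083; 416179; 1218868; 1926859; 2410930;
 2712778; 2804116; 3487339; 3880525; 4875476; 4875477; 5937460; 6645451; 7707434; 7707435; 23409258;
 26922389]%positive 30 60 24 [
  Cert 1997 1467 [Cycle (Mat 47 9 34 49) (Form 393 (-46) (-176)) 337493 28 28; Cycle (Mat 40 53 31 91) (Form 176
   (306) (-263)) 337493 28 28]];
Group 3167601 1000000 [8; 15; 146; 164; 219; 237; 338; 429; 2890; 3253; 19756; 29395; 37707; 60596; 616804; 694874;
 877989; 956059; 1356978; 1788749; 11719370; 11850450; 13315373; 13446453]%positive 30 60 24 [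
  Cert 1597 1448 [Cycle (Mat 42 19 11 43) (Form 2287984 (-444814) (-5016673)) 3423520840 54 54; Cycle (Mat 73 13 40
   29) (Form 3204545 (-4135712) (-2262881)) 3423520840 54 54]];
Group 3173166 1000000 [8; 15; 146; 164; 219; 237; 594; 677; 858; 941; 1362; 1709; 2890; 2898; 3245; 3253; 603314;
 682340; 890523; 969549; 1389746; 1755981; 11850442; 13315381; 20239051; 30092596]%positive 30 60 24 [
  Cert 587 493 [Cycle (Mat 25 2 19 25) (Form 43 (-30) (-44)) 17023 20 20; Cycle (Mat 24 19 7 30) (Form 31 (-6) (-68))
   17023 20 20]];
Group 3192899 1000000 [8; 15; 146; 164; 219; 237; 594; 941; 1354; 1717; 2725; 3418; 4938; 5780; 6507; 7349; 39574;
 44330; 46380; 51923; 53973; 58729; 77099; 119508; 169621; 223594; 366229; 420202; 701612; 709812; 863051;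
 871251]%positive 30 60 24 [
  Cert 1163 161 [Cycle (Mat 36 19 7 36) (Form 31 (1) (-79)) 36053 10 10; Cycle (Mat 32 19 23 50) (Form 47 (31) (-47))
   36053 10 10; Cycle (Mat 31 9 12 41) (Form 47 (31) (-47)) 36053 10 10; Cycle (Mat 31 22 19 51) (Form 47 (63) (-31))
   36053 10 10];
  Cert 1693 1029 [Cycle (Mat 35 4 23 51) (Form 47 (-31) (-47)) 52483 10 10; Cycle (Mat 31 58 28 107) (Form 31 (61)
   (-49)) 52483 10 10; Cycle (Mat 79 28 27 31) (Form 79 (1) (-31)) 52483 10 10; Cycle (Mat 31 3 4 55) (Form 31 (61)
   (-49)) 52483 10 10];
  Cert 1867 1535 [Cycle (Mat 43 4 17 45) (Form 47 (31) (-47)) 57877 10 10; Cycle (Mat 41 4 15 47) (Form 43 (37)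
   (-49)) 57877 10 10; Cycle (Mat 61 5 17 32) (Form 49 (-37) (-43)) 57877 10 10; Cycle (Mat 69 37 26 41) (Form 47
   (-31) (-47)) 57877 10 10]];
Group 320026 100000 [8; 15; 146; 237; 659; 676; 859; 876; 1189; 1354; 1444; 1627; 1717; 1882; 2642; 3501; 5714; 5780;
 6507; 6573; 21804; 27347; 29397; 239019; 677044; 895819; 2708180; 3583275]%positive 30 60 24 [
  Cert 317 250 [Cycle (Mat 18 5 5 19) (Form 25 (-49) (-40)) 7925 22 22; Cycle (Mat 13 1 8 25) (Form 25 (-1) (-64))
   7925 22 22]];
Group 3204719 1000000 [8; 15; 146; 237; 676; 859; 1354; 1444; 1627; 1717; 2636; 3507; 5285; 7002; 9516; 9876; 11429;
 13146; 14699; 15059; 19034; 19817; 22164; 26987; 29334; 30117; 42194; 56109; 168780; 170580; 222635; 224435; 611506;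
 698724; 874139; 897739; 961357; 969557; 2779476; 3511979; 9753258; 9786058; 14047915; 15412565]%positive 50 80 30 [
  Cert 773 458 [Cycle (Mat 29 2 5 27) (Form 30553 (31749) (-28759)) 16221405 34 34; Cycle (Mat 25 2 1 31) (Form 27917
   (27935) (-33513)) 16221405 34 34]];
Group 320580 100000 [8; 15; 146; 237; 676; 859; 1354; 1444; 1627; 1717; 2636; 3507; 5285; 7002; 9516; 9876; 11429;
 13146; 14699; 15059; 38068; 60235; 170580; 222635; 305508; 480923; 677042; 895821; 3774125; 10832690; 23679692;
 26651955]%positive 30 60 24 [
  Cert 347 60 [Cycle (Mat 21 8 17 23) (Form 139 (10) (-62)) 20126 19 19; Cycle (Mat 13 6 5 29) (Form 58 (2) (-149))
   20126 19 19; Cycle (Mat 16 15 11 32) (Form 86 (86) (-79)) 20126 19 19; Cycle (Mat 34 5 19 13) (Form 89 (-118)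
   (-58)) 20126 19 19]];
Group 322599 100000 [8; 15; 146; 237; 676; 859; 1444; 1627; 2378; 2708; 3435; 3765; 5450; 6837; 46378; 51925; 316588;
 469843; 15510859]%positive 50 80 30 [
  Cert 827 114 [Cycle (Mat 29 2 7 29) (Form 4323995 (5404404) (-2701041)) 2233760907 35 35; Cycle (Mat 29 20 21 43)
   (Form 4075354 (2814470) (-4171631)) 2233760907 35 35; Cycle (Mat 47 9 23 22) (Form 3104842 (-6306750) (-2910747))
   2233760907 35 35; Cycle (Mat 41 15 5 22) (Form 6501215 (-485774) (-2910562)) 2233760907 35 35]];
Group 3250877 1000000 [16; 17; 30; 31; 39; 40; 55; 56; 292; 475; 586; 658; 676; 859; 877; 949; 1426; 1444; 1627;
 1645; 2348; 3795; 4756; 7531; 76370; 84564; 112043; 120237; 1222986; 1386836; 1758891; 1922741; 22324564;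
 28007083]%positive 50 80 30 [
  Cert 1933 294 [Cycle (Mat 44 7 13 46) (Form 1073 (1089) (-1083)) 1436219 20 20; Cycle (Mat 36 61 35 113) (Form 743
   (1497) (-1209)) 1436219 20 20; Cycle (Mat 53 1 28 37) (Form 1963 (11) (-743)) 1436219 20 20; Cycle (Mat 70 31 37
   44) (Form 1099 (-1057) (-1073)) 1436219 20 20]];
Group 328112 100000 [16; 17; 30; 31; 39; 40; 55; 56; 292; 475; 658; 676; 859; 877; 1172; 1899; 2346; 2468; 3675;
 3797; 5706; 6581; 9803; 14772; 22163; 22828; 26323; 26988; 38475; 44182; 54121; 59828; 75172; 87627; 108980; 121435;
 186956; 206259; 365266; 373338; 413093; 421165; 636058; 747828; 825035; 936805; 1495658; 1650069; 1874761; 10932844;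
 14232979]%positive 30 60 24 [
  Cert 653 423 [Cycle (Mat 29 21 20 37) (Form 29 (30) (-16)) 10448 12 12; Cycle (Mat 27 29 11 36) (Form 16 (-2)
   (-43)) 10448 12 12; Cycle (Mat 31 22 14 31) (Form 17 (-6) (-40)) 10448 12 12; Cycle (Mat 43 3 26 17) (Form 17
   (-40) (-17)) 10448 12 12];
  Cert 907 292 [Cycle (Mat 31 18 3 31) (Form 17 (6) (-40)) 14512 12 12; Cycle (Mat 44 13 25 28) (Form 16 (-30) (-29))
   14512 12 12; Cycle (Mat 34 37 15 43) (Form 17 (-6) (-40)) 14512 12 12; Cycle (Mat 19 6 4 49) (Form 17 (6) (-40))
   14512 12 12]];
Group 328698 100000 [16; 31; 34; 35; 40; 55; 60; 61; 88; 103; 292; 475; 676; 859; 1172; 1899; 2634; 2635; 3508; 3509;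
 5706; 5778; 6509; 6581; 39212; 39500; 42643; 55660; 58803; 59091; 79002; 84388; 88364; 91795; 104812; 108243;
 112219; 117605; 154188; 182628; 182692; 186668; 206547; 210523; 210587; 239027; 340570; 445861; 612940; 627410;
 945453; 1467572; 1678155; 2935146; 2976050; 3315405; 3356309]%positive 50 80 30 [
  Cert 1627 736 [Cycle (Mat 39 1 11 42) (Form 6641 (-13221) (-6769)) 9321083 22 22; Cycle (Mat 43 1 7 38) (Form 14617
   (-1841) (-6007)) 9321083 22 22; Cycle (Mat 34 11 19 54) (Form 6647 (49) (-13337)) 9321083 22 22; Cycle (Mat 47 12
   25 41) (Form 15101 (309) (-5869)) 9321083 22 22]];
Group 3322674 1000000 [16; 31; 34; 40; 55; 61; 70; 88; 103; 121; 184; 199; 292; 475; 1188; 1883; 2634; 3509; 10898;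
 11412; 13163; 13677; 23186; 25965; 39210; 59093; 76364; 84627; 111980; 120243; 152730; 174386; 174668; 176724;
 216491; 218547; 218829; 240485; 371276; 415155; 1222964; 1231188; 1914539; 1922763; 4809898; 7773013; 10850986;
 11101354; 14064469; 14314837; 21669076; 28662571; 30726829]%positive 30 60 24 [
  Cert 1523 1082 [Cycle (Mat 41 5 7 38) (Form 5875 (-5582) (-5849)) 5951884 22 22; Cycle (Mat 43 42 18 53) (Form 4181
   (-1428) (-9960)) 5951884 22 22; Cycle (Mat 59 21 23 34) (Form 5928 (-6132) (-5525)) 5951884 22 22; Cycle (Mat 25
   32 11 75) (Form 4013 (8022) (-6495)) 5951884 22 22]];
Group 3324563 1000000 [16; 31; 34; 40; 55; 61; 70; 88; 103; 121; 184; 199; 292; 475; 1188; 1883; 2634; 3509; 10898;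
 11412; 13163; 13677; 23186; 25965; 76364; 78420; 118187; 120243; 301354; 305740; 480691; 485077; 694570; 698956;
 873907; 874188; 874189; 878293; 891733; 1231186; 1354036; 1467562; 1678165; 1791691; 1914541; 9619795; 9802404;
 15363419; 15546028; 15555371; 22202707; 28128940]%positive 30 60 24 [
  Cert 947 122 [Cycle (Mat 35 6 23 31) (Form 701 (78) (-318)) 269895 18 18; Cycle (Mat 21 13 16 55) (Form 293 (2)
   (-766)) 269895 18 18; Cycle (Mat 37 3 5 26) (Form 526 (546) (-285)) 269895 18 18; Cycle (Mat 29 20 15 43) (Form
   478 (594) (-285)) 269895 18 18]];
Group 3337330 1000000 [16; 31; 34; 40; 55; 61; 70; 88; 103; 121; 184; 199; 292; 475; 4754; 5268; 7019; 7533; 19090;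
 30061; 43306; 43594; 43666; 54637; 54709; 54997; 78418; 84556; 112051; 118189; 184916; 208299; 235221; 300186;
 313932; 353444; 354602; 369834; 371275; 415156; 416597; 431829; 432987; 472499; 486245; 682642; 747818; 825045;
 890221; 1386804; 1758923; 2462356; 2517650; 2935116; 2962003; 3329452; 3356339; 3829099; 4924714; 5425482; 7157429;
 7658197; 19698860; 30632787]%positive 30 60 24 [
  Cert 293 262 [Cycle (Mat 17 3 10 19) (Form 203 (-20) (-94)) 24319 14 14; Cycle (Mat 27 2 2 11) (Form 213 (-30)
   (-89)) 24319 14 14; Cycle (Mat 28 3 5 11) (Form 213 (-30) (-89)) 24319 14 14; Cycle (Mat 13 20 12 41) (Form 86
   (168) (-141)) 24319 14 14; Cycle (Mat 11 5 3 28) (Form 89 (30) (-213)) 24319 14 14; Cycle (Mat 22 5 3 14) (Form 94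
   (-168) (-129)) 24319 14 14; Cycle (Mat 17 5 6 19) (Form 86 (-168) (-141)) 24319 14 14; Cycle (Mat 14 27 13 46)
   (Form 94 (208) (-89)) 24319 14 14];
  Cert 1493 1170 [Cycle (Mat 43 7 14 37) (Form 231 (-6) (-83)) 123919 14 14; Cycle (Mat 37 7 14 43) (Form 203 (20)
   (-94)) 123919 14 14; Cycle (Mat 53 12 39 37) (Form 223 (4) (-86)) 123919 14 14; Cycle (Mat 45 4 43 37) (Form 133
   (-176) (-86)) 123919 14 14; Cycle (Mat 25 39 13 80) (Form 86 (176) (-133)) 123919 14 14; Cycle (Mat 43 32 38 63)
   (Form 154 (148) (-89)) 123919 14 14; Cycle (Mat 83 47 53 48) (Form 83 (-172) (-142)) 123919 14 14; Cycle (Mat 80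
   43 49 45) (Form 129 (-90) (-133)) 123919 14 14]];
Group 340944 100000 [16; 31; 34; 40; 55; 61; 88; 103; 184; 199; 281; 486; 627; 908; 2340; 2633; 3510; 3803; 5412;
 6875; 11410; 11556; 13019; 13165; 23698; 25453; 78412; 118195; 156826; 170278; 176716; 216499; 222937; 236389;
 366886; 373324; 413107; 419545]%positive 50 80 30 [
  Cert 1013 727 [Cycle (Mat 35 11 32 39) (Form 373 (-38) (-172)) 150937 28 28; Cycle (Mat 49 1 16 21) (Form 284
   (-270) (-163)) 150937 28 28]];
Group 34266 10000 [16; 31; 34; 40; 55; 61; 88; 103; 184; 199; 5266; 7021; 18726; 22820; 26331; 35986; 62317; 176714;
 184908; 208307; 216501]%positive 50 80 30 [
  Cert 163 152 [Cycle (Mat 11 2 1 15) (Form 63 (-117) (-119)) 9943 12 12; Cycle (Mat 18 7 5 11) (Form 161 (-23)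
   (-67)) 9943 12 12; Cycle (Mat 22 7 5 9) (Form 153 (15) (-71)) 9943 12 12; Cycle (Mat 13 4 8 15) (Form 161 (23)
   (-67)) 9943 12 12]];
Group 3469 1000 [16; 31; 34; 40; 55; 61; 88; 103; 184; 199]%positive 30 60 24 [
  Cert 3 1 [Cycle (Mat 2 1 1 2) (Form 2 (2) (-1)) 3 3 3; Cycle (Mat 1 0 0 3) (Form 1 (0) (-3)) 3 3 3]];
Group 3678222 1000000 [16; 31; 40; 55; 68; 123; 280; 305; 354; 413; 462; 487; 710; 738; 797; 825; 4807; 5004; 7283;
 7480; 18202; 30949; 85556; 87608; 108999; 111051; 176582; 185912; 207303; 216633; 403911; 604372; 612580; 960283;
 968491; 1350762; 2439380; 3852075; 11126436; 11710922; 13454901; 13995606; 14039387]%positive 30 60 24 [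
  Cert 67 60 [Cycle (Mat 7 3 1 10) (Form 23 (-25) (-71)) 1541 14 14; Cycle (Mat 7 1 3 10) (Form 41 (-33) (-37)) 1541
   14 14; Cycle (Mat 19 8 13 9) (Form 37 (-41) (-37)) 1541 14 14; Cycle (Mat 5 4 2 15) (Form 29 (49) (-41)) 1541 14
   14]]].

(** Since 47^2 exceeds 2000, every composite number below 2000 has a prime factor in the list. *)
Definition covered (n : Z) : bool :=
  existsb (fun d => (1 <? d) && (d <? n) && (n mod d =? 0)) [2; 3; 5; 7; 11; 13; 17; 19; 23; 29; 31; 37; 41; 43]
  || existsb (fun g => existsb (fun ct => ct_p ct =? n) (g_certs g)) groups.

(** All searches are run here; [vm_cast_no_check] defers the evaluation to the final check of the
    proof term, so that it happens only once. *)
Lemma groups_checked : forallb check_group groups = true.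
Proof. vm_cast_no_check (eq_refl true). Qed.
Lemma all_covered : forallb covered (walk Z.succ 1998 2) = true.
Proof. vm_cast_no_check (eq_refl true). Qed.

Lemma in_walk (n : nat) (a k : Z) : a <= k < a + Z.of_nat n -> In k (walk Z.succ n a).
Proof.
  revert a; induction n as [|n IH]; intros a H; [lia|]. simpl.
  destruct (Z.eq_dec a k); [now left|right]. apply IH. lia.
Qed.

Open Scope R_scope.

Theorem theorem1p2 :
  forall p : Z, prime p -> (p < 2000)%Z ->
  exists m : R,
    (* m is the least element of L_p *)
    lagrange_spectrum p m /\
    (forall x : R, lagrange_spectrum p x -> m <= x) /\
    (* m is an isolated point of L_p *)
    (exists eps : R, 0 < eps /\
       forall x : R, lagrange_spectrum p x -> Rabs (x - m) < eps -> x = m) /\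
    (* m is the irrational square root of a rational number *)
    irrational m /\
    (exists a b : Z, (0 < b)%Z /\ m = sqrt (IZR a / IZR b)).
Proof.
  intros p Hp L. assert (P2 := prime_ge_2 p Hp).
  assert (H := all_covered). rewrite forallb_forall in H.
  specialize (H p (in_walk 1998 2 p ltac:(lia))). unfold covered in H.
  apply orb_true_iff in H as [H|H]; apply existsb_exists in H as (d & Hd & H).
  - rewrite !andb_true_iff, !Z.ltb_lt, Z.eqb_eq in H. destruct H as [[H1 H2] H3].
    apply Z.mod_divide in H3; [|lia]. destruct (prime_divisors p Hp d H3) as [|[|[|]]]; lia.
  - apply existsb_exists in H as (ct & Hct & H). apply Z.eqb_eq in H. subst p.
    assert (G := groups_checked). rewrite forallb_forall in G.
    exact (check_cert_sound d ct (G d Hd) Hct Hp).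
Qed.
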